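(* Let $(\phi_t)$ be a one-parameter semigroup in $\mathbb D$ with infinitesimal generator $G$ and Kœnigs function $h$. Suppose $x\in\partial\mathbb D$ is a regular singularity of $G$ of order $\alpha\in[-1,1)\setminus\{0\}$. Then $h(x)\in\mathbb C$, the limit $\nu:=\lim_{r\to1^-}\frac{h(x)-h(rx)}{|h(x)-h(rx)|}$ exists, and with $S(\theta,\rho):=\{h(x)-\nu\varrho e^{i\vartheta}:|\vartheta|<\theta/2,\ 0<\varrho<\rho\}$: (i) for every $\theta\in(0,(1-\alpha)\pi)$ there is $\rho>0$ with $S(\theta,\rho)\subset h(\mathbb D)$; (ii) for every $\theta>(1-\alpha)\pi$ and every $\rho>0$, $S(\theta,\rho)\not\subset h(\mathbb D)$.
   Context: One-parameter semigroup $(\phi_t)$ in $\mathbb D$: continuous homomorphism from $([0,\infty),+)$ to holomorphic self-maps of $\mathbb D$ under composition, none an automorphism for $t>0$; generator $G$ with $\partial_t\phi_t=G\circ\phi_t$; Denjoy–Wolff point $\tau=\lim_{t\to\infty}\phi_t$. Kœnigs function: the univalent $h$ with $h(\tau)=0,h'(\tau)=1,h\circ\phi_t=e^{G'(\tau)t}h$ if $\tau\in\mathbb D$, and $h(0)=0$, $h\circ\phi_t=h+t$ if $\tau\in\partial\mathbb D$; $h(x)$ is its angular limit at $x$. $G$ has a regular singularity of order $\alpha$ at $x$ if $\lim_{r\to1^-}G(rx)/(1-r)^\alpha$ exists in $\mathbb C\setminus\{0\}$. *)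

(* Defs.v *)
From Stdlib Require Export Reals.
Open Scope R_scope.

Definition Cx : Type := (R * R)%type.
Definition RtoC (r : R) : Cx := (r, 0).
Definition Ci : Cx := (0, 1).
Definition Cadd (z w : Cx) : Cx := (fst z + fst w, snd z + snd w).
Definition Copp (z : Cx) : Cx := (- fst z, - snd z).
Definition Csub (z w : Cx) : Cx := Cadd z (Copp w).
Definition Cmul (z w : Cx) : Cx :=
  (fst z * fst w - snd z * snd w, fst z * snd w + snd z * fst w).
Definition Cscal (r : R) (z : Cx) : Cx := (r * fst z, r * snd z).
Definition Cmod (z : Cx) : R := sqrt (fst z * fst z + snd z * snd z).
Definition Cinv (z : Cx) : Cx :=
  let n := fst z * fst z + snd z * snd z in (fst z / n, - snd z / n).
Definition Cdiv (z w : Cx) : Cx := Cmul z (Cinv w).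
Definition Cexp (z : Cx) : Cx := (exp (fst z) * cos (snd z), exp (fst z) * sin (snd z)).

Definition inD (z : Cx) : Prop := Cmod z < 1.

Definition is_Cderiv (f : Cx -> Cx) (z d : Cx) : Prop :=
  forall eps, 0 < eps -> exists delta, 0 < delta /\
    forall w, inD w -> Cmod (Csub w z) < delta ->
      Cmod (Csub (Csub (f w) (f z)) (Cmul d (Csub w z))) <= eps * Cmod (Csub w z).

Definition holo_on_D (f : Cx -> Cx) : Prop :=
  forall z, inD z -> exists d, is_Cderiv f z d.

Definition univalent_on_D (f : Cx -> Cx) : Prop :=
  holo_on_D f /\ forall z w, inD z -> inD w -> f z = f w -> z = w.

Definition is_automorphism_D (f : Cx -> Cx) : Prop :=
  holo_on_D f /\ (forall z, inD z -> inD (f z)) /\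
  (forall z w, inD z -> inD w -> f z = f w -> z = w) /\
  (forall w, inD w -> exists z, inD z /\ f z = w).

(** One-parameter semigroup of holomorphic self-maps of D (phi t defined for t >= 0);
    continuity w.r.t. locally uniform convergence on D (compacts of D lie in
    closed discs |z| <= r < 1). *)
Definition is_semigroup (phi : R -> Cx -> Cx) : Prop :=
  (forall t, 0 <= t -> holo_on_D (phi t)) /\
  (forall t z, 0 <= t -> inD z -> inD (phi t z)) /\
  (forall z, inD z -> phi 0 z = z) /\
  (forall s t z, 0 <= s -> 0 <= t -> inD z -> phi (s + t) z = phi s (phi t z)) /\
  (forall r t0, 0 <= r < 1 -> 0 <= t0 -> forall eps, 0 < eps ->
     exists delta, 0 < delta /\ forall t z, 0 <= t -> Rabs (t - t0) < delta ->
       Cmod z <= r -> Cmod (Csub (phi t z) (phi t0 z)) < eps) /\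
  (forall t, 0 < t -> ~ is_automorphism_D (phi t)).

Definition is_generator (phi : R -> Cx -> Cx) (G : Cx -> Cx) : Prop :=
  forall t z, 0 <= t -> inD z -> forall eps, 0 < eps -> exists delta, 0 < delta /\
    forall s, 0 <= s -> Rabs (s - t) < delta ->
      Cmod (Csub (Csub (phi s z) (phi t z)) (Cscal (s - t) (G (phi t z))))
        <= eps * Rabs (s - t).

Definition is_DW_point (phi : R -> Cx -> Cx) (tau : Cx) : Prop :=
  Cmod tau <= 1 /\
  forall z, inD z -> forall eps, 0 < eps -> exists T,
    forall t, T <= t -> Cmod (Csub (phi t z) tau) < eps.

Definition is_Koenigs (phi : R -> Cx -> Cx) (G : Cx -> Cx) (tau : Cx) (h : Cx -> Cx) : Prop :=
  univalent_on_D h /\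
  ((inD tau /\ exists gp, is_Cderiv G tau gp /\
       h tau = RtoC 0 /\ is_Cderiv h tau (RtoC 1) /\
       forall t z, 0 <= t -> inD z ->
         h (phi t z) = Cmul (Cexp (Cscal t gp)) (h z))
   \/
   (Cmod tau = 1 /\ h (RtoC 0) = RtoC 0 /\
       forall t z, 0 <= t -> inD z -> h (phi t z) = Cadd (h z) (RtoC t))).

(** angular (non-tangential) limit of f at x in the boundary: limit L along
    every Stolz angle { z in D : |x - z| < M (1 - |z|) }, M > 1 *)
Definition angular_limit (f : Cx -> Cx) (x L : Cx) : Prop :=
  forall M, 1 < M -> forall eps, 0 < eps -> exists delta, 0 < delta /\
    forall z, inD z -> Cmod (Csub x z) < M * (1 - Cmod z) ->
      Cmod (Csub z x) < delta -> Cmod (Csub (f z) L) < eps.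

Definition lim_left1 (g : R -> Cx) (L : Cx) : Prop :=
  forall eps, 0 < eps -> exists delta, 0 < delta /\
    forall r, 1 - delta < r < 1 -> Cmod (Csub (g r) L) < eps.

Definition regular_singularity (G : Cx -> Cx) (x : Cx) (alpha : R) : Prop :=
  exists L, L <> RtoC 0 /\
    lim_left1 (fun r => Cdiv (G (Cscal r x)) (RtoC (Rpower (1 - r) alpha))) L.

Definition sector_in_image (h : Cx -> Cx) (hx nu : Cx) (theta rho : R) : Prop :=
  forall th r, Rabs th < theta / 2 -> 0 < r < rho ->
    exists z, inD z /\
      h z = Csub hx (Cmul nu (Cscal r (Cexp (Cmul Ci (RtoC th))))).

(* Main.v *)
Require Import Defs.
From Stdlib Require Import Reals Lra Lia ClassicalEpsilon.
From Coquelicot Require Import Coquelicot.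
Open Scope R_scope.

(** Both cases of the Koenigs equation read [h' G = c1 + c2 h]. Write points near [x] as
    [x (1 - e^w)] with [w] in the strip [|Im w| < pi / 2], so that Stolz angles become narrower strips
    and [x] becomes [Re w = -oo]. The Schwarz-Pick inequality for [phi_t], differentiated at [t = 0],
    expresses [G] through a function with nonnegative real part, so Harnack's inequality carries the
    bound [|G| = O(|e^(alpha w)|)] from the radius to every Stolz angle; a Lindelof argument then
    upgrades the radial limit [G e^(-alpha w) -> L] to Stolz angles. Integrating the differential
    equation gives [h = h(x) + c e^(p w) (1 + o(1))] there, with [p = 1 - alpha]. This yields the angular
    limit and the direction [nu]; by the minimum modulus principle it shows that sectors of angle less
    than [p pi] are covered. Conversely, if a sector of angle [q pi] lies in the image, then [h^-1]
    composed with a [q]-th power map is a self-map of the disc, and the infinitesimal Schwarz-Pick lemma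
    forces [q <= p]. *)

(** The generator is given only as the time derivative of the semigroup, so its holomorphy has to be
    produced: the differential equation is solved for it, [G = (c1 + c2 h) / h'], which requires
    [h'] to be holomorphic and without zeros. The first is the reason for developing Cauchy theory
    from Goursat's theorem; the second is read off from the equation itself, whose right-hand side
    is 1 in the boundary case and a nonzero multiple of [h] in the interior case, where [h] vanishes
    only at [tau] and has derivative 1 there. The exponent [p] arises because [dz/dw = - x e^w]
    while [G] behaves like [L e^(alpha w)], so that the [w]-derivative of [h] behaves like a
    constant times [e^((1 - alpha) w)]. This weight is integrable at [Re w = -oo] because
    [alpha < 1], and a Gronwall estimate then keeps [c1 + c2 h] away from 0 along the ray, which
    gives [c <> 0]. Asymptotics of [h'] are carried along with those of [h], since the upper bound
    on the opening uses the derivative form of Schwarz-Pick. *)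

Lemma Cmod_minus_sym (a b : C) : Cmod (a - b) = Cmod (b - a).
Proof. rewrite <- (Cmod_opp (a - b)). f_equal. ring. Qed.

Lemma Cmod_minus_le (a b : C) : Cmod a - Cmod b <= Cmod (a - b).
Proof.
  pose proof (Cmod_triangle (a - b) b) as H. replace (a - b + b)%C with a in H by ring. lra.
Qed.

Lemma Cmod_minus_triangle (a b : C) : Cmod (a - b) <= Cmod a + Cmod b.
Proof. unfold Cminus. rewrite <- (Cmod_opp b). apply Cmod_triangle. Qed.

Lemma Cmod_split (a b c : C) : Cmod (a - c) <= Cmod (a - b) + Cmod (b - c).
Proof. replace (a - c)%C with ((a - b) + (b - c))%C by ring. apply Cmod_triangle. Qed.

Lemma Cmod_sq (z : C) : Cmod z * Cmod z = fst z * fst z + snd z * snd z.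
Proof.
  unfold Cmod. rewrite sqrt_sqrt; [ring|]. nra.
Qed.

Lemma Cmod_sum_abs (z : C) : Cmod z <= Rabs (fst z) + Rabs (snd z).
Proof.
  pose proof (Rabs_pos (fst z)); pose proof (Rabs_pos (snd z)).
  apply Rsqr_incr_0_var; [|lra]. unfold Rsqr. rewrite Cmod_sq. assert (E1 : forall u, Rabs u * Rabs u = u * u)
    by (intro u; rewrite <- Rabs_mult; apply Rabs_pos_eq; nra).
  rewrite <- (E1 (fst z)), <- (E1 (snd z)). nra.
Qed.

Lemma Rabs_fst_le (z : C) : Rabs (fst z) <= Cmod z.
Proof. apply (re_le_Cmod z). Qed.

Lemma Rabs_snd_le (z : C) : Rabs (snd z) <= Cmod z.
Proof. eapply Rle_trans; [apply Rmax_r | apply Rmax_Cmod]. Qed.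

Lemma Cmod_RtoC_pos (r : R) : 0 <= r -> Cmod r = r.
Proof. intro. rewrite Cmod_R. now apply Rabs_pos_eq. Qed.

Lemma Cmod_diag (z : C) : Cmod (z - z) = 0.
Proof. replace (z - z)%C with (RtoC 0) by ring. apply Cmod_0. Qed.

Lemma RtoC_neq0 (r : R) : r <> 0 -> RtoC r <> RtoC 0.
Proof. intros N E. now apply RtoC_inj in E. Qed.

Lemma Rmin_bounds (a b : R) : Rmin a b <= a /\ Rmin a b <= b.
Proof. split; [apply Rmin_l|apply Rmin_r]. Qed.

Lemma Cmod_sub_eq0 (a b : C) : Cmod (a - b) = 0 -> a = b.
Proof. intro H. apply Cmod_eq_0 in H. now apply Ceq_minus. Qed.

Lemma Cminus_neq0 (a b : C) : a <> b -> (a - b)%C <> 0.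
Proof. apply Cminus_eq_contra. Qed.

Lemma Cmod_le_all_eps (a b : C) (K : R) :
  (forall eps, 0 < eps -> Cmod (a - b) <= eps * K) -> a = b.
Proof.
  intro H. apply Cmod_sub_eq0. destruct (Req_dec (Cmod (a - b)) 0) as [|N]; [assumption|exfalso].
  pose proof (Cmod_ge_0 (a - b)). assert (P : 0 < Cmod (a - b)) by lra. destruct (Rle_lt_dec K 0).
  - specialize (H 1 Rlt_0_1). lra.
  - specialize (H (Cmod (a - b) / (2 * K))).
    assert (0 < Cmod (a - b) / (2 * K)) by (apply Rdiv_lt_0_compat; lra).
    specialize (H H1). replace (Cmod (a - b) / (2 * K) * K) with (Cmod (a - b) / 2) in H by (field; lra). lra.
Qed.

(** * Continuity and complex differentiability *)

Definition ccont (f : C -> C) (z : C) : Prop :=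
  forall eps, 0 < eps -> exists d, 0 < d /\
    forall w, Cmod (w - z) < d -> Cmod (f w - f z) < eps.

(** Full neighbourhoods in the plane replace the restriction to the disc made in [is_Cderiv]; the
    two notions agree at interior points. The product form of the remainder needs no exception at
    [w = z]. *)
Definition cdiff (f : C -> C) (z d : C) : Prop :=
  forall eps, 0 < eps -> exists delta, 0 < delta /\
    forall w, Cmod (w - z) < delta ->
      Cmod (f w - f z - d * (w - z)) <= eps * Cmod (w - z).

Lemma ccont_const (c z : C) : ccont (fun _ => c) z.
Proof.
  intros e He. exists 1. split; [lra|]. intros w _. now rewrite Cmod_diag.
Qed.

Lemma ccont_id (z : C) : ccont (fun w => w) z.
Proof. intros e He. exists e. auto. Qed.

Lemma ccont_ext_loc (f g : C -> C) (z : C) (r : R) :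
  0 < r -> (forall w, Cmod (w - z) < r -> f w = g w) -> ccont f z -> ccont g z.
Proof.
  intros Hr E H e He. destruct (H e He) as [d [Hd K]].
  exists (Rmin d r). split; [now apply Rmin_pos|]. intros w Hw. rewrite <- !E.
  - apply K. eapply Rlt_le_trans; [exact Hw | apply Rmin_l].
  - now rewrite Cmod_diag.
  - eapply Rlt_le_trans; [exact Hw | apply Rmin_r].
Qed.

Lemma ccont_plus (f g : C -> C) (z : C) :
  ccont f z -> ccont g z -> ccont (fun w => f w + g w)%C z.
Proof.
  intros Hf Hg e He. destruct (Hf (e / 2)) as [d1 [D1 K1]]; [lra|].
  destruct (Hg (e / 2)) as [d2 [D2 K2]]; [lra|]. exists (Rmin d1 d2). split; [now apply Rmin_pos|]. intros w Hw.
  destruct (Rmin_Rgt_l _ _ _ Hw) as [W1 W2]. specialize (K1 w W1). specialize (K2 w W2).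
  replace (f w + g w - (f z + g z))%C with ((f w - f z) + (g w - g z))%C by ring.
  eapply Rle_lt_trans; [apply Cmod_triangle|]. lra.
Qed.

Lemma ccont_mult (f g : C -> C) (z : C) :
  ccont f z -> ccont g z -> ccont (fun w => f w * g w)%C z.
Proof.
  intros Hf Hg e He. set (M := Cmod (f z) + Cmod (g z) + 1).
  assert (HM : 0 < M) by (pose proof (Cmod_ge_0 (f z)); pose proof (Cmod_ge_0 (g z)); unfold M; lra).
  set (e' := Rmin 1 (e / (3 * M))).
  assert (He' : 0 < e') by (apply Rmin_pos; [lra|apply Rdiv_lt_0_compat; lra]).
  destruct (Hf e' He') as [d1 [D1 K1]]. destruct (Hg e' He') as [d2 [D2 K2]].
  exists (Rmin d1 d2). split; [now apply Rmin_pos|]. intros w Hw.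
  destruct (Rmin_Rgt_l _ _ _ Hw) as [W1 W2]. specialize (K1 w W1). specialize (K2 w W2).
  replace (f w * g w - f z * g z)%C
    with ((f w - f z) * (g w - g z) + (f w - f z) * g z + f z * (g w - g z))%C by ring.
  eapply Rle_lt_trans; [apply Cmod_triangle|]. eapply Rle_lt_trans; [apply Rplus_le_compat_r, Cmod_triangle|].
  rewrite !Cmod_mult. pose proof (Cmod_ge_0 (f z)); pose proof (Cmod_ge_0 (g z)).
  pose proof (Cmod_ge_0 (f w - f z)); pose proof (Cmod_ge_0 (g w - g z)). assert (e' <= 1) by apply Rmin_l.
  assert (e' * (3 * M) <= e).
  { apply Rle_trans with (e / (3 * M) * (3 * M)).
    - apply Rmult_le_compat_r; [lra| apply Rmin_r].
    - right. field. lra. }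
  unfold M in *. nra.
Qed.

Lemma ccont_opp (f : C -> C) (z : C) : ccont f z -> ccont (fun w => - f w)%C z.
Proof.
  intro H. apply (ccont_ext_loc (fun w => (- (1)) * f w)%C _ z 1); [lra| |].
  - intros. ring.
  - apply ccont_mult; [apply ccont_const | exact H].
Qed.

Lemma ccont_minus (f g : C -> C) (z : C) :
  ccont f z -> ccont g z -> ccont (fun w => f w - g w)%C z.
Proof. intros. apply ccont_plus; [|apply ccont_opp]; assumption. Qed.

Lemma ccont_comp (f g : C -> C) (z : C) :
  ccont f z -> ccont g (f z) -> ccont (fun w => g (f w)) z.
Proof.
  intros Hf Hg e He. destruct (Hg e He) as [d [Hd K]]. destruct (Hf d Hd) as [d' [Hd' K']]. exists d'. auto.
Qed.

Lemma ccont_neq0 (f : C -> C) (z : C) : ccont f z -> f z <> 0 ->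
  exists d, 0 < d /\ forall w, Cmod (w - z) < d -> Cmod (f z) / 2 < Cmod (f w).
Proof.
  intros Hf N. apply Cmod_gt_0 in N. destruct (Hf (Cmod (f z) / 2)) as [d [Hd K]]; [lra|].
  exists d. split; [exact Hd|]. intros w Hw. specialize (K w Hw).
  pose proof (Cmod_minus_le (f z) (f w)). rewrite Cmod_minus_sym in H. lra.
Qed.

Lemma ccont_inv (f : C -> C) (z : C) :
  ccont f z -> f z <> 0 -> ccont (fun w => / f w)%C z.
Proof.
  intros Hf N e He. destruct (ccont_neq0 f z Hf N) as [d1 [D1 K1]]. pose proof (proj1 (Cmod_gt_0 _) N) as P.
  set (m := Cmod (f z)) in *. destruct (Hf (e * (m * m / 2))) as [d2 [D2 K2]]; [apply Rmult_lt_0_compat; nra|].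
  exists (Rmin d1 d2). split; [now apply Rmin_pos|]. intros w Hw.
  destruct (Rmin_Rgt_l _ _ _ Hw) as [W1 W2]. specialize (K1 w W1). specialize (K2 w W2).
  assert (N' : f w <> 0) by (apply Cmod_gt_0; lra).
  replace (/ f w - / f z)%C with ((f z - f w) / (f w * f z))%C by (field; split; assumption).
  rewrite Cmod_div; [|now apply Cmult_neq_0]. rewrite Cmod_mult, Cmod_minus_sym. fold m.
  assert (0 < Cmod (f w) * m) by nra. apply Rlt_div_l; [assumption|].
  apply Rlt_trans with (1 := K2). apply Rmult_lt_compat_l; [exact He|]. nra.
Qed.

(** Carathéodory's form of differentiability: the slope is a function continuous at [z]. It reduces
    the rules of calculus to algebra of continuous functions, and later the slope serves as a
    difference quotient whose singularity is already removed. *)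
Lemma cdiff_slope (f : C -> C) (z d : C) :
  cdiff f z d <->
  exists g, ccont g z /\ g z = d /\ forall w, (f w - f z = g w * (w - z))%C.
Proof.
  split.
  - intro H. exists (fun w => if Ceq_dec w z then d else ((f w - f z) / (w - z))%C). split; [|split].
    + intros e He. destruct (H (e / 2)) as [dl [Hd K]]; [lra|]. exists dl. split; [exact Hd|]. intros w Hw.
      destruct (Ceq_dec z z) as [_|N]; [|now contradict N]. destruct (Ceq_dec w z) as [->|N].
      * now rewrite Cmod_diag.
      * specialize (K w Hw). apply Cminus_neq0 in N.
        replace ((f w - f z) / (w - z) - d)%C with ((f w - f z - d * (w - z)) / (w - z))%C
          by (field; exact N).
        rewrite Cmod_div by exact N. pose proof (proj1 (Cmod_gt_0 _) N). apply Rlt_div_l; [assumption|]. nra.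
    + destruct (Ceq_dec z z) as [_|N]; [reflexivity|now contradict N].
    + intro w. destruct (Ceq_dec w z) as [->|N]; [ring|]. apply Cminus_neq0 in N. field. exact N.
  - intros [g [Hg [E1 E2]]] e He. destruct (Hg e He) as [dl [Hd K]].
    exists dl. split; [exact Hd|]. intros w Hw. rewrite E2, <- E1.
    replace (g w * (w - z) - g z * (w - z))%C with ((g w - g z) * (w - z))%C by ring.
    rewrite Cmod_mult. apply Rmult_le_compat_r; [apply Cmod_ge_0|]. left. now apply K.
Qed.

Lemma cdiff_ccont (f : C -> C) (z d : C) : cdiff f z d -> ccont f z.
Proof.
  intro H. apply cdiff_slope in H. destruct H as [g [Hg [_ E]]].
  apply (ccont_ext_loc (fun w => f z + g w * (w - z))%C _ z 1); [lra| |].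
  - intros w _. rewrite <- E. ring.
  - apply ccont_plus; [apply ccont_const|apply ccont_mult; [exact Hg|]].
    apply ccont_minus; [apply ccont_id|apply ccont_const].
Qed.

Lemma cdiff_const (c z : C) : cdiff (fun _ => c) z 0.
Proof.
  apply cdiff_slope. exists (fun _ => RtoC 0). split; [apply ccont_const|]. split; [reflexivity|]. intro; ring.
Qed.

Lemma cdiff_id (z : C) : cdiff (fun w => w) z 1.
Proof.
  apply cdiff_slope. exists (fun _ => RtoC 1). split; [apply ccont_const|]. split; [reflexivity|]. intro; ring.
Qed.

Lemma cdiff_plus (f g : C -> C) (z a b : C) :
  cdiff f z a -> cdiff g z b -> cdiff (fun w => f w + g w)%C z (a + b).
Proof.
  rewrite !cdiff_slope. intros [F [F1 [F2 F3]]] [K [K1 [K2 K3]]].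
  exists (fun w => F w + K w)%C. split; [now apply ccont_plus|]. split; [now rewrite F2, K2|]. intro w.
  replace (f w + g w - (f z + g z))%C with ((f w - f z) + (g w - g z))%C by ring. rewrite F3, K3. ring.
Qed.

Lemma cdiff_mult (f g : C -> C) (z a b : C) :
  cdiff f z a -> cdiff g z b -> cdiff (fun w => f w * g w)%C z (a * g z + f z * b).
Proof.
  intros Hf Hg. pose proof (cdiff_ccont _ _ _ Hf) as Cf. revert Hf Hg.
  rewrite !cdiff_slope. intros [F [F1 [F2 F3]]] [K [K1 [K2 K3]]].
  exists (fun w => F w * g z + f w * K w)%C. split; [|split].
  - apply ccont_plus; apply ccont_mult; auto using ccont_const.
  - now rewrite F2, K2.
  - intro w. replace (f w * g w - f z * g z)%C with ((f w - f z) * g z + f w * (g w - g z))%C by ring.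
    rewrite F3, K3. ring.
Qed.

Lemma cdiff_eq (f : C -> C) (z a b : C) : cdiff f z a -> a = b -> cdiff f z b.
Proof. now intros H <-. Qed.

Lemma cdiff_scal (f : C -> C) (z a c : C) :
  cdiff f z a -> cdiff (fun w => c * f w)%C z (c * a).
Proof.
  intro H. eapply cdiff_eq; [apply cdiff_mult; [apply cdiff_const|exact H]|]. cbv beta. ring.
Qed.

Lemma cdiff_minus (f g : C -> C) (z a b : C) :
  cdiff f z a -> cdiff g z b -> cdiff (fun w => f w - g w)%C z (a - b).
Proof.
  intros Hf Hg. apply (cdiff_scal g z b (- (1))%C) in Hg.
  pose proof (cdiff_plus _ _ _ _ _ Hf Hg) as H. revert H.
  rewrite !cdiff_slope. intros [F [F1 [F2 F3]]]. exists F. split; [exact F1|].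
  split; [rewrite F2; ring|]. intro w. rewrite <- F3. ring.
Qed.

Lemma cdiff_comp (f g : C -> C) (z a b : C) :
  cdiff f z a -> cdiff g (f z) b -> cdiff (fun w => g (f w)) z (b * a).
Proof.
  intros Hf Hg. pose proof (cdiff_ccont _ _ _ Hf) as Cf. revert Hf Hg.
  rewrite !cdiff_slope. intros [F [F1 [F2 F3]]] [K [K1 [K2 K3]]].
  exists (fun w => K (f w) * F w)%C. split; [|split].
  - apply ccont_mult; [|exact F1]. now apply (ccont_comp f K).
  - now rewrite F2, K2.
  - intro w. rewrite K3, F3. ring.
Qed.

Lemma cdiff_ext_loc (f g : C -> C) (z d : C) (r : R) :
  0 < r -> (forall w, Cmod (w - z) < r -> f w = g w) -> cdiff f z d -> cdiff g z d.
Proof.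
  intros Hr E H e He. destruct (H e He) as [dl [Hd K]].
  exists (Rmin dl r). split; [now apply Rmin_pos|]. intros w Hw. rewrite <- !E.
  - apply K. eapply Rlt_le_trans; [exact Hw | apply Rmin_l].
  - now rewrite Cmod_diag.
  - eapply Rlt_le_trans; [exact Hw | apply Rmin_r].
Qed.

Lemma cdiff_inv (f : C -> C) (z a : C) :
  cdiff f z a -> f z <> 0 -> cdiff (fun w => / f w)%C z (- a / (f z * f z)).
Proof.
  intros Hf N. pose proof (cdiff_ccont _ _ _ Hf) as Cf. destruct (ccont_neq0 f z Cf N) as [d [Hd Kd]].
  pose proof (proj1 (Cmod_gt_0 _) N) as P.
  pose proof Hf as Hf'. apply cdiff_slope in Hf'. destruct Hf' as [F [F1 [F2 F3]]].
  set (g := fun w => (- F w * / f w * / f z)%C).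
  apply (cdiff_ext_loc (fun w => / f z + g w * (w - z))%C _ z _ d Hd).
  - intros w Hw. specialize (Kd w Hw). assert (N' : f w <> 0) by (apply Cmod_gt_0; lra). unfold g.
    replace (/ f z + - F w * / f w * / f z * (w - z))%C
      with (/ f z - (F w * (w - z)) * / f w * / f z)%C by ring.
    rewrite <- F3. field. auto.
  - apply cdiff_slope. exists g. split; [|split].
    + unfold g. apply ccont_mult; [apply ccont_mult|apply ccont_const].
      * now apply ccont_opp.
      * now apply ccont_inv.
    + unfold g. rewrite F2. field. exact N.
    + intro w. ring.
Qed.

Lemma cdiff_div (f g : C -> C) (z a b : C) :
  cdiff f z a -> cdiff g z b -> g z <> 0 ->
  cdiff (fun w => f w / g w)%C z ((a * g z - f z * b) / (g z * g z)).
Proof.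
  intros Hf Hg N. eapply cdiff_eq.
  - apply cdiff_mult; [exact Hf|]. apply cdiff_inv; [exact Hg|exact N].
  - cbv beta. field. exact N.
Qed.

Lemma cdiff_unique (f : C -> C) (z a b : C) : cdiff f z a -> cdiff f z b -> a = b.
Proof.
  intros Ha Hb. apply (Cmod_le_all_eps a b 2). intros e He.
  destruct (Ha e He) as [d1 [D1 K1]]. destruct (Hb e He) as [d2 [D2 K2]]. set (r := Rmin d1 d2 / 2).
  assert (0 < Rmin d1 d2) by now apply Rmin_pos. pose proof (Rmin_bounds d1 d2).
  assert (Er : Cmod (z + r - z) = r).
  { replace (z + r - z)%C with (RtoC r) by ring. apply Cmod_RtoC_pos. unfold r; lra. }
  specialize (K1 (z + r)%C). specialize (K2 (z + r)%C). rewrite Er in K1, K2.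
  specialize (K1 ltac:(unfold r; lra)). specialize (K2 ltac:(unfold r; lra)).
  assert (Cmod ((a - b) * r) <= 2 * e * r).
  { replace ((a - b) * r)%C with
      ((f (z + r) - f z - b * (z + r - z)) - (f (z + r) - f z - a * (z + r - z)))%C by ring.
    eapply Rle_trans; [apply Cmod_minus_triangle|]. lra. }
  rewrite Cmod_mult, (Cmod_RtoC_pos r) in H1 by (unfold r; lra).
  apply Rmult_le_reg_r with r; [unfold r; lra|]. lra.
Qed.

(** * The exponential and the principal logarithm *)

Definition cexp (z : C) : C := (exp (fst z) * cos (snd z), exp (fst z) * sin (snd z)).

Lemma cexp_add (z w : C) : cexp (z + w)%C = (cexp z * cexp w)%C.
Proof.
  unfold cexp, Cmult; simpl. rewrite exp_plus, cos_plus, sin_plus. apply injective_projections; simpl; ring.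
Qed.

Lemma cexp_0 : cexp (RtoC 0) = RtoC 1.
Proof. unfold cexp, RtoC; simpl. rewrite exp_0, cos_0, sin_0. f_equal; ring. Qed.

Lemma Cmod_cexp (z : C) : Cmod (cexp z) = exp (fst z).
Proof.
  apply Rsqr_inj; [apply Cmod_ge_0|left; apply exp_pos|]. unfold Rsqr. rewrite Cmod_sq. unfold cexp; simpl.
  pose proof (sin2_cos2 (snd z)) as H. unfold Rsqr in H.
  replace (exp (fst z) * cos (snd z) * (exp (fst z) * cos (snd z)) + exp (fst z) * sin (snd z) * (exp (fst z) * sin (snd z)))
    with (exp (fst z) * exp (fst z) * (sin (snd z) * sin (snd z) + cos (snd z) * cos (snd z))) by ring.
  rewrite H. ring.
Qed.

Lemma cexp_neq_0 (z : C) : cexp z <> RtoC 0.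
Proof. apply Cmod_gt_0. rewrite Cmod_cexp. apply exp_pos. Qed.

Lemma cexp_opp (z : C) : cexp (- z)%C = (/ cexp z)%C.
Proof.
  assert (H : (cexp (- z) * cexp z = 1)%C).
  { rewrite <- cexp_add. replace (- z + z)%C with (RtoC 0) by ring. apply cexp_0. }
  pose proof (cexp_neq_0 z) as N.
  replace (cexp (- z)%C) with (cexp (- z) * cexp z * / cexp z)%C by (field; exact N). rewrite H. ring.
Qed.

Lemma cexp_RtoC (t : R) : cexp (RtoC t) = RtoC (exp t).
Proof. unfold cexp, RtoC; simpl. rewrite cos_0, sin_0. f_equal; ring. Qed.

Lemma derivable_lim_remainder (f : R -> R) (x l : R) : derivable_pt_lim f x l ->
  forall eps, 0 < eps -> exists d, 0 < d /\
    forall h, Rabs h < d -> Rabs (f (x + h) - f x - l * h) <= eps * Rabs h.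
Proof.
  intros H e He. destruct (H e He) as [d K]. exists d. split; [apply cond_pos|].
  intros h Hh. destruct (Req_dec h 0) as [->|N].
  - rewrite Rplus_0_r, Rmult_0_r, Rabs_R0. replace (f x - f x - 0) with 0 by ring. rewrite Rabs_R0. lra.
  - specialize (K h N Hh).
    replace (f (x + h) - f x - l * h) with (((f (x + h) - f x) / h - l) * h) by (field; exact N).
    rewrite Rabs_mult. apply Rmult_le_compat_r; [apply Rabs_pos|lra].
Qed.

Lemma cdiff_cexp_0 : cdiff cexp 0 1.
Proof.
  (* The remainders of the real [exp], [cos] and [sin] at 0 contribute nine multiples of [e'] in
     total, hence [e / 10]; the product [x * y] is of second order and is absorbed by also asking
     [Cmod w < e']. *)
  intros e He. set (e' := Rmin 1 (e / 10)). assert (He' : 0 < e') by (apply Rmin_pos; lra).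
  assert (e' <= 1) by apply Rmin_l. assert (e' <= e / 10) by apply Rmin_r.
  destruct (derivable_lim_remainder _ _ _ (derivable_pt_lim_exp 0) e' He') as [d1 [D1 K1]].
  destruct (derivable_lim_remainder _ _ _ (derivable_pt_lim_cos 0) e' He') as [d2 [D2 K2]].
  destruct (derivable_lim_remainder _ _ _ (derivable_pt_lim_sin 0) e' He') as [d3 [D3 K3]].
  rewrite exp_0 in K1. rewrite sin_0, cos_0 in K2, K3.
  exists (Rmin e' (Rmin d1 (Rmin d2 d3))). split; [apply Rmin_pos; [exact He'|]; apply Rmin_pos; [exact D1|]; apply Rmin_pos; assumption|].
  intros w Hw. rewrite cexp_0. replace (w - 0)%C with w in * by ring.
  pose proof (Rmin_bounds e' (Rmin d1 (Rmin d2 d3))). pose proof (Rmin_bounds d1 (Rmin d2 d3)).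
  pose proof (Rmin_bounds d2 d3).
  destruct w as [x y]. pose proof (Rabs_fst_le (x, y)) as Bx. pose proof (Rabs_snd_le (x, y)) as By.
  set (m := Cmod (x, y)) in *. simpl in Bx, By.
  specialize (K1 x ltac:(lra)). specialize (K2 y ltac:(lra)). specialize (K3 y ltac:(lra)).
  rewrite !Rplus_0_l in K1, K2, K3. eapply Rle_trans; [apply Cmod_sum_abs|]. unfold cexp; simpl.
  pose proof (Rabs_pos x); pose proof (Rabs_pos y).
  set (A := exp x - 1 - 1 * x) in *. set (B := cos y - 1 - - (0) * y) in *. set (S := sin y - 0 - 1 * y) in *.
  replace (exp x * cos y + - (1) + - (1 * x - 0 * y)) with (A + exp x * B)
    by (unfold A, B; ring).
  replace (exp x * sin y + - 0 + - (1 * y + 0 * x)) with (exp x * S + (A + x) * y)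
    by (unfold A, S; ring).
  pose proof (Rabs_triang A (exp x * B)) as T1. pose proof (Rabs_triang (exp x * S) ((A + x) * y)) as T2.
  pose proof (Rabs_triang A x) as T3. rewrite Rabs_mult in T1. rewrite !Rabs_mult in T2.
  assert (Hx3 : Rabs (exp x) <= 3).
  { replace (exp x) with (A + x + 1) by (unfold A; ring).
    eapply Rle_trans; [apply Rabs_triang|]. rewrite Rabs_R1. nra. }
  pose proof (Rabs_pos A); pose proof (Rabs_pos B); pose proof (Rabs_pos S).
  pose proof (Rabs_pos (exp x)). pose proof (Rabs_pos (A + x)).
  assert (Rabs (exp x) * Rabs B <= 3 * (e' * m)) by (apply Rmult_le_compat; nra).
  assert (Rabs (exp x) * Rabs S <= 3 * (e' * m)) by (apply Rmult_le_compat; nra).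
  assert (Rabs (A + x) * Rabs y <= (2 * e') * m) by (apply Rmult_le_compat; nra). nra.
Qed.

Lemma cdiff_cexp (z : C) : cdiff cexp z (cexp z).
Proof.
  apply (cdiff_ext_loc (fun w => cexp z * cexp (w - z))%C _ z _ 1); [lra| |].
  - intros w _. rewrite <- cexp_add. f_equal. ring.
  - eapply cdiff_eq.
    + apply cdiff_scal. apply (cdiff_comp (fun w => w - z)%C cexp).
      * apply cdiff_minus; [apply cdiff_id|apply cdiff_const].
      * replace (z - z)%C with (RtoC 0) by ring. apply cdiff_cexp_0.
    + cbv beta. ring.
Qed.

(** The principal branch on the right half-plane, the only place where it inverts [cexp] below.
    Using [atan] keeps the imaginary part in the open strip [|Im| < PI / 2] for every argument. *)
Definition clog (z : C) : C := (ln (Cmod z), atan (snd z / fst z)).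

Lemma cexp_clog (z : C) : 0 < fst z -> cexp (clog z) = z.
Proof.
  intro H. destruct z as [x y]. unfold clog. simpl in *. assert (P : 0 < Cmod (x, y)).
  { eapply Rlt_le_trans; [exact H|]. eapply Rle_trans; [apply Rle_abs|]. apply (Rabs_fst_le (x, y)). }
  unfold cexp; simpl. rewrite exp_ln by exact P. set (m := Cmod (x, y)) in *.
  pose proof (Cmod_sq (x, y)) as Q. fold m in Q. simpl in Q. rewrite cos_atan, sin_atan.
  assert (E : sqrt (1 + (y / x)²) = m / x).
  { apply sqrt_lem_1.
    - unfold Rsqr. nra.
    - apply Rlt_le, Rdiv_lt_0_compat; assumption.
    - unfold Rsqr. field_simplify; [|lra|lra]. f_equal. nra. }
  rewrite E. f_equal; field; lra.
Qed.

Lemma clog_im_bound (z : C) : Rabs (snd (clog z)) < PI / 2.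
Proof. simpl. pose proof (atan_bound (snd z / fst z)). apply Rabs_def1; lra. Qed.

(** * Curves in the plane *)

Definition rcdiff (k : R -> C) (t : R) (d : C) : Prop :=
  is_derive (fun s => fst (k s)) t (fst d) /\ is_derive (fun s => snd (k s)) t (snd d).

Lemma rcdiff_of_eps (k : R -> C) (t : R) (d : C) :
  (forall eps, 0 < eps -> exists dl, 0 < dl /\ forall s, Rabs s < dl ->
     Cmod (k (t + s)%R - k t - s * d)%C <= eps * Rabs s) ->
  rcdiff k t d.
Proof.
  intro H. assert (K : forall eps, 0 < eps -> exists dl : posreal, forall s, s <> 0 -> Rabs s < dl ->
     Cmod ((k (t + s)%R - k t - s * d) / s)%C < eps).
  { intros e He. destruct (H (e / 2)) as [dl [Hd K]]; [lra|].
    exists (mkposreal dl Hd). simpl. intros s N Hs. specialize (K s Hs).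
    assert (N' : RtoC s <> 0) by (apply RtoC_neq0; lra). rewrite Cmod_div, Cmod_R by exact N'.
    pose proof (Rabs_pos_lt s N) as P. apply Rlt_div_l; [exact P|]. nra. }
  split; apply is_derive_Reals; intros e He; destruct (K e He) as [dl Kd]; exists dl;
    intros s N Hs; specialize (Kd s N Hs).
  - eapply Rle_lt_trans; [|exact Kd].
    match goal with |- _ <= Cmod ?z => replace ((fst (k (t + s)) - fst (k t)) / s - fst d) with (fst z) end.
    + apply Rabs_fst_le.
    + simpl. field. exact N.
  - eapply Rle_lt_trans; [|exact Kd].
    match goal with |- _ <= Cmod ?z => replace ((snd (k (t + s)) - snd (k t)) / s - snd d) with (snd z) end.
    + apply Rabs_snd_le.
    + simpl. field. exact N.
Qed.

Lemma rcdiff_horizontal (f : C -> C) (x y : R) (d : C) :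
  cdiff f (x, y) d -> rcdiff (fun s => f (s, y)) x d.
Proof.
  intro H. apply rcdiff_of_eps. intros e He. destruct (H e He) as [dl [Hd K]].
  exists dl. split; [exact Hd|]. intros s Hs. assert (E : ((x + s, y)%R - (x, y))%C = RtoC s).
  { unfold Cminus, Cplus, Copp, RtoC; simpl. apply injective_projections; simpl; ring. }
  specialize (K (x + s, y)%R). rewrite E, Cmod_R in K. rewrite (Cmult_comm s d). now apply K.
Qed.

Lemma rcdiff_vertical (f : C -> C) (x y : R) (d : C) :
  cdiff f (x, y) d -> rcdiff (fun s => f (x, s)) y (Ci * d).
Proof.
  intro H. apply rcdiff_of_eps. intros e He. destruct (H e He) as [dl [Hd K]].
  exists dl. split; [exact Hd|]. intros s Hs. assert (E : ((x, y + s)%R - (x, y))%C = (Ci * s)%C).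
  { unfold Ci, Cmult, Cminus, Cplus, Copp, RtoC; simpl. apply injective_projections; simpl; ring. }
  specialize (K (x, y + s)%R). rewrite E, Cmod_mult, Cmod_Ci, Rmult_1_l, Cmod_R in K.
  replace (s * (Ci * d))%C with (d * (Ci * s))%C by ring. now apply K.
Qed.

Lemma nonincreasing_of_derive (f df : R -> R) (a b : R) : a <= b ->
  (forall t, a <= t <= b -> is_derive f t (df t)) ->
  (forall t, a <= t <= b -> df t <= 0) -> f b <= f a.
Proof.
  intros Hab H1 H2. destruct (MVT_gen f a b df) as [c [Hc E]].
  - rewrite Rmin_left, Rmax_right by exact Hab. intros. apply H1. lra.
  - rewrite Rmin_left, Rmax_right by exact Hab. intros t Ht.
    apply continuity_pt_filterlim, (ex_derive_continuous (V := R_NormedModule)). eexists. now apply H1.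
  - rewrite Rmin_left, Rmax_right in Hc by exact Hab. specialize (H2 c Hc). nra.
Qed.

(** Projecting on the fixed direction [k b - k a] reduces the claim to monotonicity of a real
    function. The bound [g'] may vary with [t], so that exponential weights are integrated
    exactly. *)
Lemma mean_value_ineq (k k' : R -> C) (g g' : R -> R) (a b : R) : a <= b ->
  (forall t, a <= t <= b -> rcdiff k t (k' t)) ->
  (forall t, a <= t <= b -> is_derive g t (g' t)) ->
  (forall t, a <= t <= b -> Cmod (k' t) <= g' t) ->
  Cmod (k b - k a) <= g b - g a.
Proof.
  intros Hab Hk Hg Hb. set (u := (k b - k a)%C). destruct (Req_dec (Cmod u) 0) as [E|N].
  - rewrite E. assert (- g b <= - g a); [|lra].
    apply (nonincreasing_of_derive (fun t => - g t) (fun t => - g' t)); auto.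
    + intros t Ht. apply (is_derive_opp g). now apply Hg.
    + intros t Ht. pose proof (Hb t Ht); pose proof (Cmod_ge_0 (k' t)); lra.
  - pose proof (Cmod_ge_0 u). assert (P : 0 < Cmod u) by lra.
    pose (phi := fun t => fst u * fst (k t) + snd u * snd (k t) - Cmod u * g t). assert (Hphi : phi b <= phi a).
    { apply (nonincreasing_of_derive phi
        (fun t => fst u * fst (k' t) + snd u * snd (k' t) - Cmod u * g' t)); auto.
      - intros t Ht. destruct (Hk t Ht) as [K1 K2]. specialize (Hg t Ht).
        unfold phi. apply @is_derive_minus; [apply @is_derive_plus|]; apply is_derive_scal; assumption.
      - intros t Ht. specialize (Hb t Ht).
        assert (fst u * fst (k' t) + snd u * snd (k' t) <= Cmod u * Cmod (k' t)); [|nra].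
        apply Rsqr_incr_0_var; [|pose proof (Cmod_ge_0 (k' t)); nra]. unfold Rsqr.
        replace (Cmod u * Cmod (k' t) * (Cmod u * Cmod (k' t)))
          with ((Cmod u * Cmod u) * (Cmod (k' t) * Cmod (k' t))) by ring.
        rewrite !Cmod_sq. assert (0 <= (fst u * snd (k' t) - snd u * fst (k' t)) ^ 2) by apply pow2_ge_0. nra. }
    assert (E : fst u * fst u + snd u * snd u = fst u * (fst (k b) - fst (k a)) + snd u * (snd (k b) - snd (k a))).
    { unfold u. simpl. ring. }
    rewrite <- Cmod_sq in E. unfold phi in Hphi. apply Rmult_le_reg_l with (Cmod u); [exact P|]. lra.
Qed.

(** The squared modulus [N] is differentiable even where [k] vanishes and satisfies
    [|N'| <= 2 g' N]. The reverse bound matters as much as the direct one: it is what keeps a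
    solution away from 0. *)
Lemma gronwall (k k' : R -> C) (g g' : R -> R) (a b : R) : a <= b ->
  (forall t, a <= t <= b -> rcdiff k t (k' t)) ->
  (forall t, a <= t <= b -> is_derive g t (g' t)) ->
  (forall t, a <= t <= b -> Cmod (k' t) <= g' t * Cmod (k t)) ->
  Cmod (k b) <= exp (g b - g a) * Cmod (k a) /\ Cmod (k a) <= exp (g b - g a) * Cmod (k b).
Proof.
  intros Hab Hk Hg Hb. pose (N := fun t => fst (k t) * fst (k t) + snd (k t) * snd (k t)).
  pose (N' := fun t => 2 * (fst (k t) * fst (k' t) + snd (k t) * snd (k' t))).
  assert (HN : forall t, a <= t <= b -> is_derive N t (N' t)).
  { intros t Ht. destruct (Hk t Ht) as [K1 K2]. unfold N, N'. evar_last.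
    - apply @is_derive_plus; apply (is_derive_mult (K := R_AbsRing)); eauto; intros; apply Rmult_comm.
    - unfold plus, mult; simpl. ring. }
  assert (HB : forall t, a <= t <= b -> Rabs (N' t) <= 2 * g' t * N t).
  { intros t Ht. specialize (Hb t Ht). unfold N, N'. rewrite <- Cmod_sq, Rabs_mult, (Rabs_pos_eq 2) by lra.
    assert (Rabs (fst (k t) * fst (k' t) + snd (k t) * snd (k' t)) <= Cmod (k t) * Cmod (k' t)).
    { apply Rsqr_incr_0_var; [|pose proof (Cmod_ge_0 (k' t)); pose proof (Cmod_ge_0 (k t)); nra].
      rewrite <- Rsqr_abs. unfold Rsqr. replace (Cmod (k t) * Cmod (k' t) * (Cmod (k t) * Cmod (k' t)))
          with ((Cmod (k t) * Cmod (k t)) * (Cmod (k' t) * Cmod (k' t))) by ring.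
      rewrite !Cmod_sq.
      assert (0 <= (fst (k t) * snd (k' t) - snd (k t) * fst (k' t)) ^ 2) by apply pow2_ge_0. nra. }
    pose proof (Cmod_ge_0 (k t)). nra. }
  (* The sign treats both directions at once: [N e^(- 2 g)] decreases and [N e^(2 g)] increases. *)
  assert (Hs : forall sg : R, sg = 1 \/ sg = -1 ->
    sg * N b * exp (- sg * 2 * g b) <= sg * N a * exp (- sg * 2 * g a)).
  { intros sg Hsg. apply (nonincreasing_of_derive (fun t => sg * N t * exp (- sg * 2 * g t))
      (fun t => sg * N' t * exp (- sg * 2 * g t) + sg * N t * (- sg * 2 * g' t * exp (- sg * 2 * g t)))); auto.
    - intros t Ht. apply (is_derive_mult (K := R_AbsRing) (fun s => sg * N s) (fun s => exp (- sg * 2 * g s)));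
        [| |intros; apply Rmult_comm].
      + apply is_derive_scal. now apply HN.
      + apply (is_derive_comp (K := R_AbsRing) (V := R_NormedModule) exp (fun s => - sg * 2 * g s)).
        * apply is_derive_exp.
        * apply is_derive_scal. now apply Hg.
    - intros t Ht. specialize (HB t Ht). apply Rabs_le_between in HB.
      pose proof (exp_pos (- sg * 2 * g t)) as P.
      replace (sg * N' t * exp (- sg * 2 * g t) + sg * N t * (- sg * 2 * g' t * exp (- sg * 2 * g t)))
        with (exp (- sg * 2 * g t) * (sg * N' t - sg * sg * (2 * g' t * N t))) by ring.
      destruct Hsg as [-> | ->]; nra. }
  assert (Q : forall t, N t = Cmod (k t) * Cmod (k t)) by (intro; unfold N; now rewrite Cmod_sq).
  assert (F : forall x y u v, 0 <= x -> 0 <= y -> x * x * exp (2 * u) <= y * y * exp (2 * v) -> x <= exp (v - u) * y).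
  { intros x y u v Hx Hy H. apply Rsqr_incr_0_var.
    2:{ pose proof (exp_pos (v - u)); nra. }
    unfold Rsqr. apply Rmult_le_reg_r with (exp (2 * u)); [apply exp_pos|].
    replace (exp (v - u) * y * (exp (v - u) * y) * exp (2 * u))
      with (y * y * (exp (v - u) * exp (v - u) * exp (2 * u))) by ring.
    rewrite <- !exp_plus. now replace (v - u + (v - u) + 2 * u) with (2 * v) by ring. }
  split.
  - specialize (Hs 1 (or_introl eq_refl)). rewrite !Q in Hs. replace (g b - g a) with (- g a - - g b) by ring.
    apply F; try apply Cmod_ge_0.
    replace (2 * - g b) with (- (1) * 2 * g b) by ring. replace (2 * - g a) with (- (1) * 2 * g a) by ring. lra.
  - specialize (Hs (-1) (or_intror eq_refl)). rewrite !Q in Hs. apply F; try apply Cmod_ge_0.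
    replace (- (-1) * 2 * g b) with (2 * g b) in Hs by ring.
    replace (- (-1) * 2 * g a) with (2 * g a) in Hs by ring. lra.
Qed.

(** * Goursat's theorem on rectangles *)

Definition CInt (k : R -> C) (a b : R) : C := RInt (V := C_R_CompleteNormedModule) k a b.
Definition is_CInt (k : R -> C) (a b : R) (l : C) : Prop := is_RInt (V := C_R_NormedModule) k a b l.
Definition rcont (k : R -> C) (t : R) : Prop := continuous (U := C_R_NormedModule) k t.

Lemma rcont_of_eps (k : R -> C) (t : R) :
  (forall eps, 0 < eps -> exists dl, 0 < dl /\ forall s, Rabs (s - t) < dl ->
     Cmod (k s - k t)%C < eps) -> rcont k t.
Proof.
  intro H. apply filterlim_locally. intros [e He].
  destruct (H e He) as [dl [Hd K]]. exists (mkposreal dl Hd). intros s Hs. specialize (K s Hs). split.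
  - eapply Rle_lt_trans; [|exact K]. apply (Rabs_fst_le (k s - k t)%C).
  - eapply Rle_lt_trans; [|exact K]. apply (Rabs_snd_le (k s - k t)%C).
Qed.

Lemma rcont_horizontal (f : C -> C) (x y : R) :
  ccont f (x, y) -> rcont (fun s => f (s, y)) x.
Proof.
  intro H. apply rcont_of_eps. intros e He. destruct (H e He) as [d [Hd K]].
  exists d. split; [exact Hd|]. intros s Hs. apply K.
  eapply Rle_lt_trans; [|exact Hs]. rewrite <- Cmod_R. right. f_equal. apply injective_projections; simpl; ring.
Qed.

Lemma rcont_vertical (f : C -> C) (x y : R) :
  ccont f (x, y) -> rcont (fun s => f (x, s)) y.
Proof.
  intro H. apply rcont_of_eps. intros e He. destruct (H e He) as [d [Hd K]].
  exists d. split; [exact Hd|]. intros s Hs. apply K. eapply Rle_lt_trans; [|exact Hs].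
  rewrite <- Cmod_R, <- (Rmult_1_l (Cmod (s - y)%R)), <- Cmod_Ci, <- Cmod_mult. right. f_equal.
  apply injective_projections; simpl; ring.
Qed.

Lemma ex_CInt (k : R -> C) (a b : R) : a <= b ->
  (forall t, a <= t <= b -> rcont k t) -> ex_RInt (V := C_R_NormedModule) k a b.
Proof.
  intros Hab H. apply (ex_RInt_continuous (V := C_R_CompleteNormedModule)).
  rewrite Rmin_left, Rmax_right by exact Hab. exact H.
Qed.

Lemma CInt_correct (k : R -> C) (a b : R) :
  ex_RInt (V := C_R_NormedModule) k a b -> is_CInt k a b (CInt k a b).
Proof. apply (RInt_correct (V := C_R_CompleteNormedModule)). Qed.

Lemma norm_Cmod (z : C) : norm (V := C_R_NormedModule) z = Cmod z.
Proof.
  unfold norm; simpl. unfold prod_norm, norm; simpl. unfold abs; simpl. unfold Cmod.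
  rewrite !Rmult_1_r, <- !Rabs_mult, !Rabs_pos_eq by nra. f_equal; ring.
Qed.

Lemma CInt_bound (k : R -> C) (a b M : R) : a <= b ->
  (forall t, a <= t <= b -> rcont k t) ->
  (forall t, a <= t <= b -> Cmod (k t) <= M) -> Cmod (CInt k a b) <= (b - a) * M.
Proof.
  intros Hab H1 H2. rewrite <- norm_Cmod. apply (norm_RInt_le_const (V := C_R_NormedModule) k a b _ M Hab).
  - intros t Ht. rewrite norm_Cmod. now apply H2.
  - apply CInt_correct. now apply ex_CInt.
Qed.

Lemma CInt_ext (f g : R -> C) (a b : R) : (forall t, f t = g t) -> CInt f a b = CInt g a b.
Proof. intro H. apply (RInt_ext (V := C_R_CompleteNormedModule)). intros t _. apply H. Qed.

Lemma CInt_minus (f g : R -> C) (a b : R) :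
  ex_RInt (V := C_R_NormedModule) f a b -> ex_RInt (V := C_R_NormedModule) g a b ->
  CInt (fun t => f t - g t)%C a b = (CInt f a b - CInt g a b)%C.
Proof. apply (RInt_minus (V := C_R_CompleteNormedModule)). Qed.

Lemma CInt_FTC (k k' : R -> C) (a b : R) : a <= b ->
  (forall t, a <= t <= b -> rcdiff k t (k' t)) ->
  (forall t, a <= t <= b -> rcont k' t) ->
  CInt k' a b = (k b - k a)%C.
Proof.
  intros Hab H1 H2. apply (is_RInt_unique (V := C_R_CompleteNormedModule)).
  replace (k b - k a)%C with ((fst (k b) - fst (k a), snd (k b) - snd (k a)) : C)
    by (apply injective_projections; simpl; ring).
  apply (is_RInt_fct_extend_pair (U := R_NormedModule) (V := R_NormedModule) k').
  - apply (is_RInt_derive (V := R_CompleteNormedModule) (fun t => fst (k t))); rewrite Rmin_left, Rmax_right by exact Hab.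
    + intros t Ht. apply H1. exact Ht.
    + intros t Ht. specialize (H2 t Ht).
      apply (continuous_comp k' (fun z : R * R => fst z) t); [exact H2|]. apply (continuous_fst (U := R_UniformSpace) (V := R_UniformSpace)).
  - apply (is_RInt_derive (V := R_CompleteNormedModule) (fun t => snd (k t))); rewrite Rmin_left, Rmax_right by exact Hab.
    + intros t Ht. apply H1. exact Ht.
    + intros t Ht. specialize (H2 t Ht).
      apply (continuous_comp k' (fun z : R * R => snd z) t); [exact H2|]. apply (continuous_snd (U := R_UniformSpace) (V := R_UniformSpace)).
Qed.

(** * Bisection of rectangles *)

Definition rect : Type := (R * R * (R * R))%type.

(** The last quarter is the default. It has the property whenever the parent passes it on to some
    quarter and the first three lack it. *)
Definition quarter_step (P : nat -> R -> R -> R -> R -> Prop) (n : nat) (q : rect) : rect :=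
  let '((a, b), (c, d)) := q in
  let m := (a + b) / 2 in let p := (c + d) / 2 in
  if excluded_middle_informative (P (S n) a m c p) then ((a, m), (c, p))
  else if excluded_middle_informative (P (S n) m b c p) then ((m, b), (c, p))
  else if excluded_middle_informative (P (S n) a m p d) then ((a, m), (p, d))
  else ((m, b), (p, d)).

Fixpoint quarters (P : nat -> R -> R -> R -> R -> Prop) (q : rect) (n : nat) : rect :=
  match n with O => q | S n => quarter_step P n (quarters P q n) end.

Lemma nested_intervals (u v : nat -> R) :
  (forall n, u n <= u (S n)) -> (forall n, v (S n) <= v n) -> (forall n, u n <= v n) ->
  exists x, forall n, u n <= x <= v n.
Proof.
  intros Hu Hv Huv. assert (Mu : forall n m, (n <= m)%nat -> u n <= u m).
  { intros n m H. induction H; [lra|]. specialize (Hu m). lra. }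
  assert (Mv : forall n m, (n <= m)%nat -> v m <= v n).
  { intros n m H. induction H; [lra|]. specialize (Hv m). lra. }
  assert (C1 : forall n m, u n <= v m).
  { intros n m. destruct (Nat.le_ge_cases n m) as [H|H].
    - specialize (Mu n m H). specialize (Huv m). lra.
    - specialize (Mv m n H). specialize (Huv n). lra. }
  destruct (completeness (fun x => exists n, x = u n)) as [x [X1 X2]].
  - exists (v O). intros y [n ->]. apply C1.
  - exists (u O). now exists O.
  - exists x. intro n. split; [apply X1; now exists n|]. apply X2. intros y [m ->]. apply C1.
Qed.

(** Stated for a property depending on the depth because of its two uses: in Goursat's theorem the
    property is rescaled by 4 at each level, while for the existence of maxima it is the same at all
    levels. *)
Lemma rectangle_bisection (P : nat -> R -> R -> R -> R -> Prop) (a b c d : R) :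
  (forall n a b c d, a <= b -> c <= d -> P n a b c d ->
    P (S n) a ((a + b) / 2) c ((c + d) / 2) \/ P (S n) ((a + b) / 2) b c ((c + d) / 2) \/
    P (S n) a ((a + b) / 2) ((c + d) / 2) d \/ P (S n) ((a + b) / 2) b ((c + d) / 2) d) ->
  a <= b -> c <= d -> P O a b c d ->
  exists x y, a <= x <= b /\ c <= y <= d /\ forall n, exists a' b' c' d',
    P n a' b' c' d' /\ a <= a' <= x /\ x <= b' <= b /\ c <= c' <= y /\ y <= d' <= d /\
    b' - a' = (b - a) / 2 ^ n /\ d' - c' = (d - c) / 2 ^ n.
Proof.
  intros P_quarter Hab Hcd H0. set (holds := fun (n : nat) (q : rect) =>
    let '((a, b), (c, d)) := q in a <= b /\ c <= d /\ P n a b c d).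
  set (q := quarters P ((a, b), (c, d))). assert (Step : forall n, holds n (q n) ->
    holds (S n) (q (S n)) /\
    fst (fst (q n)) <= fst (fst (q (S n))) /\ snd (fst (q (S n))) <= snd (fst (q n)) /\
    fst (snd (q n)) <= fst (snd (q (S n))) /\ snd (snd (q (S n))) <= snd (snd (q n)) /\
    snd (fst (q (S n))) - fst (fst (q (S n))) = (snd (fst (q n)) - fst (fst (q n))) / 2 /\
    snd (snd (q (S n))) - fst (snd (q (S n))) = (snd (snd (q n)) - fst (snd (q n))) / 2).
  { intros n Hn. change (q (S n)) with (quarter_step P n (q n)).
    destruct (q n) as [[a' b'] [c' d']]. destruct Hn as [H1 [H2 H3]].
    destruct (P_quarter n a' b' c' d' H1 H2 H3) as [Q|[Q|[Q|Q]]]; unfold quarter_step;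
    repeat (match goal with |- context [excluded_middle_informative ?X] =>
      destruct (excluded_middle_informative X) end; try tauto);
    simpl; repeat split; auto; lra. }
  assert (Inv : forall n, holds n (q n)).
  { induction n as [|n IH]; [simpl; auto|]. apply Step. exact IH. }
  assert (Wid : forall n, snd (fst (q n)) - fst (fst (q n)) = (b - a) / 2 ^ n /\
      snd (snd (q n)) - fst (snd (q n)) = (d - c) / 2 ^ n).
  { induction n as [|n [I1 I2]]; [simpl; split; lra|]. destruct (Step n (Inv n)) as [_ [_ [_ [_ [_ [E1 E2]]]]]].
    rewrite E1, E2, I1, I2. simpl. pose proof (pow_lt 2 n ltac:(lra)). split; field; lra. }
  assert (Ord : forall n, fst (fst (q n)) <= snd (fst (q n)) /\ fst (snd (q n)) <= snd (snd (q n))).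
  { intro n. pose proof (Inv n) as I. destruct (q n) as [[a' b'] [c' d']]. simpl in *. tauto. }
  destruct (nested_intervals (fun n => fst (fst (q n))) (fun n => snd (fst (q n)))) as [x Hx].
  { intro n. apply (Step n (Inv n)). } { intro n. apply (Step n (Inv n)). } { intro n. apply Ord. }
  destruct (nested_intervals (fun n => fst (snd (q n))) (fun n => snd (snd (q n)))) as [y Hy].
  { intro n. apply (Step n (Inv n)). } { intro n. apply (Step n (Inv n)). } { intro n. apply Ord. }
  assert (Sub : forall n, a <= fst (fst (q n)) /\ snd (fst (q n)) <= b /\ c <= fst (snd (q n)) /\ snd (snd (q n)) <= d).
  { induction n as [|n IH]; [simpl; lra|]. destruct (Step n (Inv n)) as [_ [S1 [S2 [S3 [S4 _]]]]]. lra. }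
  exists x, y. split; [apply (Hx O)|]. split; [apply (Hy O)|]. intro n.
  specialize (Hx n). specialize (Hy n). specialize (Inv n). specialize (Wid n). specialize (Sub n).
  destruct (q n) as [[a' b'] [c' d']]. simpl in *. exists a', b', c', d'. repeat split; try tauto; lra.
Qed.

(** The counterclockwise contour integral; [Ci] is the factor [dz/dy] on vertical sides. *)
Definition boundary_int (f : C -> C) (a b c d : R) : C :=
  (CInt (fun s => f (s, c)) a b + CInt (fun s => Ci * f (b, s)) c d
   - CInt (fun s => f (s, d)) a b - CInt (fun s => Ci * f (a, s)) c d)%C.

Definition ccont_rect (f : C -> C) (a b c d : R) : Prop :=
  forall x y, a <= x <= b -> c <= y <= d -> ccont f (x, y).

Lemma rcont_Ci_vertical (f : C -> C) (x y : R) :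
  ccont f (x, y) -> rcont (fun s => Ci * f (x, s))%C y.
Proof.
  intro H. apply (rcont_vertical (fun z => Ci * f z)%C). apply ccont_mult; [apply ccont_const|exact H].
Qed.

Lemma boundary_int_quarter (f : C -> C) (a b c d m p : R) :
  a <= m <= b -> c <= p <= d -> ccont_rect f a b c d ->
  (boundary_int f a b c d = boundary_int f a m c p + boundary_int f m b c p
    + boundary_int f a m p d + boundary_int f m b p d)%C.
Proof.
  intros Hm Hp Hf. assert (HH : forall y, c <= y <= d ->
    (CInt (fun s => f (s, y)) a b = CInt (fun s => f (s, y)) a m + CInt (fun s => f (s, y)) m b)%C).
  { intros y Hy. symmetry. apply (RInt_Chasles (V := C_R_CompleteNormedModule));
      apply ex_CInt; try lra; intros; apply rcont_horizontal; apply Hf; lra. }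
  assert (HV : forall x, a <= x <= b ->
    (CInt (fun s => Ci * f (x, s)) c d = CInt (fun s => Ci * f (x, s)) c p + CInt (fun s => Ci * f (x, s)) p d)%C).
  { intros x Hx. symmetry. apply (RInt_Chasles (V := C_R_CompleteNormedModule));
      apply ex_CInt; try lra; intros; apply rcont_Ci_vertical; apply Hf; lra. }
  unfold boundary_int. rewrite (HH c), (HH d), (HV a), (HV b) by lra. ring.
Qed.

Lemma boundary_int_minus (f g : C -> C) (a b c d : R) : a <= b -> c <= d ->
  ccont_rect f a b c d -> ccont_rect g a b c d ->
  (boundary_int (fun z => f z - g z) a b c d = boundary_int f a b c d - boundary_int g a b c d)%C.
Proof.
  intros Hab Hcd Hf Hg. unfold boundary_int. assert (HH : forall y, c <= y <= d ->
    (CInt (fun s => f (s, y) - g (s, y)) a b = CInt (fun s => f (s, y)) a b - CInt (fun s => g (s, y)) a b)%C).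
  { intros y Hy. apply CInt_minus; apply ex_CInt; auto; intros; apply rcont_horizontal; auto. }
  assert (HV : forall x, a <= x <= b ->
    (CInt (fun s => Ci * (f (x, s) - g (x, s))) c d = CInt (fun s => Ci * f (x, s)) c d - CInt (fun s => Ci * g (x, s)) c d)%C).
  { intros x Hx. rewrite <- CInt_minus by (apply ex_CInt; auto; intros; apply rcont_Ci_vertical; auto).
    apply CInt_ext. intro t. ring. }
  rewrite (HH c), (HH d), (HV a), (HV b) by lra. ring.
Qed.

(** Applied to affine integrands, whose quadratic primitives are entire; this is why the hypotheses
    are global. *)
Lemma boundary_int_primitive (F f : C -> C) (a b c d : R) : a <= b -> c <= d ->
  (forall z, cdiff F z (f z)) -> (forall z, ccont f z) -> boundary_int f a b c d = RtoC 0.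
Proof.
  intros Hab Hcd HF Hf. unfold boundary_int.
  assert (HH : forall y, (CInt (fun s => f (s, y)) a b = F (b, y) - F (a, y))%C).
  { intro y. apply (CInt_FTC (fun s => F (s, y))); auto.
    - intros. now apply rcdiff_horizontal.
    - intros. now apply rcont_horizontal. }
  assert (HV : forall x, (CInt (fun s => Ci * f (x, s)) c d = F (x, d) - F (x, c))%C).
  { intro x. apply (CInt_FTC (fun s => F (x, s))); auto.
    - intros. now apply rcdiff_vertical.
    - intros. now apply rcont_Ci_vertical. }
  rewrite !HH, !HV. ring.
Qed.

Lemma boundary_int_bound (f : C -> C) (a b c d M : R) : a <= b -> c <= d ->
  ccont_rect f a b c d -> (forall x y, a <= x <= b -> c <= y <= d -> Cmod (f (x, y)) <= M) ->
  Cmod (boundary_int f a b c d) <= 2 * ((b - a) + (d - c)) * M.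
Proof.
  intros Hab Hcd Hf HM. unfold boundary_int.
  assert (HH : forall y, c <= y <= d -> Cmod (CInt (fun s => f (s, y)) a b) <= (b - a) * M).
  { intros y Hy. apply CInt_bound; auto. intros; apply rcont_horizontal; auto. }
  assert (HV : forall x, a <= x <= b -> Cmod (CInt (fun s => Ci * f (x, s)) c d)%C <= (d - c) * M).
  { intros x Hx. apply CInt_bound; auto.
    - intros; apply rcont_Ci_vertical; auto.
    - intros. rewrite Cmod_mult, Cmod_Ci, Rmult_1_l. auto. }
  eapply Rle_trans; [apply Cmod_minus_triangle|].
  eapply Rle_trans; [apply Rplus_le_compat_r, Cmod_minus_triangle|].
  eapply Rle_trans; [apply Rplus_le_compat_r, Rplus_le_compat_r, Cmod_triangle|].
  pose proof (HH c ltac:(lra)); pose proof (HH d ltac:(lra)).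
  pose proof (HV a ltac:(lra)); pose proof (HV b ltac:(lra)). lra.
Qed.

Lemma pow2_unbounded (K : R) : exists n, K < 2 ^ n.
Proof.
  destruct (Pow_x_infinity 2 ltac:(rewrite Rabs_pos_eq; lra) (K + 1)) as [n H].
  exists n. specialize (H n (Nat.le_refl n)). rewrite Rabs_pos_eq in H; [lra|]. apply pow_le; lra.
Qed.

Lemma goursat (f : C -> C) (a b c d : R) : a <= b -> c <= d ->
  (forall x y, a <= x <= b -> c <= y <= d -> exists l, cdiff f (x, y) l) ->
  boundary_int f a b c d = RtoC 0.
Proof.
  intros Hab Hcd Hf. assert (Hc : ccont_rect f a b c d).
  { intros x y Hx Hy. destruct (Hf x y Hx Hy) as [l Hl]. now apply cdiff_ccont in Hl. }
  destruct (Ceq_dec (boundary_int f a b c d) 0) as [|N]; [assumption|exfalso].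
  apply Cmod_gt_0 in N. set (e0 := Cmod (boundary_int f a b c d)) in *.
  (* Some quarter carries at least a fourth of the contour integral of its parent, whence the factor
     [4 ^ n]. Containment in the original rectangle is recorded to keep continuity available. *)
  destruct (rectangle_bisection (fun n a' b' c' d' =>
      (a <= a' /\ b' <= b /\ c <= c' /\ d' <= d) /\ e0 <= 4 ^ n * Cmod (boundary_int f a' b' c' d')))
    with (a := a) (b := b) (c := c) (d := d) as [x [y [Hx [Hy HP]]]]; auto.
  - intros n a' b' c' d' H1 H2 [HS HE].
    rewrite (boundary_int_quarter f a' b' c' d' ((a' + b') / 2) ((c' + d') / 2)) in HE; try lra.
    2:{ intros u v Hu Hv. apply Hc; lra. }
    set (J1 := boundary_int f a' ((a' + b') / 2) c' ((c' + d') / 2)) in *.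
    set (J2 := boundary_int f ((a' + b') / 2) b' c' ((c' + d') / 2)) in *.
    set (J3 := boundary_int f a' ((a' + b') / 2) ((c' + d') / 2) d') in *.
    set (J4 := boundary_int f ((a' + b') / 2) b' ((c' + d') / 2) d') in *.
    assert (T : Cmod (J1 + J2 + J3 + J4) <= Cmod J1 + Cmod J2 + Cmod J3 + Cmod J4).
    { eapply Rle_trans; [apply Cmod_triangle|]. apply Rplus_le_compat_r.
      eapply Rle_trans; [apply Cmod_triangle|]. apply Rplus_le_compat_r. apply Cmod_triangle. }
    pose proof (pow_lt 4 n ltac:(lra)) as P4. simpl pow.
    destruct (Rle_lt_dec e0 (4 * 4 ^ n * Cmod J1)); [left; split; [lra|assumption]|].
    destruct (Rle_lt_dec e0 (4 * 4 ^ n * Cmod J2)); [right; left; split; [lra|assumption]|].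
    destruct (Rle_lt_dec e0 (4 * 4 ^ n * Cmod J3)); [right; right; left; split; [lra|assumption]|].
    destruct (Rle_lt_dec e0 (4 * 4 ^ n * Cmod J4)); [right; right; right; split; [lra|assumption]|].
    exfalso. nra.
  - split; [lra|]. simpl. fold e0. lra.
  - destruct (Hf x y Hx Hy) as [l Hl]. set (L := (b - a) + (d - c) + 1). assert (HL : 0 < L) by (unfold L; lra).
    (* Perimeter and size of the small rectangle are each [O(L / 2 ^ n)], so the powers cancel and
       the final bound is [2 L (eps L) = e0 / 2]. *)
    set (eps := e0 / (4 * (L * L))). assert (He : 0 < eps) by (unfold eps; apply Rdiv_lt_0_compat; nra).
    destruct (Hl eps He) as [dl [Hd K]]. destruct (pow2_unbounded (L / dl)) as [n Hn].
    pose proof (pow_lt 2 n ltac:(lra)) as P2. assert (Hn' : L / 2 ^ n < dl).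
    { apply Rlt_div_l; [exact P2|]. apply Rlt_div_l in Hn; [lra|exact Hd]. }
    destruct (HP n) as [a' [b' [c' [d' [[HS HE] [H1 [H2 [H3 [H4 [W1 W2]]]]]]]]]]. set (z0 := (x, y) : C) in *.
    (* The first-order Taylor polynomial at the limit point; its contour integral vanishes, so only
       the remainder is estimated. *)
    set (g := fun z : C => (f z0 - l * z0 + l * z)%C). assert (Hg : boundary_int g a' b' c' d' = RtoC 0).
    { apply (boundary_int_primitive (fun z => (f z0 - l * z0) * z + l * (z * z) / 2)%C); try lra.
      - intro z. eapply cdiff_eq.
        + apply cdiff_plus; [apply cdiff_scal, cdiff_id|].
          apply cdiff_mult; [apply cdiff_scal, cdiff_mult; apply cdiff_id|apply cdiff_const].
        + cbv beta. unfold g. field.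
      - intro z. unfold g. apply ccont_plus; [apply ccont_const|].
        apply ccont_mult; [apply ccont_const|apply ccont_id]. }
    assert (Hc' : ccont_rect f a' b' c' d') by (intros u v Hu Hv; apply Hc; lra).
    assert (Hgc : ccont_rect g a' b' c' d').
    { intros u v Hu Hv. unfold g. apply ccont_plus; [apply ccont_const|].
      apply ccont_mult; [apply ccont_const|apply ccont_id]. }
    assert (E : boundary_int f a' b' c' d' = boundary_int (fun z => f z - g z)%C a' b' c' d').
    { rewrite boundary_int_minus, Hg by (auto; lra). ring. }
    assert (HLn : (b' - a') + (d' - c') <= L / 2 ^ n).
    { rewrite W1, W2. unfold L, Rdiv. pose proof (Rinv_0_lt_compat _ P2). nra. }
    assert (B : Cmod (boundary_int f a' b' c' d') <= 2 * ((b' - a') + (d' - c')) * (eps * (L / 2 ^ n))).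
    { rewrite E. apply boundary_int_bound; try lra.
      - intros u v Hu Hv. apply ccont_minus; auto.
      - intros u v Hu Hv. assert (D : Cmod ((u, v) - z0)%C <= L / 2 ^ n).
        { eapply Rle_trans; [apply Cmod_sum_abs|]. simpl.
          assert (Rabs (u + - x) <= b' - a') by (apply Rabs_le; lra).
          assert (Rabs (v + - y) <= d' - c') by (apply Rabs_le; lra). lra. }
        unfold g. replace (f (u, v) - (f z0 - l * z0 + l * (u, v)))%C with (f (u, v) - f z0 - l * ((u, v) - z0))%C by ring.
        eapply Rle_trans; [apply K; lra|]. nra. }
    assert (P4 : 4 ^ n = 2 ^ n * 2 ^ n).
    { rewrite <- Rpow_mult_distr. f_equal; try lra. }
    assert (B2 : e0 <= 2 * L * (eps * L)).
    { eapply Rle_trans; [exact HE|]. rewrite P4.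
      replace (2 * L * (eps * L)) with (2 ^ n * 2 ^ n * (2 * (L / 2 ^ n) * (eps * (L / 2 ^ n)))) by (field; lra).
      apply Rmult_le_compat_l; [nra|]. eapply Rle_trans; [exact B|].
      assert (0 < L / 2 ^ n) by (apply Rdiv_lt_0_compat; lra). apply Rmult_le_compat_r; [nra|]. lra. }
    replace (2 * L * (eps * L)) with (e0 / 2) in B2 by (unfold eps; field; lra). lra.
Qed.

(** * Mean values and the maximum principle *)

(** Differentiability at a single point. Quantifying it over a set makes it easy to leave out one
    exceptional point. *)
Definition hol (f : C -> C) (z : C) : Prop := exists l, cdiff f z l.

Lemma hol_ccont (f : C -> C) (z : C) : hol f z -> ccont f z.
Proof. intros [l H]. now apply cdiff_ccont in H. Qed.

Lemma hol_const (c z : C) : hol (fun _ => c) z.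
Proof. eexists. apply cdiff_const. Qed.

Lemma hol_id (z : C) : hol (fun w => w) z.
Proof. eexists. apply cdiff_id. Qed.

Lemma hol_plus (f g : C -> C) (z : C) : hol f z -> hol g z -> hol (fun w => f w + g w)%C z.
Proof. intros [a Ha] [b Hb]. eexists. apply cdiff_plus; eassumption. Qed.

Lemma hol_minus (f g : C -> C) (z : C) : hol f z -> hol g z -> hol (fun w => f w - g w)%C z.
Proof. intros [a Ha] [b Hb]. eexists. apply cdiff_minus; eassumption. Qed.

Lemma hol_mult (f g : C -> C) (z : C) : hol f z -> hol g z -> hol (fun w => f w * g w)%C z.
Proof. intros [a Ha] [b Hb]. eexists. apply cdiff_mult; eassumption. Qed.

Lemma hol_div (f g : C -> C) (z : C) :
  hol f z -> hol g z -> g z <> RtoC 0 -> hol (fun w => f w / g w)%C z.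
Proof. intros [a Ha] [b Hb] N. eexists. apply cdiff_div; eassumption. Qed.

Lemma hol_comp (f g : C -> C) (z : C) : hol f z -> hol g (f z) -> hol (fun w => g (f w)) z.
Proof. intros [a Ha] [b Hb]. eexists. eapply (cdiff_comp f g); eassumption. Qed.

Lemma hol_cexp (f : C -> C) (z : C) : hol f z -> hol (fun w => cexp (f w)) z.
Proof. intro H. apply (hol_comp f cexp); [exact H|]. eexists. apply cdiff_cexp. Qed.

Lemma hol_ext_loc (f g : C -> C) (z : C) (r : R) :
  0 < r -> (forall w, Cmod (w - z) < r -> f w = g w) -> hol f z -> hol g z.
Proof. intros Hr E [l H]. exists l. eapply cdiff_ext_loc; eassumption. Qed.

(** The radius is [e^s]: circles around [a] are images of vertical segments under [w |-> a + e^w],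
    so Goursat's theorem on rectangles applies to annuli. *)
Definition circle (a : C) (s y : R) : C := (a + cexp (s, y))%C.

Lemma circle_dist (a : C) (s y : R) : Cmod (circle a s y - a) = exp s.
Proof.
  unfold circle. replace (a + cexp (s, y) - a)%C with (cexp (s, y)) by ring. now rewrite Cmod_cexp.
Qed.

Lemma hol_circle (f : C -> C) (a : C) (s y : R) :
  hol f (circle a s y) -> hol (fun w => f (a + cexp w))%C (s, y).
Proof.
  intro H. apply (hol_comp (fun w => a + cexp w)%C f); [|exact H].
  apply hol_plus; [apply hol_const|apply hol_cexp, hol_id].
Qed.

Lemma rcont_circle (f : C -> C) (a : C) (s y : R) :
  ccont f (circle a s y) -> rcont (fun t => f (circle a s t)) y.
Proof.
  intro H. apply (rcont_vertical (fun w => f (a + cexp w))%C).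
  apply (ccont_comp (fun w => a + cexp w)%C f); [|exact H].
  apply hol_ccont, hol_plus; [apply hol_const|apply hol_cexp, hol_id].
Qed.

Lemma CInt_const (c : C) (a b : R) : CInt (fun _ => c) a b = ((b - a)%R * c)%C.
Proof.
  unfold CInt. rewrite (RInt_const (V := C_R_CompleteNormedModule)). apply (scal_R_Cmult (b - a) c).
Qed.

(* Apply Goursat to [w |-> f (a + e^w)]: the two horizontal sides cancel by periodicity. *)
Lemma circle_int_indep (f : C -> C) (a : C) (r s1 s2 : R) : s1 <= s2 -> exp s2 < r ->
  (forall z, 0 < Cmod (z - a) < r -> hol f z) ->
  CInt (fun y => Ci * f (circle a s1 y))%C 0 (2 * PI)
  = CInt (fun y => Ci * f (circle a s2 y))%C 0 (2 * PI).
Proof.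
  intros Hs Hr Hf. pose proof PI_RGT_0.
  pose proof (goursat (fun w => f (a + cexp w))%C s1 s2 0 (2 * PI) Hs ltac:(lra)) as G.
  unfold boundary_int in G. assert (E : forall s, cexp (s, 2 * PI) = cexp (s, 0)).
  { intro s. unfold cexp; simpl. now rewrite cos_2PI, sin_2PI, cos_0, sin_0. }
  rewrite (CInt_ext (fun s => f (a + cexp (s, (2 * PI)%R))%C) (fun s => f (a + cexp (s, 0))%C)) in G
    by (intro; now rewrite E).
  symmetry. unfold circle. apply Ceq_minus. rewrite <- G; [ring|].
  intros x y Hx Hy. apply hol_circle. apply Hf. rewrite circle_dist. split; [apply exp_pos|].
  apply Rle_lt_trans with (exp s2); [|exact Hr].
  destruct (proj2 Hx) as [L|L]; [left; now apply exp_increasing|right; now rewrite L].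
Qed.

Lemma exists_small_exp (d s : R) : 0 < d -> exists s', s' <= s /\ exp s' < d.
Proof.
  intro Hd. exists (Rmin s (ln d - 1)). split; [apply Rmin_l|].
  rewrite <- (exp_ln d) at 2 by exact Hd. apply exp_increasing. pose proof (Rmin_r s (ln d - 1)). lra.
Qed.

(** The integral does not depend on the radius, and continuity at [a] gives its value as the radius
    shrinks. Asking only for continuity at the centre lets the lemma apply to slope functions. *)
Lemma circle_mean (f : C -> C) (a : C) (r s : R) : exp s < r ->
  (forall z, 0 < Cmod (z - a) < r -> hol f z) -> ccont f a ->
  CInt (fun y => Ci * f (circle a s y))%C 0 (2 * PI) = ((2 * PI)%R * (Ci * f a))%C.
Proof.
  intros Hr Hf Hc. pose proof PI_RGT_0. apply (Cmod_le_all_eps _ _ (2 * PI)). intros e He.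
  destruct (Hc e He) as [d [Hd K]]. destruct (exists_small_exp d s Hd) as [s' [Hs' Hd']].
  rewrite <- (circle_int_indep f a r s' s Hs' Hr Hf).
  replace ((2 * PI)%R * (Ci * f a))%C with (CInt (fun _ => Ci * f a)%C 0 (2 * PI))
    by (rewrite CInt_const; now rewrite Rminus_0_r).
  assert (Hr' : exp s' < r).
  { apply Rle_lt_trans with (exp s); [|exact Hr].
    destruct Hs' as [L|L]; [left; now apply exp_increasing|right; now rewrite L]. }
  assert (Cz : forall y, ccont (fun z => Ci * f z)%C (circle a s' y)).
  { intro y. apply ccont_mult; [apply ccont_const|]. apply hol_ccont, Hf.
    rewrite circle_dist. split; [apply exp_pos|exact Hr']. }
  rewrite <- CInt_minus.
  - replace (e * (2 * PI)) with ((2 * PI - 0) * e) by ring. apply CInt_bound; [lra| |].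
    + intros t _. apply (rcont_circle (fun z => Ci * f z - Ci * f a)%C).
      apply ccont_minus; [apply Cz|apply ccont_const].
    + intros t _. replace (Ci * f (circle a s' t) - Ci * f a)%C with (Ci * (f (circle a s' t) - f a))%C by ring.
      rewrite Cmod_mult, Cmod_Ci, Rmult_1_l. left. apply K. now rewrite circle_dist.
  - apply ex_CInt; [lra|]. intros. now apply (rcont_circle (fun z => Ci * f z)%C).
  - apply ex_CInt; [lra|]. intros. apply continuous_const.
Qed.

(** * Maxima on compact sets and the maximum principle *)

Definition bounded_set (K : C -> Prop) : Prop := exists M, forall z, K z -> Cmod z <= M.
Definition closed_set (K : C -> Prop) : Prop :=
  forall z, (forall e, 0 < e -> exists w, K w /\ Cmod (w - z) < e) -> K z.

(** Without a maximum, bisection produces shrinking rectangles each containing points of [K] that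
    beat any prescribed point of [K]. At their common point, which lies in the closed set [K], this
    contradicts upper semicontinuity, the only regularity asked of [u]. *)
Lemma compact_max (K : C -> Prop) (u : C -> R) (z0 : C) :
  bounded_set K -> closed_set K -> K z0 ->
  (forall z, K z -> forall e, 0 < e -> exists d, 0 < d /\
     forall w, K w -> Cmod (w - z) < d -> u w < u z + e) ->
  exists z, K z /\ forall w, K w -> u w <= u z.
Proof.
  intros [M HM] Hcl Hz0 Hu. apply NNPP. intro N. assert (N' : forall z, K z -> exists w, K w /\ u z < u w).
  { intros z Hz. apply NNPP. intro Q. apply N. exists z. split; [exact Hz|].
    intros w Hw. apply Rnot_lt_le. intro L. apply Q. now exists w. }
  clear N. assert (HM0 : 0 <= M) by (pose proof (HM z0 Hz0); pose proof (Cmod_ge_0 z0); lra).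
  set (inR := fun a b c d (z : C) => a <= fst z <= b /\ c <= snd z <= d). destruct (rectangle_bisection
    (fun _ a b c d => forall z, K z -> exists w, K w /\ inR a b c d w /\ u z < u w) (- M) M (- M) M)
    as [x [y [_ [_ HP]]]]; try lra.
  (* If all four quarters failed, each would have a point of [K] that no member of that quarter
     beats; the best of the four would not be beaten in the whole rectangle. *)
  - intros _ a b c d Hab Hcd HP. apply NNPP. intro Q.
    assert (Q' : forall A B C' D, ~ (forall z, K z -> exists w, K w /\ inR A B C' D w /\ u z < u w) ->
       exists z, K z /\ forall w, K w -> inR A B C' D w -> u w <= u z).
    { intros A B C' D Q1. apply not_all_ex_not in Q1. destruct Q1 as [z Q1].
      apply imply_to_and in Q1. destruct Q1 as [Kz Q1]. exists z. split; [exact Kz|].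
      intros w Hw Iw. apply Rnot_lt_le. intro L. apply Q1. now exists w. }
    apply not_or_and in Q. destruct Q as [Q1 Q]. apply not_or_and in Q. destruct Q as [Q2 Q].
    apply not_or_and in Q. destruct Q as [Q3 Q4].
    apply Q' in Q1; apply Q' in Q2; apply Q' in Q3; apply Q' in Q4.
    destruct Q1 as [z1 [K1 U1]]; destruct Q2 as [z2 [K2 U2]];
    destruct Q3 as [z3 [K3 U3]]; destruct Q4 as [z4 [K4 U4]].
    assert (Mx : forall p q, K p -> K q -> exists r, K r /\ u p <= u r /\ u q <= u r).
    { intros p q Kp Kq. destruct (Rle_lt_dec (u p) (u q)); [exists q|exists p]; repeat split; auto; lra. }
    destruct (Mx z1 z2 K1 K2) as [p [Kp [P1 P2]]]. destruct (Mx z3 z4 K3 K4) as [q [Kq [P3 P4]]].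
    destruct (Mx p q Kp Kq) as [r [Kr [P5 P6]]]. destruct (HP r Kr) as [w [Kw [[I1 I2] L]]].
    assert (u w <= u r); [|lra].
    destruct (Rle_lt_dec (fst w) ((a + b) / 2)); destruct (Rle_lt_dec (snd w) ((c + d) / 2)).
    + specialize (U1 w Kw). unfold inR in U1. lra.
    + specialize (U3 w Kw). unfold inR in U3. lra.
    + specialize (U2 w Kw). unfold inR in U2. lra.
    + specialize (U4 w Kw). unfold inR in U4. lra.
  - intros z Hz. destruct (N' z Hz) as [w [Kw L]]. exists w. split; [exact Kw|]. split; [|exact L].
    specialize (HM w Kw). pose proof (Rabs_fst_le w); pose proof (Rabs_snd_le w).
    split; apply Rabs_le_between; lra.
  - set (z := (x, y) : C) in *.
    assert (Near : forall e, 0 < e -> forall z', K z' -> exists w, K w /\ Cmod (w - z) < e /\ u z' < u w).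
    { intros e He z' Kz'. destruct (pow2_unbounded ((4 * M + 1) / e)) as [n Hn].
      destruct (HP n) as [a [b [c [d [Hw [A1 [A2 [A3 [A4 [W1 W2]]]]]]]]]].
      destruct (Hw z' Kz') as [w [Kw [[I1 I2] L]]]. exists w. split; [exact Kw|]. split; [|exact L].
      eapply Rle_lt_trans; [apply Cmod_sum_abs|]. simpl.
      assert (Rabs (fst w + - x) <= b - a) by (apply Rabs_le; lra).
      assert (Rabs (snd w + - y) <= d - c) by (apply Rabs_le; lra). pose proof (pow_lt 2 n ltac:(lra)).
      apply Rle_lt_trans with ((4 * M) / 2 ^ n).
      - rewrite W1 in H. rewrite W2 in H0. unfold Rdiv in *. lra.
      - apply Rlt_div_l; [lra|]. apply Rlt_div_l in Hn; [lra|exact He]. }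
    assert (Kz : K z).
    { apply Hcl. intros e He. destruct (Near e He z0 Hz0) as [w [Kw [Lw _]]]. now exists w. }
    destruct (N' z Kz) as [z1 [Kz1 L1]]. destruct (Hu z Kz (u z1 - u z)) as [d [Hd K']]; [lra|].
    destruct (Near d Hd z1 Kz1) as [w [Kw [Lw Uw]]]. specialize (K' w Kw Lw). lra.
Qed.

(** The mean of [|w|^2] over the circle exceeds its value at the centre by the squared radius. This
    excess provides the strictness in the maximum principle. *)
Lemma RInt_circle_sq (z : C) (s : R) :
  is_RInt (V := R_NormedModule) (fun y => Cmod (circle z s y) * Cmod (circle z s y)) 0 (2 * PI)
    (2 * PI * (Cmod z * Cmod z + exp s * exp s)).
Proof.
  set (F := fun y => (Cmod z * Cmod z + exp s * exp s) * y + 2 * exp s * (fst z * sin y - snd z * cos y)).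
  replace (2 * PI * (Cmod z * Cmod z + exp s * exp s)) with (minus (F (2 * PI)) (F 0)).
  2:{ unfold F, minus, plus, opp; simpl. rewrite sin_2PI, cos_2PI, sin_0, cos_0. ring. }
  apply (is_RInt_ext (V := R_NormedModule)
    (fun y => (Cmod z * Cmod z + exp s * exp s) + 2 * exp s * (fst z * cos y + snd z * sin y))).
  { intros y _. rewrite !Cmod_sq. unfold circle, cexp. simpl. pose proof (sin2_cos2 y) as T. unfold Rsqr in T.
    replace ((fst z + exp s * cos y) * (fst z + exp s * cos y) + (snd z + exp s * sin y) * (snd z + exp s * sin y))
      with (fst z * fst z + snd z * snd z + exp s * exp s * (sin y * sin y + cos y * cos y)
            + 2 * exp s * (fst z * cos y + snd z * sin y)) by ring.
    rewrite T. ring. }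
  apply (is_RInt_derive (V := R_CompleteNormedModule)).
  - intros y _. unfold F. auto_derive; [trivial|ring].
  - intros y _. apply (ex_derive_continuous (V := R_NormedModule)). auto_derive. trivial.
Qed.

(* The perturbation [eta * |z|^2] makes the sub-mean-value inequality strict, which excludes interior maxima. *)
Lemma maximum_principle (K S : C -> Prop) (f : C -> C) (B : R) :
  bounded_set K -> closed_set K -> (forall z, K z -> ccont f z) ->
  (forall z, K z -> ~ S z -> exists r, 0 < r /\
     forall w, Cmod (w - z) < r -> K w /\ (w <> z -> hol f w)) ->
  (forall z, K z -> S z -> Cmod (f z) <= B) ->
  forall z, K z -> Cmod (f z) <= B.
Proof.
  intros Hb Hcl Hc Hint HB z1 Hz1. pose proof PI_RGT_0. destruct Hb as [M HM].
  assert (HM0 : 0 <= M) by (pose proof (HM z1 Hz1); pose proof (Cmod_ge_0 z1); lra).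
  assert (Main : forall eta, 0 < eta -> Cmod (f z1) <= B + eta * (M * M)).
  { intros eta Heta. set (u := fun z => Cmod (f z) + eta * (Cmod z * Cmod z)).
    destruct (compact_max K u z1) as [z [Kz Uz]]; auto.
    - now exists M.
    - intros z Kz e He. destruct (Hc z Kz (e / 2)) as [d1 [D1 K1]]; [lra|].
      set (q := e / (2 * eta * (2 * M + 1))). assert (Hq : 0 < q) by (unfold q; apply Rdiv_lt_0_compat; nra).
      exists (Rmin d1 q). split; [apply Rmin_pos; assumption|].
      intros w Kw Hw. specialize (K1 w (Rlt_le_trans _ _ _ Hw (Rmin_l _ _))).
      pose proof (Rlt_le_trans _ _ _ Hw (Rmin_r _ _)) as Hw2.
      pose proof (Cmod_minus_le (f w) (f z)). pose proof (Cmod_minus_le w z).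
      pose proof (HM z Kz). pose proof (HM w Kw). pose proof (Cmod_ge_0 z). pose proof (Cmod_ge_0 w).
      assert (eta * (Cmod w * Cmod w - Cmod z * Cmod z) <= e / 2); [|unfold u; lra].
      apply Rle_trans with (eta * (q * (2 * M + 1))).
      + apply Rmult_le_compat_l; [lra|]. nra.
      + right. unfold q. field. split; lra.
    - assert (Sz : S z).
      { apply NNPP. intro NS. destruct (Hint z Kz NS) as [r [Hr Hw]].
        destruct (exists_small_exp r 0 Hr) as [s [_ Hs]].
        assert (Hf : forall w, 0 < Cmod (w - z) < r -> hol f w).
        { intros w [W1 W2]. apply Hw; [exact W2|]. intros ->.
          replace (z - z)%C with (RtoC 0) in W1 by ring. rewrite Cmod_0 in W1. lra. }
        pose proof (circle_mean f z r s Hs Hf (Hc z Kz)) as E.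
        assert (I : Cmod (CInt (fun y => Ci * f (circle z s y))%C 0 (2 * PI))
            <= 2 * PI * u z - eta * (2 * PI * (Cmod z * Cmod z + exp s * exp s))).
        { rewrite <- norm_Cmod. apply (norm_RInt_le (V := C_R_NormedModule) (fun y => Ci * f (circle z s y))%C
            (fun y => u z - eta * (Cmod (circle z s y) * Cmod (circle z s y))) 0 (2 * PI)); [lra| | |].
          - intros y _. rewrite norm_Cmod, Cmod_mult, Cmod_Ci, Rmult_1_l.
            assert (Kc : K (circle z s y)) by (apply Hw; rewrite circle_dist; exact Hs).
            specialize (Uz _ Kc). unfold u in Uz at 1. lra.
          - apply CInt_correct, ex_CInt; [lra|]. intros y _.
            apply (rcont_circle (fun w => Ci * f w)%C). apply ccont_mult; [apply ccont_const|].
            apply Hc. apply Hw. rewrite circle_dist. exact Hs.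
          - apply (is_RInt_minus (V := R_NormedModule)).
            + replace (2 * PI * u z) with (scal (V := R_NormedModule) (2 * PI - 0) (u z))
                by (unfold scal; simpl; unfold mult; simpl; ring).
              apply (is_RInt_const (V := R_NormedModule)).
            + apply (is_RInt_scal (V := R_NormedModule)). apply RInt_circle_sq. }
        rewrite E, !Cmod_mult, Cmod_Ci, Cmod_RtoC_pos in I by lra.
        unfold u in I. pose proof (exp_pos s). assert (0 < 2 * PI * eta * (exp s * exp s)) by (apply Rmult_lt_0_compat; [apply Rmult_lt_0_compat; lra|nra]). nra. }
      specialize (Uz z1 Hz1). specialize (HB z Kz Sz). unfold u in Uz.
      pose proof (HM z Kz). pose proof (Cmod_ge_0 z). pose proof (Cmod_ge_0 z1).
      assert (eta * (Cmod z * Cmod z) <= eta * (M * M)) by (apply Rmult_le_compat_l; nra).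
      assert (0 <= eta * (Cmod z1 * Cmod z1)) by (apply Rmult_le_pos; nra). lra. }
  apply Rnot_lt_le. intro L. specialize (Main ((Cmod (f z1) - B) / (2 * (M * M + 1)))).
  assert (P : 0 < (Cmod (f z1) - B) / (2 * (M * M + 1))) by (apply Rdiv_lt_0_compat; nra). specialize (Main P).
  assert ((Cmod (f z1) - B) / (2 * (M * M + 1)) * (M * M) <= (Cmod (f z1) - B) / 2).
  { apply Rle_trans with ((Cmod (f z1) - B) / (2 * (M * M + 1)) * (M * M + 1)).
    - apply Rmult_le_compat_l; lra.
    - right. field. nra. }
  lra.
Qed.

Lemma closed_disc_closed (a : C) (r : R) : closed_set (fun z => Cmod (z - a) <= r).
Proof.
  intros z H. apply Rnot_lt_le. intro L. destruct (H (Cmod (z - a) - r)) as [w [W1 W2]]; [lra|].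
  pose proof (Cmod_split z w a). rewrite (Cmod_minus_sym z w) in H0. lra.
Qed.

Lemma closed_disc_bounded (a : C) (r : R) : bounded_set (fun z => Cmod (z - a) <= r).
Proof.
  exists (r + Cmod a). intros z H. pose proof (Cmod_minus_le z a). lra.
Qed.

Lemma closed_disc_interior (a z : C) (r : R) : Cmod (z - a) < r ->
  forall w, Cmod (w - z) < r - Cmod (z - a) -> Cmod (w - a) <= r.
Proof. intros H w Hw. pose proof (Cmod_split w z a). lra. Qed.

(** At the exceptional point [p] only continuity is known. It accommodates the quotient [f z / z] at
    the origin in the Schwarz lemma. *)
Lemma maximum_principle_disc (f : C -> C) (a p : C) (r B : R) :
  (forall z, Cmod (z - a) <= r -> ccont f z) ->
  (forall z, Cmod (z - a) <= r -> z <> p -> hol f z) ->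
  (forall z, Cmod (z - a) = r -> Cmod (f z) <= B) ->
  forall z, Cmod (z - a) <= r -> Cmod (f z) <= B.
Proof.
  intros Hc Hf HB. apply (maximum_principle (fun z => Cmod (z - a) <= r) (fun z => Cmod (z - a) = r) f B).
  - apply closed_disc_bounded.
  - apply closed_disc_closed.
  - exact Hc.
  - intros z Kz Nz. assert (Lz : Cmod (z - a) < r) by lra. destruct (Ceq_dec z p) as [->|N].
    + exists (r - Cmod (p - a)). split; [lra|]. intros w Hw.
      pose proof (closed_disc_interior a p r Lz w Hw). split; auto.
    + pose proof (proj1 (Cmod_gt_0 _) (Cminus_neq0 _ _ N)).
      exists (Rmin (r - Cmod (z - a)) (Cmod (z - p))). split; [apply Rmin_pos; lra|]. intros w Hw.
      pose proof (closed_disc_interior a z r Lz w (Rlt_le_trans _ _ _ Hw (Rmin_l _ _))) as W.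
      pose proof (Rlt_le_trans _ _ _ Hw (Rmin_r _ _)) as W2.
      split; [exact W|]. intros _. apply Hf; [exact W|]. intros ->. rewrite Cmod_minus_sym in W2. lra.
  - intros z _ E. now apply HB.
Qed.

(* Otherwise [1 / (f - v)] would violate the maximum principle. *)
Lemma covering (f : C -> C) (a v : C) (r m : R) : 0 <= r ->
  (forall z, Cmod (z - a) <= r -> hol f z) ->
  (forall z, Cmod (z - a) = r -> m <= Cmod (f z - v)) -> Cmod (f a - v) < m ->
  exists z, Cmod (z - a) <= r /\ f z = v.
Proof.
  intros Hr Hf Hm Ha. apply NNPP. intro N. assert (N' : forall z, Cmod (z - a) <= r -> (f z - v)%C <> RtoC 0).
  { intros z Hz E. apply N. exists z. split; [exact Hz|]. now apply Ceq_minus. }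
  assert (Ea : Cmod (a - a) <= r).
  { now rewrite Cmod_diag. }
  assert (Hg : forall z, Cmod (z - a) <= r -> hol (fun w => 1 / (f w - v))%C z).
  { intros z Hz. apply hol_div; [apply hol_const| |now apply N'].
    apply hol_minus; [now apply Hf|apply hol_const]. }
  assert (P : 0 < Cmod (f a - v)) by (apply Cmod_gt_0, N', Ea). assert (B : Cmod (1 / (f a - v)) <= 1 / m).
  { apply (maximum_principle_disc (fun w => 1 / (f w - v))%C a a r); auto.
    - intros. now apply hol_ccont, Hg.
    - intros z Hz. assert (Hz' : Cmod (z - a) <= r) by lra.
      rewrite Cmod_div, Cmod_1 by now apply N'. specialize (Hm z Hz).
      unfold Rdiv. rewrite !Rmult_1_l. apply Rinv_le_contravar; lra. }
  rewrite Cmod_div, Cmod_1 in B by now apply N'. unfold Rdiv in B. rewrite !Rmult_1_l in B.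
  apply Rinv_le_contravar in B; [|apply Rinv_0_lt_compat; lra]. rewrite !Rinv_inv in B. lra.
Qed.

Lemma schwarz_lemma (f : C -> C) : (forall z, Cmod z < 1 -> hol f z) ->
  (forall z, Cmod z < 1 -> Cmod (f z) <= 1) -> f 0 = 0 ->
  forall z, Cmod z < 1 -> Cmod (f z) <= Cmod z.
Proof.
  intros Hf Hb H0 z Hz. destruct (Hf 0) as [d Hd]; [rewrite Cmod_0; lra|].
  apply cdiff_slope in Hd. destruct Hd as [k [Kc [_ Kf]]]. assert (Kf' : forall w, f w = (k w * w)%C).
  { intro w. specialize (Kf w). rewrite H0 in Kf. replace (f w - 0)%C with (f w) in Kf by ring. rewrite Kf. ring. }
  assert (Kh : forall w, Cmod w < 1 -> w <> RtoC 0 -> hol k w).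
  { intros w Hw Nw. pose proof (proj1 (Cmod_gt_0 _) Nw) as P.
    apply (hol_ext_loc (fun u => f u / u)%C k w (Cmod w)); [exact P| |].
    - intros u Hu. rewrite Kf'. field. intros ->.
      replace (0 - w)%C with (- w)%C in Hu by ring. rewrite Cmod_opp in Hu. lra.
    - apply hol_div; [now apply Hf|apply hol_id|exact Nw]. }
  assert (Kb : Cmod (k z) <= 1).
  (* Any radius [rho] strictly between [q] and 1 encloses [z] and satisfies [1 / rho < |k z|],
     contradicting the bound [1 / rho] on the circle of radius [rho]; the midpoint is taken. *)
  { apply Rnot_lt_le. intro L. set (q := Rmax (Cmod z) (/ Cmod (k z))). assert (Q1 : q < 1).
    { apply Rmax_lub_lt; [exact Hz|]. rewrite <- Rinv_1. apply Rinv_lt_contravar; lra. }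
    assert (Q2 : Cmod z <= q) by apply Rmax_l. assert (Q3 : / Cmod (k z) <= q) by apply Rmax_r.
    set (rho := (1 + q) / 2). assert (0 < / Cmod (k z)) by (apply Rinv_0_lt_compat; lra).
    assert (B : Cmod (k z) <= / rho).
    { apply (maximum_principle_disc k 0 0 rho).
      - intros w Hw. replace (w - 0)%C with w in Hw by ring.
        destruct (Ceq_dec w 0) as [->|N]; [exact Kc|]. apply hol_ccont, Kh; [unfold rho in Hw; lra|exact N].
      - intros w Hw N. replace (w - 0)%C with w in Hw by ring. apply Kh; [unfold rho in Hw; lra|exact N].
      - intros w Hw. replace (w - 0)%C with w in Hw by ring.
        assert (Hw' : Cmod w < 1) by (unfold rho in Hw; lra).
        specialize (Hb w Hw'). rewrite Kf', Cmod_mult, Hw in Hb.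
        apply Rmult_le_reg_r with rho; [unfold rho; lra|]. rewrite Rinv_l by (unfold rho; lra). exact Hb.
      - replace (z - 0)%C with z by ring. unfold rho; lra. }
    assert (/ rho < Cmod (k z)); [|lra].
    rewrite <- (Rinv_inv (Cmod (k z))). apply Rinv_lt_contravar; [|unfold rho; lra].
    apply Rmult_lt_0_compat; unfold rho; lra. }
  rewrite Kf', Cmod_mult. pose proof (Cmod_ge_0 z). nra.
Qed.

(** * Möbius maps and the Schwarz-Pick lemma *)

Definition mobius (a z : C) : C := ((z - a) / (1 - Cconj a * z))%C.

Lemma mobius_identity (a z : C) :
  Cmod (1 - Cconj a * z) * Cmod (1 - Cconj a * z) - Cmod (z - a) * Cmod (z - a)
  = (1 - Cmod a * Cmod a) * (1 - Cmod z * Cmod z).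
Proof. rewrite !Cmod_sq. simpl. ring. Qed.

Lemma mobius_den (a z : C) : Cmod a < 1 -> Cmod z < 1 -> (1 - Cconj a * z)%C <> RtoC 0.
Proof.
  intros Ha Hz. apply Cmod_gt_0.
  pose proof (Cmod_minus_le 1 (Cconj a * z)). rewrite Cmod_1, Cmod_mult, Cmod_conj in H.
  pose proof (Cmod_ge_0 a); pose proof (Cmod_ge_0 z). nra.
Qed.

Lemma mobius_lt1 (a z : C) : Cmod a < 1 -> Cmod z < 1 -> Cmod (mobius a z) < 1.
Proof.
  intros Ha Hz. pose proof (mobius_den a z Ha Hz) as N. pose proof (proj1 (Cmod_gt_0 _) N) as P.
  unfold mobius. rewrite Cmod_div by exact N. apply Rlt_div_l; [exact P|]. rewrite Rmult_1_l.
  pose proof (mobius_identity a z). pose proof (Cmod_ge_0 (z - a)).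
  pose proof (Cmod_ge_0 a); pose proof (Cmod_ge_0 z).
  assert (0 < (1 - Cmod a * Cmod a) * (1 - Cmod z * Cmod z)) by (apply Rmult_lt_0_compat; nra). nra.
Qed.

Lemma hol_mobius (a z : C) : Cmod a < 1 -> Cmod z < 1 -> hol (mobius a) z.
Proof.
  intros Ha Hz. apply hol_div; [| |now apply mobius_den].
  - apply hol_minus; [apply hol_id|apply hol_const].
  - apply hol_minus; [apply hol_const|]. apply hol_mult; [apply hol_const|apply hol_id].
Qed.

Lemma mobius_cancel (a z : C) : Cmod a < 1 -> Cmod z < 1 -> mobius (- a)%C (mobius a z) = z.
Proof.
  intros Ha Hz. pose proof (mobius_den a z Ha Hz) as N1. assert (Ha' : Cmod (- a) < 1) by now rewrite Cmod_opp.
  pose proof (mobius_den (- a)%C (mobius a z) Ha' (mobius_lt1 a z Ha Hz)) as N2.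
  pose proof (mobius_den a a Ha Ha) as N3.
  unfold mobius in *. rewrite Copp_conj in *. field. split; [exact N1|]. intro E. apply N3. rewrite <- E. ring.
Qed.

(** Möbius maps move [a] and [f a] to the origin, where the Schwarz lemma applies. Denominators are
    cleared so that the inequality can be expanded in a time parameter or divided by [|z - a|]. *)
Lemma schwarz_pick (f : C -> C) : (forall z, Cmod z < 1 -> hol f z) ->
  (forall z, Cmod z < 1 -> Cmod (f z) < 1) -> forall a z, Cmod a < 1 -> Cmod z < 1 ->
  Cmod (f z - f a) * Cmod (1 - Cconj a * z) <= Cmod (z - a) * Cmod (1 - Cconj (f a) * f z).
Proof.
  intros Hf Hb a z Ha Hz. assert (Ha' : Cmod (- a) < 1) by now rewrite Cmod_opp.
  set (g := fun u => mobius (f a) (f (mobius (- a)%C u))). assert (M0 : mobius (- a)%C 0 = a).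
  { unfold mobius. replace (1 - Cconj (- a) * 0)%C with (RtoC 1) by ring. field. }
  assert (G : Cmod (g (mobius a z)) <= Cmod (mobius a z)).
  { apply (schwarz_lemma g).
    - intros u Hu. unfold g. apply (hol_comp (fun u => f (mobius (- a)%C u)) (mobius (f a))).
      + apply (hol_comp (mobius (- a)%C) f); [now apply hol_mobius|]. apply Hf. now apply mobius_lt1.
      + apply hol_mobius; auto. apply Hb, mobius_lt1; auto.
    - intros u Hu. left. unfold g. apply mobius_lt1; auto. apply Hb, mobius_lt1; auto.
    - unfold g. rewrite M0. unfold mobius, Cdiv. ring.
    - now apply mobius_lt1. }
  unfold g in G. rewrite mobius_cancel in G by assumption. unfold mobius in G.
  pose proof (mobius_den a z Ha Hz) as N1. pose proof (mobius_den (f a) (f z) (Hb a Ha) (Hb z Hz)) as N2.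
  rewrite !Cmod_div in G by assumption. apply Cmod_gt_0 in N1. apply Cmod_gt_0 in N2.
  set (A1 := Cmod (1 - Cconj a * z)) in *. set (A2 := Cmod (1 - Cconj (f a) * f z)) in *.
  apply (Rmult_le_compat_r (A1 * A2)) in G; [|nra].
  replace (Cmod (f z - f a) / A2 * (A1 * A2)) with (Cmod (f z - f a) * A1) in G by (field; lra).
  replace (Cmod (z - a) / A1 * (A1 * A2)) with (Cmod (z - a) * A2) in G by (field; lra). exact G.
Qed.

Lemma ccont_Cmod_le (F G : C -> C) (a : C) (r : R) : 0 < r -> ccont F a -> ccont G a ->
  (forall w, w <> a -> Cmod (w - a) < r -> Cmod (F w) <= Cmod (G w)) -> Cmod (F a) <= Cmod (G a).
Proof.
  intros Hr HF HG H. apply Rnot_lt_le. intro L. set (e := (Cmod (F a) - Cmod (G a)) / 2).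
  destruct (HF e) as [d1 [D1 K1]]; [unfold e; lra|]. destruct (HG e) as [d2 [D2 K2]]; [unfold e; lra|].
  set (t := Rmin r (Rmin d1 d2) / 2).
  assert (P : 0 < Rmin r (Rmin d1 d2)) by (repeat apply Rmin_pos; assumption).
  pose proof (Rmin_bounds r (Rmin d1 d2)). pose proof (Rmin_bounds d1 d2). assert (E : Cmod (a + t - a) = t).
  { replace (a + t - a)%C with (RtoC t) by ring. apply Cmod_RtoC_pos. unfold t; lra. }
  specialize (K1 (a + t)%C). specialize (K2 (a + t)%C). specialize (H (a + t)%C).
  rewrite E in *. specialize (K1 ltac:(unfold t; lra)). specialize (K2 ltac:(unfold t; lra)).
  assert (N : (a + t)%C <> a).
  { intro E'. rewrite E' in E. replace (a - a)%C with (RtoC 0) in E by ring. rewrite Cmod_0 in E. unfold t in E; lra. }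
  specialize (H N ltac:(unfold t; lra)).
  pose proof (Cmod_minus_le (F a) (F (a + t)%C)) as Q. rewrite Cmod_minus_sym in Q.
  pose proof (Cmod_minus_le (G (a + t)%C) (G a)). unfold e in *. lra.
Qed.

(** Schwarz-Pick with the factor [|w - a|] cancelled, in the limit [w -> a]; writing [f w - f a]
    through the slope [k] makes both sides continuous at [a]. *)
Lemma schwarz_pick_deriv (f : C -> C) (a d : C) : (forall z, Cmod z < 1 -> hol f z) ->
  (forall z, Cmod z < 1 -> Cmod (f z) < 1) -> Cmod a < 1 -> cdiff f a d ->
  Cmod d * (1 - Cmod a * Cmod a) <= 1 - Cmod (f a) * Cmod (f a).
Proof.
  intros Hf Hb Ha Hd. assert (Sq : forall b, Cmod b < 1 -> Cmod (1 - Cconj b * b) = 1 - Cmod b * Cmod b).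
  { intros b H. replace (1 - Cconj b * b)%C with (RtoC (1 - Cmod b * Cmod b)).
    - apply Cmod_RtoC_pos. pose proof (Cmod_ge_0 b). nra.
    - rewrite Cmod_sq. apply injective_projections; simpl; ring. }
  pose proof (cdiff_ccont _ _ _ Hd) as Cf. apply cdiff_slope in Hd. destruct Hd as [k [Kc [Kd Kf]]].
  rewrite <- Kd, <- !Sq, <- Cmod_mult; auto.
  apply (ccont_Cmod_le (fun z => k z * (1 - Cconj a * z))%C (fun z => 1 - Cconj (f a) * f z)%C a (1 - Cmod a)).
  - lra.
  - apply ccont_mult; [exact Kc|]. apply ccont_minus; [apply ccont_const|].
    apply ccont_mult; [apply ccont_const|apply ccont_id].
  - apply ccont_minus; [apply ccont_const|]. apply ccont_mult; [apply ccont_const|exact Cf].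
  - intros w N Hw. assert (Hw' : Cmod w < 1) by (pose proof (Cmod_minus_le w a); lra).
    pose proof (schwarz_pick f Hf Hb a w Ha Hw') as SP.
    rewrite Kf, Cmod_mult in SP. apply Cminus_neq0, Cmod_gt_0 in N.
    rewrite Cmod_mult. apply Rmult_le_reg_l with (Cmod (w - a)); [exact N|]. lra.
Qed.

(** * The derivative of a holomorphic function is holomorphic *)

Lemma mean_value_segment (f : C -> C) (z w : C) (d : R -> C) (M : R) :
  (forall t, 0 <= t <= 1 -> cdiff f (z + t * (w - z))%C (d t) /\ Cmod (d t) <= M) ->
  Cmod (f w - f z) <= M * Cmod (w - z).
Proof.
  intro H. pose proof (mean_value_ineq (fun t => f (z + (t, 0%R) * (w - z))%C) (fun t => d t * (w - z))%C
    (fun t => M * Cmod (w - z) * t) (fun t => M * Cmod (w - z)) 0 1 ltac:(lra)) as MV.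
  assert (E1 : (z + (1%R, 0%R) * (w - z))%C = w) by (apply injective_projections; simpl; ring).
  assert (E0 : (z + (0%R, 0%R) * (w - z))%C = z) by (apply injective_projections; simpl; ring).
  cbv beta in MV. rewrite E1, E0 in MV. clear E1 E0. rewrite Rmult_1_r, Rmult_0_r, Rminus_0_r in MV. apply MV.
  - intros t Ht. apply (rcdiff_horizontal (fun u => f (z + u * (w - z))%C)). eapply cdiff_eq.
    + apply (cdiff_comp (fun u => z + u * (w - z))%C f).
      * apply cdiff_plus; [apply cdiff_const|apply cdiff_mult; [apply cdiff_id|apply cdiff_const]].
      * apply H. exact Ht.
    + cbv beta. ring.
  - intros t _. auto_derive; [trivial|ring].
  - intros t Ht. rewrite Cmod_mult. apply Rmult_le_compat_r; [apply Cmod_ge_0|]. now apply H.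
Qed.

Lemma segment_dist (c z w : C) (r t : R) : 0 <= t <= 1 ->
  Cmod (z - c) <= r -> Cmod (w - c) <= r -> Cmod (z + t * (w - z) - c) <= r.
Proof.
  intros Ht Hz Hw. replace (z + t * (w - z) - c)%C with ((1 - t)%R * (z - c) + t * (w - c))%C
    by (rewrite RtoC_minus; ring).
  eapply Rle_trans; [apply Cmod_triangle|]. rewrite !Cmod_mult, !Cmod_RtoC_pos by lra. nra.
Qed.

Lemma segment_dist0 (z w : C) (t : R) : 0 <= t <= 1 -> Cmod (z + t * (w - z) - z) <= Cmod (w - z).
Proof.
  intro Ht. replace (z + t * (w - z) - z)%C with (t * (w - z))%C by ring.
  rewrite Cmod_mult, Cmod_RtoC_pos by lra. pose proof (Cmod_ge_0 (w - z)). nra.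
Qed.

Lemma rcont_difference_quotient (f : C -> C) (z c : C) (s y : R) : ccont f (circle z s y) ->
  rcont (fun t => Ci * ((f (circle z s t) - c) / cexp (s, t)))%C y.
Proof.
  intro H. apply (rcont_vertical (fun w => Ci * ((f (z + cexp w) - c) / cexp w))%C).
  assert (Cx : ccont cexp (s, y)) by (eapply cdiff_ccont, cdiff_cexp).
  apply ccont_mult; [apply ccont_const|]. apply ccont_mult.
  - apply ccont_minus; [|apply ccont_const]. apply (ccont_comp (fun w => z + cexp w)%C f); [|exact H].
    apply ccont_plus; [apply ccont_const|exact Cx].
  - apply ccont_inv; [exact Cx|apply cexp_neq_0].
Qed.

(** Cauchy's formula for the derivative, obtained as the mean value property of the slope function,
    which is continuous at the centre and holomorphic around it. *)
Lemma derivative_mean (f : C -> C) (z d : C) (r s : R) : exp s < r ->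
  (forall w, Cmod (w - z) < r -> hol f w) -> cdiff f z d ->
  ((2 * PI)%R * (Ci * d))%C = CInt (fun y => Ci * ((f (circle z s y) - f z) / cexp (s, y)))%C 0 (2 * PI).
Proof.
  intros Hr Hf Hd. apply cdiff_slope in Hd. destruct Hd as [k [Kc [Kd Kf]]].
  rewrite <- Kd, <- (circle_mean k z r s Hr); [| |exact Kc].
  - apply CInt_ext. intro y. f_equal. rewrite Kf. unfold circle. field. apply cexp_neq_0.
  - intros w [W1 W2]. apply (hol_ext_loc (fun u => (f u - f z) / (u - z))%C k w (Cmod (w - z))); [exact W1| |].
    + intros u Hu. rewrite Kf. field. intro E. apply Ceq_minus in E. subst u. rewrite Cmod_minus_sym in Hu. lra.
    + apply hol_div; [apply hol_minus; [now apply Hf|apply hol_const]|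
        apply hol_minus; [apply hol_id|apply hol_const]|now apply Cmod_gt_0].
Qed.

Lemma Cmod_2PI_Ci (d : C) : Cmod ((2 * PI)%R * (Ci * d))%C = 2 * PI * Cmod d.
Proof. pose proof PI_RGT_0. rewrite !Cmod_mult, Cmod_Ci, Cmod_RtoC_pos by lra. ring. Qed.

Lemma hol_bounded_disc (f : C -> C) (a : C) (r : R) : 0 <= r ->
  (forall z, Cmod (z - a) <= r -> ccont f z) ->
  exists M, 0 <= M /\ forall z, Cmod (z - a) <= r -> Cmod (f z) <= M.
Proof.
  intros Hr Hc. destruct (compact_max (fun z => Cmod (z - a) <= r) (fun z => Cmod (f z)) a) as [z [_ Hz]].
  - apply closed_disc_bounded.
  - apply closed_disc_closed.
  - now rewrite Cmod_diag.
  - intros z Hz e He. destruct (Hc z Hz e He) as [d [Hd K]]. exists d. split; [exact Hd|].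
    intros w _ Hw. specialize (K w Hw). pose proof (Cmod_minus_le (f w) (f z)). lra.
  - exists (Cmod (f z)). split; [apply Cmod_ge_0|exact Hz].
Qed.

Lemma rcont_ext (f g : R -> C) (t : R) : (forall s, f s = g s) -> rcont f t -> rcont g t.
Proof. intro H. now apply (continuous_ext (U := C_R_NormedModule)). Qed.

Lemma rcont_minus (f g : R -> C) (t : R) : rcont f t -> rcont g t -> rcont (fun s => f s - g s)%C t.
Proof.
  intros Hf Hg. apply (continuous_plus (V := C_R_NormedModule)); [exact Hf|].
  now apply (continuous_opp (V := C_R_NormedModule)).
Qed.

Lemma CInt_scal (k : C) (f : R -> C) (a b : R) : ex_RInt (V := C_R_NormedModule) f a b ->
  CInt (fun t => k * f t)%C a b = (k * CInt f a b)%C.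
Proof.
  intro H. apply CInt_correct in H.
  pose proof (is_RInt_fct_extend_fst (U := R_NormedModule) (V := R_NormedModule) f _ _ _ H) as H1.
  pose proof (is_RInt_fct_extend_snd (U := R_NormedModule) (V := R_NormedModule) f _ _ _ H) as H2.
  apply (is_RInt_unique (V := C_R_CompleteNormedModule)).
  apply (is_RInt_fct_extend_pair (U := R_NormedModule) (V := R_NormedModule)).
  - apply (is_RInt_minus (V := R_NormedModule)); apply (is_RInt_scal (V := R_NormedModule)); assumption.
  - apply (is_RInt_plus (V := R_NormedModule)); apply (is_RInt_scal (V := R_NormedModule)); assumption.
Qed.

Lemma CInt_quotient_bound (N : R -> C) (s r M : R) : exp s = r ->
  (forall t, rcont (fun t => Ci * (N t / cexp (s, t)))%C t) ->
  (forall t, Cmod (N t) <= M) ->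
  Cmod (CInt (fun t => Ci * (N t / cexp (s, t)))%C 0 (2 * PI)) <= 2 * PI * (M / r).
Proof.
  intros Es Hc HM. pose proof PI_RGT_0. pose proof (exp_pos s).
  replace (2 * PI * (M / r)) with ((2 * PI - 0) * (M / r)) by ring. apply CInt_bound; [lra|auto|]. intros t _.
  rewrite Cmod_mult, Cmod_Ci, Rmult_1_l, Cmod_div, Cmod_cexp by apply cexp_neq_0. simpl.
  rewrite Es. apply Rmult_le_compat_r; [|apply HM]. left. apply Rinv_0_lt_compat. lra.
Qed.

(** In [derivative_mean] the circle moves with its centre, so regularity of [f] passes to [df]
    without differentiating a kernel: a bound on [f] bounds [df], hence [f] is Lipschitz, hence [df]
    is Lipschitz, hence the Taylor remainder of [f] is quadratic, hence [df] is differentiable. *)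
Lemma hol_derivative (f df : C -> C) (z0 : C) (R0 : R) : 0 < R0 ->
  (forall z, Cmod (z - z0) < R0 -> cdiff f z (df z)) -> hol df z0.
Proof.
  intros HR0 Hf. pose proof PI_RGT_0 as HPI.
  (* Every passage through a circle of radius [r] costs one [r]: [f] is bounded up to [7 r], [df] up
     to [6 r], and [df] is Lipschitz up to [5 r]. *)
  set (r := R0 / 8). assert (Hr : 0 < r) by (unfold r; lra). assert (ER : R0 = 8 * r) by (unfold r; field).
  clearbody r. subst R0.
  assert (Hol : forall z, Cmod (z - z0) < 8 * r -> hol f z) by (intros z Hz; eexists; eauto).
  destruct (hol_bounded_disc f z0 (7 * r)) as [M [HM0 HM]]; [lra| |].
  { intros z Hz. apply hol_ccont, Hol. lra. }
  set (s := ln r). assert (Es : exp s = r) by (apply exp_ln; exact Hr).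
  assert (Circ : forall z y, Cmod (circle z s y - z0) <= r + Cmod (z - z0)).
  { intros z y. pose proof (Cmod_split (circle z s y) z z0). rewrite circle_dist, Es in H. exact H. }
  assert (Form : forall z, Cmod (z - z0) <= 6 * r ->
    ((2 * PI)%R * (Ci * df z))%C = CInt (fun y => Ci * ((f (circle z s y) - f z) / cexp (s, y)))%C 0 (2 * PI)).
  { intros z Hz. apply (derivative_mean f z (df z) (2 * r) s); [lra| |apply Hf; lra].
    intros w Hw. apply Hol. pose proof (Cmod_split w z z0). lra. }
  assert (Cc : forall z c y, Cmod (z - z0) <= 6 * r ->
    rcont (fun t => Ci * ((f (circle z s t) - c) / cexp (s, t)))%C y).
  { intros z c y Hz. apply rcont_difference_quotient, hol_ccont, Hol. pose proof (Circ z y). lra. }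
  set (A := 2 * M / r). assert (HA : forall z, Cmod (z - z0) <= 6 * r -> Cmod (df z) <= A).
  { intros z Hz. apply Rmult_le_reg_l with (2 * PI); [lra|]. rewrite <- Cmod_2PI_Ci, (Form z Hz).
    apply (CInt_quotient_bound (fun t => f (circle z s t) - f z)%C); [exact Es|intro; now apply Cc|].
    intro t. eapply Rle_trans; [apply Cmod_minus_triangle|].
    pose proof (Circ z t). pose proof (HM z ltac:(lra)). pose proof (HM (circle z s t) ltac:(lra)). lra. }
  assert (HL : forall z w, Cmod (z - z0) <= 6 * r -> Cmod (w - z0) <= 6 * r ->
     Cmod (f w - f z) <= A * Cmod (w - z)).
  { intros z w Hz Hw. apply (mean_value_segment f z w (fun t => df (z + t * (w - z))%C)).
    intros t Ht. pose proof (segment_dist z0 z w (6 * r) t Ht Hz Hw). split; [apply Hf; lra|now apply HA]. }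
  set (B := 2 * A / r). assert (HA0 : 0 <= A) by (apply Rmult_le_pos; [lra|left; now apply Rinv_0_lt_compat]).
  assert (HB0 : 0 <= B) by (apply Rmult_le_pos; [lra|left; now apply Rinv_0_lt_compat]).
  assert (HB : forall z w, Cmod (z - z0) <= 5 * r -> Cmod (w - z0) <= 5 * r ->
     Cmod (df w - df z) <= B * Cmod (w - z)).
  { intros z w Hz Hw. apply Rmult_le_reg_l with (2 * PI); [lra|]. rewrite <- Cmod_2PI_Ci.
    replace ((2 * PI)%R * (Ci * (df w - df z)))%C with ((2 * PI)%R * (Ci * df w) - (2 * PI)%R * (Ci * df z))%C by ring.
    rewrite (Form z), (Form w) by lra. rewrite <- CInt_minus by (apply ex_CInt; [lra|intros; apply Cc; lra]).
    set (N := fun y => ((f (circle w s y) - f (circle z s y)) - (f w - f z))%C).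
    assert (EN : forall t, (Ci * ((f (circle w s t) - f w) / cexp (s, t)) - Ci * ((f (circle z s t) - f z) / cexp (s, t))
      = Ci * (N t / cexp (s, t)))%C) by (intro t; unfold N, Cdiv; ring).
    rewrite (CInt_ext _ _ _ _ EN).
    replace (B * Cmod (w - z)) with ((2 * A * Cmod (w - z)) / r) by (unfold B; field; lra).
    apply CInt_quotient_bound; [exact Es| |].
    - intro t. apply (rcont_ext _ _ _ EN), rcont_minus; apply Cc; lra.
    - intro t. eapply Rle_trans; [apply Cmod_minus_triangle|]. pose proof (Circ w t). pose proof (Circ z t).
      pose proof (HL (circle z s t) (circle w s t) ltac:(lra) ltac:(lra)) as L1.
      pose proof (HL z w ltac:(lra) ltac:(lra)).
      assert (E : (circle w s t - circle z s t)%C = (w - z)%C) by (unfold circle; ring). rewrite E in L1. lra. }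
  assert (HQ : forall z w, Cmod (z - z0) <= 5 * r -> Cmod (w - z0) <= 5 * r ->
     Cmod (f w - f z - df z * (w - z)) <= B * Cmod (w - z) * Cmod (w - z)).
  { intros z w Hz Hw.
    replace (f w - f z - df z * (w - z))%C with ((f w - df z * w) - (f z - df z * z))%C by ring.
    apply (mean_value_segment (fun u => f u - df z * u)%C z w (fun t => df (z + t * (w - z))%C - df z)%C).
    intros t Ht. pose proof (segment_dist z0 z w (5 * r) t Ht Hz Hw). split.
    - eapply cdiff_eq; [apply cdiff_minus; [apply Hf; lra|apply cdiff_scal, cdiff_id]|]. ring.
    - eapply Rle_trans; [now apply HB|]. apply Rmult_le_compat_l; [exact HB0|]. now apply segment_dist0. }
  assert (Small : forall K, 0 <= K -> forall e, 0 < e -> exists d, 0 < d /\ forall v, v < d -> v <= r /\ K * v <= e / 2).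
  { intros K HK e He. assert (P : 0 < e / 2 / (K + 1)) by (apply Rdiv_lt_0_compat; lra).
    exists (Rmin r (e / 2 / (K + 1))). split; [now apply Rmin_pos|]. intros v Hv.
    destruct (Rmin_Rgt_l _ _ _ Hv) as [V1 V2]. apply Rlt_div_r in V2; [|lra]. split; [lra|].
    destruct (Rle_lt_dec 0 v); nra. }
  assert (Cdf : forall y, ccont df (circle z0 s y)).
  { intros y e He. destruct (Small B HB0 e He) as [d [Hd K]]. exists d. split; [exact Hd|].
    intros w Hw. destruct (K _ Hw). pose proof (Circ z0 y). rewrite Cmod_diag in *.
    pose proof (Cmod_split w (circle z0 s y) z0). eapply Rle_lt_trans; [apply HB; lra|]. lra. }
  assert (Z0 : Cmod (z0 - z0) <= 5 * r) by (rewrite Cmod_diag; lra).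
  set (D0 := fun y => (Ci * ((df (circle z0 s y) - df z0) / cexp (s, y)))%C).
  assert (Cd : forall y, rcont D0 y) by (intro y; apply rcont_difference_quotient, Cdf).
  (* The value that [derivative_mean] would give for the derivative of [df] at [z0]; it is defined
     by the integral first and justified by [HP]. *)
  set (c := (CInt D0 0 (2 * PI) / ((2 * PI)%R * Ci))%C).
  assert (Ec : ((2 * PI)%R * (Ci * c))%C = CInt D0 0 (2 * PI)).
  { unfold c. field. split; [apply Ci_nz|apply RtoC_neq0; lra]. }
  assert (HP : forall w, Cmod (w - z0) <= r ->
     Cmod (df w - df z0 - c * (w - z0)) <= (2 * B / r) * Cmod (w - z0) * Cmod (w - z0)).
  { intros w Hw. set (k := (w - z0)%C) in *. assert (Hw' : Cmod (w - z0) <= 5 * r) by (fold k; lra).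
    apply Rmult_le_reg_l with (2 * PI); [lra|]. rewrite <- Cmod_2PI_Ci.
    replace ((2 * PI)%R * (Ci * (df w - df z0 - c * k)))%C
      with ((2 * PI)%R * (Ci * df w) - (2 * PI)%R * (Ci * df z0) - k * ((2 * PI)%R * (Ci * c)))%C by ring.
    rewrite (Form w), (Form z0), Ec by lra. assert (Ck : forall y, rcont (fun y => k * D0 y)%C y).
    { intro y. apply (rcont_vertical (fun v => k * (Ci * ((df (z0 + cexp v) - df z0) / cexp v)))%C s y).
      apply ccont_mult; [apply ccont_const|]. apply ccont_mult; [apply ccont_const|].
      assert (Cx : ccont cexp (s, y)) by (eapply cdiff_ccont, cdiff_cexp).
      apply ccont_mult; [apply ccont_minus; [|apply ccont_const]|apply ccont_inv; [exact Cx|apply cexp_neq_0]].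
      apply (ccont_comp (fun v => z0 + cexp v)%C df); [|apply Cdf].
      apply ccont_plus; [apply ccont_const|exact Cx]. }
    rewrite <- CInt_scal by (apply ex_CInt; auto; lra).
    set (Q := fun z y => (Ci * ((f (circle z s y) - f z) / cexp (s, y)))%C).
    assert (CQ : forall z y, Cmod (z - z0) <= 5 * r -> rcont (Q z) y) by (intros z y Hz; apply Cc; lra).
    change (Cmod (CInt (Q w) 0 (2 * PI) - CInt (Q z0) 0 (2 * PI) - CInt (fun y => k * D0 y)%C 0 (2 * PI))
      <= 2 * PI * (2 * B / r * Cmod k * Cmod k)).
    assert (ExQ : forall z, Cmod (z - z0) <= 5 * r -> ex_RInt (V := C_R_NormedModule) (Q z) 0 (2 * PI))
      by (intros z Hz; apply ex_CInt; [lra|auto]).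
    rewrite <- (CInt_minus (Q w) (Q z0)) by auto.
    rewrite <- (CInt_minus (fun y => Q w y - Q z0 y)%C (fun y => k * D0 y)%C);
      [|apply (ex_CInt (fun y => Q w y - Q z0 y)%C); [lra|intros; apply rcont_minus; auto]|apply ex_CInt; auto; lra].
    set (N := fun y => ((f (circle w s y) - f (circle z0 s y) - df (circle z0 s y) * k) - (f w - f z0 - df z0 * k))%C).
    assert (EN : forall t, (Q w t - Q z0 t - k * D0 t = Ci * (N t / cexp (s, t)))%C)
      by (intro t; unfold Q, D0, N, Cdiv; ring).
    rewrite (CInt_ext _ _ _ _ EN).
    replace (2 * B / r * Cmod k * Cmod k) with ((2 * (B * Cmod k * Cmod k)) / r) by (field; lra).
    apply CInt_quotient_bound; [exact Es| |].
    - intro t. apply (rcont_ext _ _ _ EN). apply rcont_minus; [apply rcont_minus; auto|apply Ck].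
    - intro t. unfold N. eapply Rle_trans; [apply Cmod_minus_triangle|].
      pose proof (Circ w t) as W1. pose proof (Circ z0 t) as W2. fold k in W1. rewrite Cmod_diag in W2.
      assert (E : (circle w s t - circle z0 s t)%C = k) by (unfold circle, k; ring).
      pose proof (HQ (circle z0 s t) (circle w s t) ltac:(lra) ltac:(lra)) as Q1. rewrite E in Q1.
      pose proof (HQ z0 w Z0 Hw') as Q2. fold k in Q2. lra. }
  exists c. intros e He.
  assert (HB4 : 0 <= 2 * B / r) by (apply Rmult_le_pos; [lra|left; now apply Rinv_0_lt_compat]).
  destruct (Small _ HB4 e He) as [d [Hd K]]. exists d. split; [exact Hd|].
  intros w Hw. destruct (K _ Hw) as [W1 W2].
  eapply Rle_trans; [now apply HP|]. apply Rmult_le_compat_r; [apply Cmod_ge_0|]. lra.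
Qed.

(** * Semigroup generators in Stolz angles *)

(* Differentiate at [s = 0+] the Schwarz-Pick inequality for [phi s] at the points [0] and [a]. *)
Lemma generator_inequality (phi : R -> C -> C) (G : C -> C) (a : C) :
  (forall s z, 0 < s -> Cmod z < 1 -> hol (phi s) z /\ Cmod (phi s z) < 1) ->
  (forall z eps, Cmod z < 1 -> 0 < eps -> exists d, 0 < d /\
     forall s, 0 < s < d -> Cmod (phi s z - z - s * G z) <= eps * s) ->
  Cmod a < 1 ->
  fst (Cconj a * (G a - G 0))%C + Cmod a * Cmod a * fst (Cconj (G 0) * a)%C <= 0.
Proof.
  intros Hphi HG Ha. apply Rnot_lt_le. intro Pos.
  (* Real-linear in the two velocities: half the coefficient of [s] in the squared Schwarz-Pick
     inequality. It is first evaluated at the difference quotients [al], [be] and then compared with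
     [G a], [G 0]. *)
  set (X := fun al be : C => fst (Cconj a * (al - be))%C + Cmod a * Cmod a * fst (Cconj be * a)%C).
  change (0 < X (G a) (G 0)) in Pos. set (e := Rmin 1 (X (G a) (G 0) / 8)).
  assert (He : 0 < e) by (apply Rmin_pos; lra).
  assert (E1 : e <= 1) by apply Rmin_l. assert (E2 : e <= X (G a) (G 0) / 8) by apply Rmin_r.
  assert (H0 : Cmod 0 < 1) by (rewrite Cmod_0; lra).
  destruct (HG a e Ha He) as [d1 [D1 K1]]. destruct (HG 0 e H0 He) as [d2 [D2 K2]].
  set (N := Cmod (G a) + Cmod (G 0) + 2).
  assert (HN : 2 <= N) by (pose proof (Cmod_ge_0 (G a)); pose proof (Cmod_ge_0 (G 0)); unfold N; lra).
  (* With [s <= k0 / 2] the second-order terms are at most [X / 4], and [e <= X / 8] makes the error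
     of the comparison at most [3 X / 8]; the sum stays below [X]. *)
  set (k0 := X (G a) (G 0) / (4 * N * N)). set (s := Rmin (Rmin d1 d2) (k0) / 2).
  assert (Q : 0 < k0) by (unfold k0; apply Rdiv_lt_0_compat; nra).
  assert (Q' : 0 < Rmin (Rmin d1 d2) (k0)) by (repeat apply Rmin_pos; assumption).
  pose proof (Rmin_l (Rmin d1 d2) (k0)) as M1. pose proof (Rmin_r (Rmin d1 d2) (k0)) as M2.
  pose proof (Rmin_bounds d1 d2). assert (Hs : 0 < s) by (unfold s; lra).
  specialize (K1 s ltac:(unfold s in *; lra)). specialize (K2 s ltac:(unfold s in *; lra)).
  assert (Ns : RtoC s <> RtoC 0) by (apply RtoC_neq0; lra).
  set (al := ((phi s a - a) / s)%C). set (be := (phi s 0 / s)%C).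
  assert (Fa : phi s a = (a + s * al)%C) by (unfold al; field; exact Ns).
  assert (F0 : phi s 0 = (s * be)%C) by (unfold be; field; exact Ns). clearbody al be.
  assert (A1 : Cmod (al - G a) <= e).
  { apply Rmult_le_reg_r with s; [exact Hs|]. rewrite <- (Cmod_RtoC_pos s) at 1 by lra.
    rewrite <- Cmod_mult. replace ((al - G a) * s)%C with (phi s a - a - s * G a)%C by (rewrite Fa; ring). exact K1. }
  assert (A2 : Cmod (be - G 0) <= e).
  { apply Rmult_le_reg_r with s; [exact Hs|]. rewrite <- (Cmod_RtoC_pos s) at 1 by lra.
    rewrite <- Cmod_mult. replace ((be - G 0) * s)%C with (phi s 0 - 0 - s * G 0)%C by (rewrite F0; ring). exact K2. }
  pose proof (schwarz_pick (phi s) (fun z Hz => proj1 (Hphi s z Hs Hz)) (fun z Hz => proj2 (Hphi s z Hs Hz)) 0 a H0 Ha) as SP.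
  replace (1 - Cconj 0 * a)%C with (RtoC 1) in SP by (apply injective_projections; simpl; ring).
  replace (a - 0)%C with a in SP by ring. rewrite Cmod_1, Rmult_1_r in SP. assert (B1 : Cmod al <= N).
  { pose proof (Cmod_minus_le al (G a)). pose proof (Cmod_ge_0 (G 0)). unfold N. lra. }
  assert (B2 : Cmod be <= N).
  { pose proof (Cmod_minus_le be (G 0)). pose proof (Cmod_ge_0 (G a)). unfold N. lra. }
  pose proof (proj2 (Hphi s a Hs Ha)) as Fa1. assert (SQ : Cmod (phi s a - phi s 0) * Cmod (phi s a - phi s 0)
     <= (Cmod a * Cmod a) * (Cmod (1 - Cconj (phi s 0) * phi s a) * Cmod (1 - Cconj (phi s 0) * phi s a))).
  { pose proof (Cmod_ge_0 (phi s a - phi s 0)). nra. }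
  rewrite (Cmod_sq (phi s a - phi s 0)), (Cmod_sq (1 - Cconj (phi s 0) * phi s a)) in SQ.
  assert (Dom : X al be <= s * (N * N * 2)).
  { assert (R1 : Rabs (fst (Cconj be * al)%C) <= Cmod be * Cmod al).
    { eapply Rle_trans; [apply Rabs_fst_le|]. rewrite Cmod_mult, Cmod_conj. lra. }
    apply Rabs_le_between in R1.
    pose proof (Cmod_ge_0 al); pose proof (Cmod_ge_0 be); pose proof (Cmod_ge_0 a); pose proof (Cmod_ge_0 (phi s a)).
    assert (R2 : Cmod be * Cmod al <= N * N) by nra. assert (R3 : Cmod be * Cmod be <= N * N) by nra.
    (* The terms of order [s ^ 2] on the right-hand side; those on the left form the square of
       [|al - be|] and are dropped by sign. *)
    set (Y := Cmod a * Cmod a * (- 2 * fst (Cconj be * al)%C + (Cmod be * Cmod be) * (Cmod (phi s a) * Cmod (phi s a)))).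
    assert (Y1 : Y <= N * N * 4).
    { unfold Y. set (aa := Cmod a * Cmod a). assert (0 <= aa <= 1) by (unfold aa; nra).
      set (pp := Cmod (phi s a) * Cmod (phi s a)). assert (0 <= pp <= 1) by (unfold pp; nra).
      assert (Cmod be * Cmod be * pp <= N * N) by nra. nra. }
    assert (SQ2 : s * (2 * X al be) <= s * (s * Y)).
    { unfold Y, X. rewrite Fa, F0 in SQ. rewrite Fa. rewrite (Cmod_sq a) in *. rewrite (Cmod_sq be), (Cmod_sq (a + s * al)).
      simpl in *.
      assert (0 <= s * s * ((fst al - fst be) * (fst al - fst be) + (snd al - snd be) * (snd al - snd be))) by (apply Rmult_le_pos; [nra|apply Rplus_le_le_0_compat; apply Rle_0_sqr]).
      lra. }
    apply Rmult_le_reg_l in SQ2; [|exact Hs]. nra. }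
  assert (Cmp : X (G a) (G 0) <= X al be + 3 * e).
  { assert (Z : X (G a) (G 0) - X al be = - fst (Cconj a * (al - G a))%C + fst (Cconj a * (be - G 0))%C
       - Cmod a * Cmod a * fst (Cconj (be - G 0) * a)%C) by (unfold X; simpl; ring).
    pose proof (Rabs_fst_le (Cconj a * (al - G a))%C) as T1. rewrite Cmod_mult, Cmod_conj in T1.
    pose proof (Rabs_fst_le (Cconj a * (be - G 0))%C) as T2. rewrite Cmod_mult, Cmod_conj in T2.
    pose proof (Rabs_fst_le (Cconj (be - G 0) * a)%C) as T3. rewrite Cmod_mult, Cmod_conj in T3.
    pose proof (Cmod_ge_0 a). pose proof (Cmod_ge_0 (al - G a)). pose proof (Cmod_ge_0 (be - G 0)).
    assert (Cmod a * Cmod (al - G a) <= e) by nra. assert (Cmod a * Cmod (be - G 0) <= e) by nra.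
    assert (Cmod (be - G 0) * Cmod a <= e) by nra. set (f3 := fst (Cconj (be - G 0) * a)%C) in *.
    apply Rabs_le_between in T1. apply Rabs_le_between in T2. apply Rabs_le_between in T3.
    set (aa := Cmod a * Cmod a) in *. assert (Haa : 0 <= aa <= 1) by (unfold aa; nra).
    assert (F3 : - e <= f3) by lra. clearbody aa f3. assert (- e <= aa * f3) by (clear - Haa F3 He; nra). lra. }
  assert (s * (N * N * 2) <= X (G a) (G 0) / 4).
  { assert (s <= k0 / 2) by (unfold s; lra).
    apply Rle_trans with (k0 / 2 * (N * N * 2)); [apply Rmult_le_compat_r; nra|].
    right. unfold k0. field. lra. }
  lra.
Qed.

(** A Cayley transform centred at the value at [u0] sends the right half-plane into the disc, and
    Schwarz-Pick bounds the result by [rho]. The hypothesis on [u] says that its pseudohyperbolic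
    distance from [u0] is at most [rho]. *)
Lemma harnack (Q : C -> C) (u0 u : C) (rho : R) :
  (forall z, Cmod z < 1 -> hol Q z) -> (forall z, Cmod z < 1 -> 0 <= fst (Q z)) ->
  Cmod u0 < 1 -> Cmod u < 1 -> 0 <= rho < 1 -> Cmod (u - u0) <= rho * Cmod (1 - Cconj u0 * u) ->
  Cmod (Q u) <= Cmod (Q u0) * ((1 + rho) / (1 - rho)).
Proof.
  intros Hh Hp Hu0 Hu Hrho Hd.
  (* Adding [eta] makes the real part strictly positive, so that the denominator of the Cayley
     transform cannot vanish and the image lies in the open disc. *)
  assert (Key : forall eta, 0 < eta -> Cmod (Q u + eta) * (1 - rho) <= Cmod (Q u0 + eta) * (1 + rho)).
  { intros eta He. set (Q0 := (Q u0 + eta)%C). set (P := fun z => (Q z + eta)%C).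
    assert (P0 : 0 < fst Q0) by (unfold Q0; simpl; specialize (Hp u0 Hu0); lra).
    assert (PP : forall z, Cmod z < 1 -> 0 < fst (P z)) by (intros z Hz; unfold P; simpl; specialize (Hp z Hz); lra).
    assert (PN : forall z, Cmod z < 1 -> (P z + Cconj Q0)%C <> RtoC 0).
    { intros z Hz E. specialize (PP z Hz). apply (f_equal fst) in E. simpl in *. lra. }
    set (W := fun z => ((P z - Q0) / (P z + Cconj Q0))%C). assert (HW : forall z, Cmod z < 1 -> hol W z).
    { intros z Hz. apply hol_div; [| |now apply PN].
      - apply hol_minus; [apply hol_plus; [now apply Hh|apply hol_const]|apply hol_const].
      - apply hol_plus; [apply hol_plus; [now apply Hh|apply hol_const]|apply hol_const]. }
    assert (HW1 : forall z, Cmod z < 1 -> Cmod (W z) < 1).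
    { intros z Hz. unfold W. rewrite Cmod_div by now apply PN. pose proof (proj1 (Cmod_gt_0 _) (PN z Hz)) as N.
      apply Rlt_div_l; [exact N|]. rewrite Rmult_1_l. specialize (PP z Hz).
      apply Rsqr_incrst_0; [|apply Cmod_ge_0|lra]. unfold Rsqr. rewrite !Cmod_sq. simpl in *. nra. }
    assert (W0 : W u0 = RtoC 0) by (unfold W, P, Q0, Cdiv; ring).
    pose proof (schwarz_pick W HW HW1 u0 u Hu0 Hu) as SP. rewrite W0 in SP.
    replace (W u - 0)%C with (W u) in SP by ring.
    replace (1 - Cconj 0 * W u)%C with (RtoC 1) in SP by (apply injective_projections; simpl; ring).
    rewrite Cmod_1, Rmult_1_r in SP. pose proof (proj1 (Cmod_gt_0 _) (mobius_den u0 u Hu0 Hu)) as N.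
    assert (Wr : Cmod (W u) <= rho) by (apply Rmult_le_reg_r with (Cmod (1 - Cconj u0 * u)); lra).
    assert (Id : (P u = Q0 + Cconj Q0 * W u + P u * W u)%C).
    { unfold W. field. now apply PN. }
    assert (T : Cmod (P u) <= Cmod Q0 + Cmod Q0 * Cmod (W u) + Cmod (P u) * Cmod (W u)).
    { rewrite Id at 1. eapply Rle_trans; [apply Cmod_triangle|]. rewrite Cmod_mult.
      apply Rplus_le_compat_r. eapply Rle_trans; [apply Cmod_triangle|]. rewrite Cmod_mult, Cmod_conj. lra. }
    change (Q u + eta)%C with (P u). pose proof (Cmod_ge_0 (P u)). pose proof (Cmod_ge_0 Q0). nra. }
  apply Rmult_le_reg_r with (1 - rho); [lra|].
  replace (Cmod (Q u0) * ((1 + rho) / (1 - rho)) * (1 - rho)) with (Cmod (Q u0) * (1 + rho)) by (field; lra).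
  apply Rnot_lt_le. intro L. set (eta := (Cmod (Q u) * (1 - rho) - Cmod (Q u0) * (1 + rho)) / 4).
  assert (He : 0 < eta) by (unfold eta; lra). specialize (Key eta He).
  assert (T1 : Cmod (Q u) <= Cmod (Q u + eta) + eta).
  { pose proof (Cmod_minus_triangle (Q u + eta) eta). replace (Q u + eta - eta)%C with (Q u) in H by ring.
    rewrite (Cmod_RtoC_pos eta) in H by lra. exact H. }
  assert (T2 : Cmod (Q u0 + eta) <= Cmod (Q u0) + eta).
  { pose proof (Cmod_triangle (Q u0) eta). rewrite (Cmod_RtoC_pos eta) in H by lra. exact H. }
  unfold eta in *. nra.
Qed.

(** A point of a Stolz angle stays within bounded hyperbolic distance of the radial point with the
    same distance to the vertex. Since [Bd <= 6 s], [mobius_identity] gives [1 - (A / Bd)^2 >= (2 s)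
    (2 m s) / (6 s)^2 = m / 9], and the square root of [1 - m / 9] is at most [1 - m / 18]. *)
Lemma stolz_hyperbolic (zeta : C) (m : R) : 0 < m <= 1 -> 0 < Cmod zeta <= m / 2 ->
  m * Cmod zeta <= fst zeta ->
  Cmod (1 - 2 * zeta) < 1 /\ Cmod (1 - 2 * Cmod zeta) < 1 /\
  Cmod ((1 - 2 * zeta) - (1 - 2 * Cmod zeta)) <=
    (1 - m / 18) * Cmod (1 - Cconj (1 - 2 * Cmod zeta) * (1 - 2 * zeta)).
Proof.
  intros Hm Hz HR. set (s := Cmod zeta) in *. pose proof (Cmod_sq zeta) as Sq. fold s in Sq.
  assert (H1 : Cmod (1 - 2 * zeta) * Cmod (1 - 2 * zeta) = 1 - 4 * fst zeta + 4 * (s * s)).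
  { rewrite Cmod_sq, Sq. simpl. ring. }
  assert (H2 : Cmod (1 - 2 * s) * Cmod (1 - 2 * s) = (1 - 2 * s) * (1 - 2 * s)).
  { rewrite Cmod_sq. simpl. ring. }
  pose proof (Cmod_ge_0 (1 - 2 * zeta)). pose proof (Cmod_ge_0 (1 - 2 * s)).
  assert (L1 : Cmod (1 - 2 * zeta) < 1) by nra. assert (L2 : Cmod (1 - 2 * s) < 1) by nra.
  split; [exact L1|]. split; [exact L2|]. pose proof (mobius_identity (1 - 2 * s)%C (1 - 2 * zeta)%C) as Id.
  set (A := Cmod ((1 - 2 * zeta) - (1 - 2 * s))) in *.
  set (Bd := Cmod (1 - Cconj (1 - 2 * s) * (1 - 2 * zeta))) in *. rewrite H1, H2 in Id.
  assert (HB : Bd <= 6 * s).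
  { unfold Bd. replace (1 - Cconj (1 - 2 * s) * (1 - 2 * zeta))%C with (2 * s + 2 * zeta * (1 - 2 * s))%C
      by (apply injective_projections; simpl; ring).
    eapply Rle_trans; [apply Cmod_triangle|]. rewrite !Cmod_mult. fold s.
    rewrite (Cmod_RtoC_pos s), (Cmod_RtoC_pos 2) by lra. nra. }
  assert (0 <= A) by apply Cmod_ge_0. assert (0 <= Bd) by apply Cmod_ge_0.
  assert (HBB : Bd * Bd <= 36 * (s * s)) by nra. assert (P1 : 2 * s <= 1 - (1 - 2 * s) * (1 - 2 * s)) by nra.
  assert (P2 : 2 * m * s <= 1 - (1 - 4 * fst zeta + 4 * (s * s))) by nra.
  assert (P3 : (2 * s) * (2 * m * s) <= Bd * Bd - A * A).
  { rewrite Id. apply Rmult_le_compat; nra. }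
  assert (P4 : A * A <= (1 - m / 9) * (Bd * Bd)) by nra.
  apply Rsqr_incr_0_var; [|apply Rmult_le_pos; lra]. unfold Rsqr. apply Rle_trans with (1 := P4).
  replace ((1 - m / 18) * Bd * ((1 - m / 18) * Bd)) with ((1 - m / 9 + m * m / 324) * (Bd * Bd)) by field.
  apply Rmult_le_compat_r; nra.
Qed.

Lemma generator_stolz_bound (G : C -> C) (x : C) (m : R) :
  Cmod x = 1 -> (forall z, Cmod z < 1 -> hol G z) ->
  (forall a, Cmod a < 1 ->
    fst (Cconj a * (G a - G 0))%C + Cmod a * Cmod a * fst (Cconj (G 0) * a)%C <= 0) ->
  0 < m <= 1 -> exists M, 0 < M /\
  forall zeta, 0 < Cmod zeta <= m / 2 -> m * Cmod zeta <= fst zeta ->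
    Cmod (G (x * (1 - zeta))%C) <= M * (Cmod (G (x * (1 - Cmod zeta))%C) + Cmod zeta).
Proof.
  intros Hx HG Hq Hm. assert (Xx : (x * Cconj x)%C = RtoC 1).
  { rewrite <- Cmod2_conj, Hx. f_equal. ring. }
  assert (Nx : x <> RtoC 0) by (apply Cmod_gt_0; lra).
  (* Up to the imaginary constant [Cconj (G 0) * x - G 0 * Cconj x], this is the quantity in [Hq]
     divided by [- |a|^2] and completed to a function with real part [>= 0]. With that constant, all
     terms except [G a / a] are [O(|a - x|)], which produces the additive [Cmod zeta] in the
     conclusion. *)
  set (q := fun a => (G 0 * (1 / a - Cconj x) - Cconj (G 0) * (a - x) - G a / a)%C).
  assert (Hq0 : forall a, Cmod a < 1 -> a <> RtoC 0 -> 0 <= fst (q a)).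
  { intros a Ha Na. specialize (Hq a Ha). pose proof (proj1 (Cmod_gt_0 _) Na) as P.
    set (aa := Cmod a * Cmod a) in *. assert (Paa : 0 < aa) by (unfold aa; nra).
    assert (Inv : forall v : C, (v / a)%C = ((/ aa)%R * (Cconj a * v))%C).
    { intro v. assert (Ea : RtoC aa = (a * Cconj a)%C).
      { rewrite <- Cmod2_conj. unfold aa. f_equal. ring. }
      rewrite RtoC_inv, Ea by lra. field. split; [|exact Na].
      intro E. rewrite E, Cmult_0_r in Ea. apply RtoC_inj in Ea. lra. }
    assert (E : fst (q a) = - (/ aa) * (fst (Cconj a * (G a - G 0))%C + aa * fst (Cconj (G 0) * a)%C)).
    { replace (q a) with (- ((G a - G 0) / a) - Cconj (G 0) * a + (Cconj (G 0) * x - G 0 * Cconj x))%C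
        by (unfold q; field; exact Na).
      rewrite Inv. simpl. field. lra. }
    rewrite E. assert (0 < / aa) by now apply Rinv_0_lt_compat. nra. }
  (* The map [u |-> x (1 + u) / 2] sends the unit disc onto the disc internally tangent at [x] that
     omits 0, the pole of [q]. The point [x (1 - zeta)] corresponds to [u = 1 - 2 zeta]. *)
  set (Q := fun u => q (x * ((1 + u) / 2))%C).
  assert (Ha : forall u, Cmod u < 1 -> Cmod (x * ((1 + u) / 2)) < 1 /\ (x * ((1 + u) / 2))%C <> RtoC 0).
  { intros u Hu. split.
    - rewrite Cmod_mult, Hx, Rmult_1_l, Cmod_div by (apply RtoC_neq0; lra).
      rewrite (Cmod_RtoC_pos 2) by lra. pose proof (Cmod_triangle 1 u). rewrite Cmod_1 in H. lra.
    - apply Cmult_neq_0; [exact Nx|]. intro E.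
      assert (E' : (1 + u)%C = RtoC 0) by (replace (1 + u)%C with ((1 + u) / 2 * 2)%C by field; rewrite E; ring).
      apply (f_equal fst) in E'. simpl in E'. pose proof (Rabs_fst_le u).
      assert (fst u = -1) by lra. rewrite H0 in H. rewrite Rabs_left in H; lra. }
  assert (HQ : forall u, Cmod u < 1 -> hol Q u).
  { intros u Hu. destruct (Ha u Hu) as [A1 A2]. unfold Q. apply (hol_comp (fun u => x * ((1 + u) / 2))%C q).
    - apply hol_mult; [apply hol_const|]. apply hol_div; [|apply hol_const|apply RtoC_neq0; lra].
      apply hol_plus; [apply hol_const|apply hol_id].
    - unfold q. apply hol_minus; [apply hol_minus|].
      + apply hol_mult; [apply hol_const|]. apply hol_minus; [|apply hol_const].
        apply hol_div; [apply hol_const|apply hol_id|exact A2].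
      + apply hol_mult; [apply hol_const|]. apply hol_minus; [apply hol_id|apply hol_const].
      + apply hol_div; [now apply HG|apply hol_id|exact A2]. }
  assert (HQ0 : forall u, Cmod u < 1 -> 0 <= fst (Q u)).
  { intros u Hu. destruct (Ha u Hu). now apply Hq0. }
  set (g0 := Cmod (G 0)). assert (Hg0 : 0 <= g0) by apply Cmod_ge_0.
  exists ((36 / m) * (2 + 3 * g0) + 2 * g0 + 1). assert (Hm36 : 0 < 36 / m) by (apply Rdiv_lt_0_compat; lra).
  split; [nra|]. intros zeta Hz HR. destruct (stolz_hyperbolic zeta m Hm Hz HR) as [U1 [U2 U3]].
  set (s := Cmod zeta) in *.
  pose proof (harnack Q (1 - 2 * s)%C (1 - 2 * zeta)%C (1 - m / 18) HQ HQ0 U2 U1 ltac:(lra) U3) as Hk.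
  unfold Q in Hk. assert (Ez : (x * ((1 + (1 - 2 * zeta)) / 2))%C = (x * (1 - zeta))%C) by field.
  assert (Es : (x * ((1 + (1 - 2 * s)) / 2))%C = (x * (1 - s))%C) by field.
  pose proof (Ha _ U1) as [A1 A2]. pose proof (Ha _ U2) as [B1 B2]. rewrite Ez in *. rewrite Es in *.
  set (a := (x * (1 - zeta))%C) in *. set (b := (x * (1 - s))%C) in *.
  assert (Rb : Cmod (q b) <= 2 * Cmod (G b) + 3 * g0 * s).
  { assert (Nb : Cmod b = 1 - s).
    { unfold b. rewrite Cmod_mult, Hx, Rmult_1_l. rewrite <- RtoC_minus. apply Cmod_RtoC_pos. lra. }
    assert (N1 : (1 - s)%C <> RtoC 0).
    { rewrite <- RtoC_minus. intro E. apply RtoC_inj in E. lra. }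
    assert (Hi : / (1 - s) <= 2).
    { rewrite <- (Rinv_inv 2). apply Rinv_le_contravar; lra. }
    assert (F1 : Cmod (1 / b - Cconj x) <= 2 * s).
    { replace (1 / b - Cconj x)%C with (Cconj x * (s / (1 - s)))%C.
      - rewrite Cmod_mult, Cmod_conj, Hx, Rmult_1_l, Cmod_div, <- RtoC_minus by exact N1.
        rewrite !Cmod_RtoC_pos by lra. unfold Rdiv. nra.
      - assert (Ec : Cconj x = (1 / x)%C) by (rewrite <- Xx; field; exact Nx).
        unfold b. rewrite Ec. field. split; assumption. }
    assert (F2 : Cmod (b - x) = s).
    { unfold b. replace (x * (1 - s) - x)%C with (- (x * s))%C by ring.
      rewrite Cmod_opp, Cmod_mult, Hx, Cmod_RtoC_pos by lra. ring. }
    assert (F3 : Cmod (G b / b) <= 2 * Cmod (G b)).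
    { rewrite Cmod_div, Nb by exact B2. unfold Rdiv. pose proof (Cmod_ge_0 (G b)). nra. }
    unfold q. eapply Rle_trans; [apply Cmod_minus_triangle|].
    eapply Rle_trans; [apply Rplus_le_compat_r, Cmod_minus_triangle|].
    rewrite !Cmod_mult, Cmod_conj, F2. fold g0. nra. }
  assert (K36 : (1 + (1 - m / 18)) / (1 - (1 - m / 18)) <= 36 / m).
  { replace (1 - (1 - m / 18)) with (m / 18) by ring. replace (36 / m) with (2 / (m / 18)) by (field; lra).
    unfold Rdiv. apply Rmult_le_compat_r; [|lra]. left. apply Rinv_0_lt_compat. lra. }
  assert (Ra : Cmod (q a) <= (2 * Cmod (G b) + 3 * g0 * s) * (36 / m)).
  { eapply Rle_trans; [exact Hk|]. apply Rmult_le_compat; auto using Cmod_ge_0.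
    apply Rmult_le_pos; [lra|]. left. apply Rinv_0_lt_compat. lra. }
  assert (Ga : G a = (G 0 * (1 - a * Cconj x) - Cconj (G 0) * (a - x) * a - q a * a)%C).
  { unfold q. field. exact A2. }
  assert (F4 : (1 - a * Cconj x)%C = zeta).
  { unfold a. replace (1 - x * (1 - zeta) * Cconj x)%C with (1 - (x * Cconj x) * (1 - zeta))%C by ring. rewrite Xx. ring. }
  assert (F5 : Cmod (a - x) = s).
  { unfold a. replace (x * (1 - zeta) - x)%C with (- (x * zeta))%C by ring.
    rewrite Cmod_opp, Cmod_mult, Hx. apply Rmult_1_l. }
  rewrite Ga, F4. eapply Rle_trans; [apply Cmod_minus_triangle|].
  eapply Rle_trans; [apply Rplus_le_compat_r, Cmod_minus_triangle|].
  rewrite !Cmod_mult, Cmod_conj, F5. fold g0. fold s.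
  pose proof (Cmod_ge_0 a). pose proof (Cmod_ge_0 (q a)). pose proof (Cmod_ge_0 (G b)).
  assert (g0 * s * Cmod a <= g0 * s) by (rewrite <- (Rmult_1_r (g0 * s)) at 2; apply Rmult_le_compat_l; [apply Rmult_le_pos|]; lra).
  assert (Cmod (q a) * Cmod a <= Cmod (q a)) by nra. set (k := 36 / m) in *. clearbody k.
  assert (0 <= k * g0 * Cmod (G b)) by (repeat apply Rmult_le_pos; lra).
  assert (0 <= g0 * Cmod (G b)) by (apply Rmult_le_pos; lra). assert (0 <= k * s) by (apply Rmult_le_pos; lra).
  nra.
Qed.

(** * A Lindelöf theorem on horizontal strips *)

Lemma rectangle_closed (a b c d : R) : closed_set (fun z => a <= fst z <= b /\ c <= snd z <= d).
Proof.
  intros z H. assert (N : forall e, 0 < e -> exists w : C, (a <= fst w <= b /\ c <= snd w <= d) /\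
     Rabs (fst w - fst z) < e /\ Rabs (snd w - snd z) < e).
  { intros e He. destruct (H e He) as [w [W1 W2]]. exists w. split; [exact W1|].
    split; eapply Rle_lt_trans; [apply (Rabs_fst_le (w - z)%C)|exact W2|apply (Rabs_snd_le (w - z)%C)|exact W2]. }
  repeat split; apply Rnot_lt_le; intro L.
  - destruct (N (a - fst z)) as [w [W1 [W2 W3]]]; [lra|]. apply Rabs_lt_between in W2. lra.
  - destruct (N (fst z - b)) as [w [W1 [W2 W3]]]; [lra|]. apply Rabs_lt_between in W2. lra.
  - destruct (N (c - snd z)) as [w [W1 [W2 W3]]]; [lra|]. apply Rabs_lt_between in W3. lra.
  - destruct (N (snd z - d)) as [w [W1 [W2 W3]]]; [lra|]. apply Rabs_lt_between in W3. lra.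
Qed.

Lemma rectangle_bounded (a b c d : R) : bounded_set (fun z => a <= fst z <= b /\ c <= snd z <= d).
Proof.
  exists (Rabs a + Rabs b + (Rabs c + Rabs d)). intros z [H1 H2]. eapply Rle_trans; [apply Cmod_sum_abs|].
  pose proof (Rle_abs a); pose proof (Rle_abs b); pose proof (Rle_abs c); pose proof (Rle_abs d).
  pose proof (Rle_abs (- a)); pose proof (Rle_abs (- b)); pose proof (Rle_abs (- c)); pose proof (Rle_abs (- d)).
  rewrite !Rabs_Ropp in *.
  assert (Rabs (fst z) <= Rabs a + Rabs b) by (apply Rabs_le; pose proof (Rabs_pos a); pose proof (Rabs_pos b); lra).
  assert (Rabs (snd z) <= Rabs c + Rabs d) by (apply Rabs_le; pose proof (Rabs_pos c); pose proof (Rabs_pos d); lra).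
  lra.
Qed.

Lemma maximum_principle_rectangle (f : C -> C) (a b c d B : R) :
  (forall z, a <= fst z <= b -> c <= snd z <= d -> hol f z) ->
  (forall z, a <= fst z <= b -> c <= snd z <= d ->
     fst z = a \/ fst z = b \/ snd z = c \/ snd z = d -> Cmod (f z) <= B) ->
  forall z, a <= fst z <= b -> c <= snd z <= d -> Cmod (f z) <= B.
Proof.
  intros Hf HB z Hz1 Hz2. apply (maximum_principle (fun z => a <= fst z <= b /\ c <= snd z <= d)
    (fun z => fst z = a \/ fst z = b \/ snd z = c \/ snd z = d) f B).
  - apply rectangle_bounded.
  - apply rectangle_closed.
  - intros u [U1 U2]. now apply hol_ccont, Hf.
  - intros u [U1 U2] N. assert (P1 : a < fst u) by (apply Rnot_le_lt; intro; apply N; left; lra).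
    assert (P2 : fst u < b) by (apply Rnot_le_lt; intro; apply N; right; left; lra).
    assert (P3 : c < snd u) by (apply Rnot_le_lt; intro; apply N; right; right; left; lra).
    assert (P4 : snd u < d) by (apply Rnot_le_lt; intro; apply N; right; right; right; lra).
    exists (Rmin (Rmin (fst u - a) (b - fst u)) (Rmin (snd u - c) (d - snd u))).
    split; [repeat apply Rmin_pos; lra|]. intros w Hw.
    pose proof (Rmin_bounds (Rmin (fst u - a) (b - fst u)) (Rmin (snd u - c) (d - snd u))).
    pose proof (Rmin_bounds (fst u - a) (b - fst u)). pose proof (Rmin_bounds (snd u - c) (d - snd u)).
    pose proof (Rabs_fst_le (w - u)%C) as F1. pose proof (Rabs_snd_le (w - u)%C) as F2. simpl in F1, F2.
    apply Rabs_le_between in F1. apply Rabs_le_between in F2. split; [split; lra|]. intros _. apply Hf; lra.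
  - intros u [U1 U2] S. now apply HB.
  - auto.
Qed.

Definition ccosh (w : C) : C := ((cexp w + cexp (- w)) / 2)%C.

Lemma fst_ccosh (w : C) : fst (ccosh w) = (exp (fst w) + exp (- fst w)) / 2 * cos (snd w).
Proof. unfold ccosh, cexp. simpl. rewrite cos_neg, sin_neg. field. Qed.

Lemma hol_ccosh (f : C -> C) (z : C) : hol f z -> hol (fun w => ccosh (f w)) z.
Proof.
  intro H. apply hol_div; [|apply hol_const|apply RtoC_neq0; lra].
  apply hol_plus; [now apply hol_cexp|]. apply hol_cexp.
  apply (hol_ext_loc (fun w => 0 - f w)%C _ z 1); [lra|intros; ring|].
  apply hol_minus; [apply hol_const|exact H].
Qed.

(* The factor [exp (i k w)] interpolates between the two horizontal sides and
   [exp (- cosh (w - i b / 2))] makes the contribution of the vertical sides negligible. *)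
Lemma two_constants_rectangle (f : C -> C) (T b k M B : R) :
  0 <= T -> 0 < b < PI / 2 ->
  (forall w, - T <= fst w <= T -> 0 <= snd w <= b -> hol f w /\ Cmod (f w) <= M) ->
  (forall t, - T <= t <= T -> Cmod (f (t, 0)) <= B) ->
  0 <= k -> M * exp (- (k * b)) <= B -> M * exp (- ((1 + T) / 4)) <= B ->
  forall y, 0 <= y <= b -> Cmod (f (0, y)) <= exp (1 + k * y) * B.
Proof.
  intros HT Hb Hf HB Hk HM1 HM2 y Hy.
  set (F := fun w => (f w * cexp (Ci * k * w) * cexp ((-1)%R * ccosh (w - Ci * (b / 2)%R)))%C).
  assert (NF : forall w, Cmod (F w) = Cmod (f w) * exp (- (k * snd w)) *
     exp (- ((exp (fst w) + exp (- fst w)) / 2 * cos (snd w - b / 2)))).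
  { intro w. unfold F. rewrite !Cmod_mult, !Cmod_cexp.
    assert (E1 : fst (Ci * k * w)%C = - (k * snd w)) by (simpl; ring).
    assert (E2 : fst ((-1)%R * ccosh (w - Ci * (b / 2)%R))%C = - fst (ccosh (w - Ci * (b / 2)%R)%C)) by (simpl; ring).
    rewrite E1, E2, fst_ccosh. assert (E3 : fst (w - Ci * (b / 2)%R)%C = fst w) by (simpl; ring).
    assert (E4 : snd (w - Ci * (b / 2)%R)%C = snd w - b / 2) by (simpl; ring). now rewrite E3, E4. }
  assert (Hcos : forall v, 0 <= v <= b -> 1 / 2 <= cos (v - b / 2)).
  { intros v Hv. rewrite <- cos_PI3. pose proof PI_RGT_0. destruct (Rle_lt_dec 0 (v - b / 2)).
    - apply cos_decr_1; lra.
    - rewrite <- (cos_neg (v - b / 2)). apply cos_decr_1; lra. }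
  assert (Hcosh : forall p, 1 <= (exp p + exp (- p)) / 2 /\ (1 + Rabs p) / 2 <= (exp p + exp (- p)) / 2).
  { intro p. pose proof (exp_pos p); pose proof (exp_pos (- p)).
    pose proof (exp_ineq1_le p); pose proof (exp_ineq1_le (- p)).
    split; [lra|]. unfold Rabs. destruct (Rcase_abs p); lra. }
  assert (Hm : forall p v, 0 <= v <= b -> exp (- ((exp p + exp (- p)) / 2 * cos (v - b / 2))) <= exp (- ((1 + Rabs p) / 4))).
  { intros p v Hv. pose proof (Hcos v Hv). destruct (Hcosh p).
    assert ((1 + Rabs p) / 4 <= (exp p + exp (- p)) / 2 * cos (v - b / 2)) by nra.
    destruct (Rle_lt_or_eq_dec _ _ H2) as [L|L]; [left; apply exp_increasing; lra|right; now rewrite <- L]. }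
  assert (Hle : forall u, 0 <= u -> exp (- u) <= 1).
  { intros u Hu. rewrite <- exp_0. destruct (Rle_lt_or_eq_dec _ _ Hu) as [L|L]; [left; apply exp_increasing; lra|right; now rewrite <- L, Ropp_0]. }
  assert (Max : Cmod (F (0, y)) <= B).
  { apply (maximum_principle_rectangle F (- T) T 0 b B); [| |simpl; lra|simpl; lra].
    - intros w W1 W2. destruct (Hf w W1 W2) as [Hw _]. unfold F. apply hol_mult; [apply hol_mult; [exact Hw|]|].
      + apply hol_cexp. apply hol_mult; [apply hol_const|apply hol_id].
      + apply hol_cexp. apply hol_mult; [apply hol_const|]. apply hol_ccosh.
        apply hol_minus; [apply hol_id|apply hol_const].
    - intros [p v] W1 W2 S. simpl in W1, W2, S. rewrite NF. simpl. destruct (Hf (p, v) W1 W2) as [_ HMw].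
      pose proof (Cmod_ge_0 (f (p, v))). pose proof (exp_pos (- (k * v))).
      pose proof (Hm p v W2) as HE. pose proof (exp_pos (- ((exp p + exp (- p)) / 2 * cos (v - b / 2)))) as PE.
      set (E := exp (- ((exp p + exp (- p)) / 2 * cos (v - b / 2)))) in *. assert (E1 : E <= 1).
      { eapply Rle_trans; [exact HE|]. apply Hle. pose proof (Rabs_pos p). lra. }
      assert (K1 : exp (- (k * v)) <= 1) by (apply Hle; apply Rmult_le_pos; lra).
      assert (S' : Rabs p = T \/ v = 0 \/ v = b).
      { destruct S as [->|[->|S]]; [left; rewrite Rabs_Ropp|left|right; exact S]; apply Rabs_pos_eq; lra. }
      assert (Bd : forall m1 m2 m3, Cmod (f (p, v)) <= m1 -> exp (- (k * v)) <= m2 -> E <= m3 -> m1 * m2 * m3 <= B ->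
        Cmod (f (p, v)) * exp (- (k * v)) * E <= B).
      { intros m1 m2 m3 L1 L2 L3 L4. eapply Rle_trans; [|exact L4].
        apply Rmult_le_compat; [apply Rmult_le_pos; lra|lra| |exact L3]. apply Rmult_le_compat; lra. }
      destruct S' as [S'|[->| ->]].
      + rewrite S' in HE. apply (Bd M 1 (exp (- ((1 + T) / 4)))); lra.
      + specialize (HB p W1). apply (Bd B 1 1); lra.
      + apply (Bd M (exp (- (k * b))) 1); lra. }
  rewrite NF in Max. simpl in Max. rewrite Ropp_0, exp_0 in Max. set (c := cos (y - b / 2)) in *.
  assert (Hc : c <= 1) by apply COS_bound.
  assert (HB0 : 0 <= B) by (pose proof (HB 0 ltac:(lra)); pose proof (Cmod_ge_0 (f (0, 0))); lra).
  replace (exp (- (k * y)) * exp (- ((1 + 1) / 2 * c))) with (exp (- (k * y + c))) in Max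
    by (rewrite <- exp_plus; f_equal; field).
  rewrite Rmult_assoc, <- exp_plus in Max.
  replace (- (k * y) + - ((1 + 1) / 2 * c)) with (- (k * y + c)) in Max by field.
  apply Rle_trans with (exp (k * y + c) * B).
  - apply Rmult_le_reg_r with (exp (- (k * y + c))); [apply exp_pos|].
    replace (exp (k * y + c) * B * exp (- (k * y + c))) with (B * (exp (k * y + c) * exp (- (k * y + c)))) by ring.
    rewrite <- exp_plus. replace (k * y + c + - (k * y + c)) with 0 by ring. rewrite exp_0. lra.
  - apply Rmult_le_compat_r; [exact HB0|].
    destruct (Rle_lt_or_eq_dec _ _ Hc) as [L|L]; [left; apply exp_increasing; lra|right; f_equal; lra].
Qed.

(** The real axis cuts the strip into two halves. On each, [f] is small on one side and bounded by
    [M] on the other, so [two_constants_rectangle], applied in a long rectangle around the given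
    abscissa, makes it small up to height [b']. *)
Lemma lindelof_strip (f : C -> C) (A b M : R) : 0 < b < PI / 2 ->
  (forall w, fst w < A -> Rabs (snd w) <= b -> hol f w /\ Cmod (f w) <= M) ->
  (forall eps, 0 < eps -> exists T, forall t, t < T -> Cmod (f (t, 0)) < eps) ->
  forall b', 0 < b' < b -> forall eps, 0 < eps -> exists T, forall w, fst w < T ->
    Rabs (snd w) <= b' -> Cmod (f w) < eps.
Proof.
  intros Hb Hf H0 b' Hb' eps He. assert (HM : 0 <= M).
  { destruct (Hf (A - 1, 0)) as [_ H]; [simpl; lra|simpl; rewrite Rabs_R0; lra|].
    pose proof (Cmod_ge_0 (f (A - 1, 0))). lra. }
  destruct (exists_small_exp (eps / (2 * exp 1 * (M + 1))) 0) as [s [Hs1 Hs2]].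
  { apply Rdiv_lt_0_compat; [exact He|]. pose proof (exp_pos 1). nra. }
  (* Between heights [b'] and [b] the exponential weight gains [e^(- k (b - b')) = e^s], which was
     chosen to beat [M]. Then [B] is set so that [e^(1 + k b') B = eps / 2]. *)
  set (k := - s / (b - b')).
  assert (Hk : 0 <= k) by (apply Rmult_le_pos; [lra|left; apply Rinv_0_lt_compat; lra]).
  set (B := eps / 2 * exp (- (1 + k * b'))).
  assert (HB : 0 < B) by (apply Rmult_lt_0_compat; [lra|apply exp_pos]).
  assert (HMk : M * exp (- (k * b)) <= B).
  { unfold B. replace (- (k * b)) with (s + 1 + - (1 + k * b')) by (unfold k; field; lra).
    rewrite exp_plus, exp_plus, <- Rmult_assoc. apply Rmult_le_compat_r; [left; apply exp_pos|].
    pose proof (exp_pos 1). apply Rle_trans with ((M + 1) * (eps / (2 * exp 1 * (M + 1)) * exp 1)).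
    - apply Rmult_le_compat; [lra|left; apply Rmult_lt_0_compat; apply exp_pos|lra|].
      apply Rmult_le_compat_r; lra.
    - right. field. lra. }
  destruct (exists_small_exp (B / (M + 1)) 0) as [s2 [Hs3 Hs4]].
  { apply Rdiv_lt_0_compat; lra. }
  (* The half-length for which the vertical sides contribute at most [M e^(s2) <= B]. *)
  set (T := - 4 * s2). assert (HT : 0 <= T) by (unfold T; lra). assert (HMT : M * exp (- ((1 + T) / 4)) <= B).
  { apply Rle_trans with ((M + 1) * (B / (M + 1))); [|right; field; lra].
    apply Rmult_le_compat; [lra|left; apply exp_pos|lra|]. left.
    apply Rlt_trans with (2 := Hs4). apply exp_increasing. unfold T. lra. }
  destruct (H0 B HB) as [T0 HT0]. exists (Rmin A T0 - T). intros w Hw1 Hw2. pose proof (Rmin_bounds A T0).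
  assert (Fin : forall y, 0 <= y <= b' -> exp (1 + k * y) * B < eps).
  { intros y Hy. apply Rle_lt_trans with (exp (1 + k * b') * B).
    - apply Rmult_le_compat_r; [lra|]. assert (L : k * y <= k * b') by (apply Rmult_le_compat_l; lra).
      destruct (Rle_lt_or_eq_dec _ _ L) as [L'|L']; [left; apply exp_increasing; lra|right; now rewrite L'].
    - unfold B. replace (exp (1 + k * b') * (eps / 2 * exp (- (1 + k * b')))) with (eps / 2 * (exp (1 + k * b') * exp (- (1 + k * b')))) by ring.
      rewrite <- exp_plus. replace (1 + k * b' + - (1 + k * b')) with 0 by ring. rewrite exp_0. lra. }
  destruct w as [t y]. simpl in Hw1, Hw2. apply Rabs_le_between in Hw2. destruct (Rle_lt_dec 0 y) as [Py|Ny].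
  - pose proof (two_constants_rectangle (fun v => f ((t, 0%R) + v)%C) T b k M B HT Hb) as TC.
    assert (E : ((t, 0%R) + (0%R, y))%C = (t, y)) by (apply injective_projections; simpl; ring).
    rewrite <- E. eapply Rle_lt_trans; [|apply (Fin y); lra]. apply TC; auto; try lra.
    + intros v V1 V2. destruct (Hf ((t, 0%R) + v)%C) as [F1 F2]; [simpl; lra|simpl; apply Rabs_le; lra|].
      split; [|exact F2]. apply (hol_comp (fun v => (t, 0%R) + v)%C f); [|exact F1].
      apply hol_plus; [apply hol_const|apply hol_id].
    + intros u Hu. assert (E' : ((t, 0%R) + (u, 0%R))%C = (t + u, 0)) by (apply injective_projections; simpl; ring).
      rewrite E'. left. apply HT0. lra.
  (* A half-turn about [(t, 0)] is holomorphic, unlike conjugation, and brings the lower half-strip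
     to the upper one. *)
  - pose proof (two_constants_rectangle (fun v => f ((t, 0%R) - v)%C) T b k M B HT Hb) as TC.
    assert (E : ((t, 0%R) - (0%R, - y)%R)%C = (t, y)) by (apply injective_projections; simpl; ring).
    rewrite <- E. eapply Rle_lt_trans; [|apply (Fin (- y)); lra]. apply TC; auto; try lra.
    + intros v V1 V2. destruct (Hf ((t, 0%R) - v)%C) as [F1 F2]; [simpl; lra|simpl; apply Rabs_le; lra|].
      split; [|exact F2]. apply (hol_comp (fun v => (t, 0%R) - v)%C f); [|exact F1].
      apply hol_minus; [apply hol_const|apply hol_id].
    + intros u Hu. assert (E' : ((t, 0%R) - (u, 0%R))%C = (t - u, 0)) by (apply injective_projections; simpl; ring).
      rewrite E'. left. apply HT0. lra.
Qed.

(** * Asymptotics of the generator and of the Koenigs function in Stolz angles *)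

Lemma exp_le (a b : R) : a <= b -> exp a <= exp b.
Proof. intros [L|L]; [left; now apply exp_increasing|right; now rewrite L]. Qed.

Lemma exp_threshold (p K eps : R) : 0 < p -> 0 < eps -> exists T, T <= 0 /\ forall t, t < T -> K * exp (p * t) < eps.
Proof.
  intros Hp He. destruct (exists_small_exp (eps / (Rabs K + 1)) 0) as [s [Hs1 Hs2]].
  { apply Rdiv_lt_0_compat; [exact He|]. pose proof (Rabs_pos K). lra. }
  exists (s / p). split.
  - apply Rle_div_l; [exact Hp|lra].
  - intros t Ht. pose proof (Rabs_pos K). pose proof (Rle_abs K). assert (L : exp (p * t) <= exp s).
    { apply exp_le. apply (Rmult_lt_compat_l p) in Ht; [|exact Hp].
      replace (p * (s / p)) with s in Ht by (field; lra). lra. }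
    apply Rle_lt_trans with (Rabs K * exp s).
    + apply Rle_trans with (Rabs K * exp (p * t)).
      * apply Rmult_le_compat_r; [left; apply exp_pos|lra].
      * apply Rmult_le_compat_l; lra.
    + apply Rle_lt_trans with (Rabs K * (eps / (Rabs K + 1))).
      * apply Rmult_le_compat_l; lra.
      * apply Rmult_lt_reg_r with (Rabs K + 1); [lra|].
        replace (Rabs K * (eps / (Rabs K + 1)) * (Rabs K + 1)) with (Rabs K * eps) by (field; lra). nra.
Qed.

Lemma cos_strip (b y : R) : 0 < b < PI / 2 -> Rabs y <= b -> 0 < cos b <= cos y /\ cos b <= 1.
Proof.
  intros Hb Hy. split; [split|apply COS_bound].
  - apply cos_gt_0; lra.
  - pose proof PI_RGT_0. unfold Rabs in Hy. destruct (Rcase_abs y).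
    + rewrite <- (cos_neg y). apply cos_decr_1; lra.
    + apply cos_decr_1; lra.
Qed.

Lemma Cmod_sq_1_cexp (w : C) :
  Cmod (1 - cexp w) * Cmod (1 - cexp w) = 1 - 2 * fst (cexp w) + exp (fst w) * exp (fst w).
Proof. rewrite <- (Cmod_cexp w), !Cmod_sq. simpl. ring. Qed.

Lemma strip_in_disc (x w : C) (b : R) : Cmod x = 1 -> 0 < b < PI / 2 -> Rabs (snd w) <= b ->
  exp (fst w) <= cos b / 2 -> Cmod (x * (1 - cexp w)) < 1 /\ cos b * exp (fst w) <= fst (cexp w).
Proof.
  intros Hx Hb Hw He. destruct (cos_strip b (snd w) Hb Hw) as [[C1 C2] C3]. pose proof (exp_pos (fst w)) as P.
  assert (R1 : cos b * exp (fst w) <= fst (cexp w)) by (simpl; nra).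
  split; [|exact R1]. rewrite Cmod_mult, Hx, Rmult_1_l.
  pose proof (Cmod_sq_1_cexp w) as Sq. pose proof (Cmod_ge_0 (1 - cexp w)). nra.
Qed.

Lemma generator_strip (G : C -> C) (x L : C) (al : R) :
  Cmod x = 1 -> al < 1 -> (forall z, Cmod z < 1 -> hol G z) ->
  (forall a, Cmod a < 1 ->
    fst (Cconj a * (G a - G 0))%C + Cmod a * Cmod a * fst (Cconj (G 0) * a)%C <= 0) ->
  (forall eps, 0 < eps -> exists T, forall t, t < T ->
    Cmod (G (x * (1 - exp t))%C * exp (- (al * t)) - L) < eps) ->
  forall b, 0 < b < PI / 2 -> forall eps, 0 < eps -> exists T, forall w, fst w < T -> Rabs (snd w) <= b ->
    Cmod (G (x * (1 - cexp w))%C * cexp (- (al * w)) - L)%C < eps.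
Proof.
  intros Hx Hal HG Hq HL b Hb eps He.
  (* The Lindelöf argument loses width, so boundedness is established on a strip strictly between
     the requested one and the full one; [cos b1] is the aperture constant of the corresponding
     Stolz angle. *)
  set (b1 := (b + PI / 2) / 2). assert (Hb1 : 0 < b1 < PI / 2) by (unfold b1; lra).
  assert (Hm : 0 < cos b1 <= 1).
  { destruct (cos_strip b1 0 Hb1) as [[C1 C2] C3]; [rewrite Rabs_R0; lra|]. lra. }
  destruct (generator_stolz_bound G x (cos b1) Hx HG Hq Hm) as [M [HM HMb]].
  destruct (HL 1 Rlt_0_1) as [T1 HT1]. destruct (exp_threshold 1 1 (cos b1 / 2)) as [T2 [HT2 HT2']]; [lra|lra|].
  set (f := fun w => (G (x * (1 - cexp w)) * cexp (- (al * w)) - L)%C).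
  apply (lindelof_strip f (Rmin T1 T2) b1 (M * (Cmod L + 2) + Cmod L)); auto.
  - intros w Hw1 Hw2. pose proof (Rmin_bounds T1 T2).
    specialize (HT2' (fst w) ltac:(lra)). rewrite !Rmult_1_l in HT2'.
    destruct (strip_in_disc x w b1 Hx Hb1 Hw2 ltac:(lra)) as [D1 D2]. split.
    + unfold f. apply hol_minus; [|apply hol_const]. apply hol_mult.
      * apply (hol_comp (fun w => x * (1 - cexp w))%C G); [|now apply HG].
        apply hol_mult; [apply hol_const|]. apply hol_minus; [apply hol_const|apply hol_cexp, hol_id].
      * apply hol_cexp. apply (hol_ext_loc (fun w => (- al)%R * w)%C _ w 1); [lra| |].
        -- intros. rewrite RtoC_opp. ring.
        -- apply hol_mult; [apply hol_const|apply hol_id].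
    + unfold f. eapply Rle_trans; [apply Cmod_minus_triangle|]. apply Rplus_le_compat_r.
      rewrite Cmod_mult, Cmod_cexp.
      assert (E1 : fst (- (al * w))%C = - (al * fst w)) by (simpl; ring). rewrite E1.
      specialize (HMb (cexp w)). rewrite Cmod_cexp in HMb.
      pose proof (exp_pos (fst w)) as P. specialize (HMb ltac:(lra) D2). specialize (HT1 (fst w) ltac:(lra)).
      set (Gr := G (x * (1 - exp (fst w)))%C) in *. pose proof (exp_pos (- (al * fst w))) as P2.
      assert (G1 : Cmod Gr * exp (- (al * fst w)) <= Cmod L + 1).
      { rewrite <- (Cmod_RtoC_pos (exp (- (al * fst w)))) by lra. rewrite <- Cmod_mult.
        pose proof (Cmod_minus_le (Gr * exp (- (al * fst w))) L). lra. }
      (* The additive term of [generator_stolz_bound] becomes [e^((1 - al) fst w)], bounded because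
         [al < 1] and [fst w < 0]. *)
      assert (G2 : exp (fst w) * exp (- (al * fst w)) <= 1).
      { rewrite <- exp_plus, <- exp_0. apply exp_le. nra. }
      apply Rle_trans with (M * (Cmod Gr + exp (fst w)) * exp (- (al * fst w))).
      * apply Rmult_le_compat_r; lra.
      * replace (M * (Cmod Gr + exp (fst w)) * exp (- (al * fst w)))
          with (M * (Cmod Gr * exp (- (al * fst w)) + exp (fst w) * exp (- (al * fst w)))) by ring.
        apply Rmult_le_compat_l; lra.
  - intros e He'. destruct (HL e He') as [T HT]. exists T. intros t Ht. specialize (HT t Ht).
    unfold f. change ((t, 0)) with (RtoC t). rewrite cexp_RtoC.
    replace (- (al * t))%C with (RtoC (- (al * t))) by (rewrite RtoC_opp, RtoC_mult; ring).
    now rewrite cexp_RtoC.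
  - unfold b1; lra.
Qed.

(** The Cauchy estimate carries its own rate, which the limit inherits. Completeness is applied to
    the sequence along [T - 1 - n], one component at a time. *)
Lemma limit_at_minus_infinity (k : R -> C) (K p T : R) : 0 < p ->
  (forall t1 t2, t1 <= t2 -> t2 < T -> Cmod (k t2 - k t1) <= K * exp (p * t2)) ->
  exists l, forall t, t < T -> Cmod (k t - l) <= K * exp (p * t).
Proof.
  intros Hp Hk. set (u := fun n : nat => k (T - 1 - INR n)).
  assert (Ck : forall eps, 0 < eps -> exists N : nat, forall n m : nat, (n >= N)%nat -> (m >= N)%nat ->
     Cmod (u n - u m) < eps).
  { intros e He. destruct (exp_threshold p K e Hp He) as [T0 [_ HT0]].
    destruct (nfloor_ex (Rmax 0 (T - T0))) as [N [N1 N2]]; [apply Rmax_l|]. exists (S N). intros n m Hn Hm.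
    apply le_INR in Hn. apply le_INR in Hm. rewrite S_INR in Hn, Hm.
    pose proof (Rmax_r 0 (T - T0)). pose proof (Rmax_l 0 (T - T0)). destruct (Rle_lt_dec (INR n) (INR m)).
    - eapply Rle_lt_trans; [apply Hk; lra|]. apply HT0. lra.
    - rewrite Cmod_minus_sym. eapply Rle_lt_trans; [apply Hk; lra|]. apply HT0. lra. }
  destruct (Rcomplete.R_complete (fun n => fst (u n))) as [l1 Hl1].
  { intros e He. destruct (Ck e He) as [N HN]. exists N. intros n m Hn Hm.
    eapply Rle_lt_trans; [apply (Rabs_fst_le (u n - u m)%C)|]. now apply HN. }
  destruct (Rcomplete.R_complete (fun n => snd (u n))) as [l2 Hl2].
  { intros e He. destruct (Ck e He) as [N HN]. exists N. intros n m Hn Hm.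
    eapply Rle_lt_trans; [apply (Rabs_snd_le (u n - u m)%C)|]. now apply HN. }
  exists (l1, l2). intros t Ht. apply Rnot_lt_le. intro Lt.
  set (e := (Cmod (k t - (l1, l2)) - K * exp (p * t)) / 2). assert (He : 0 < e) by (unfold e; lra).
  destruct (Hl1 e He) as [N1 HN1]. destruct (Hl2 e He) as [N2 HN2].
  destruct (nfloor_ex (Rmax 0 (T - t))) as [N3 [_ HN3]]; [apply Rmax_l|]. pose proof (Rmax_r 0 (T - t)).
  set (n := (N1 + N2 + S N3)%nat).
  specialize (HN1 n ltac:(lia)). specialize (HN2 n ltac:(lia)). unfold R_dist, Rdist in *.
  assert (Hn : T - 1 - INR n <= t).
  { unfold n. rewrite plus_INR, S_INR. pose proof (pos_INR (N1 + N2)). lra. }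
  pose proof (Hk _ _ Hn Ht) as K1. fold (u n) in K1. pose proof (Cmod_split (k t) (u n) (l1, l2)) as S1.
  pose proof (Cmod_sum_abs (u n - (l1, l2))%C) as S2. simpl in S2. unfold Rminus in *. unfold e in *. lra.
Qed.

(** The factor [- (x * cexp w)] is [dz/dw], so the last estimate is the formal derivative of the one
    before. Both are kept: covering of sectors uses the values, and the bound on their opening uses
    the derivative. *)
Definition koenigs_asymptotics (h dh : C -> C) (x hx c : C) (p : R) : Prop :=
  forall b, 0 < b < PI / 2 -> forall eps, 0 < eps ->
    exists T, forall w, fst w < T -> Rabs (snd w) <= b ->
      Cmod (x * (1 - cexp w)) < 1 /\
      Cmod (h (x * (1 - cexp w))%C - hx - c * cexp (p * w)) <= eps * exp (p * fst w) /\
      Cmod (dh (x * (1 - cexp w))%C * (- (x * cexp w)) - p * c * cexp (p * w)) <= eps * exp (p * fst w).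

Lemma Cmod_cexp_scal (p : R) (w : C) : Cmod (cexp (p * w)%C) = exp (p * fst w).
Proof. rewrite Cmod_cexp. f_equal. simpl. ring. Qed.

(** In the variable [w] the equation becomes [K' = - x E e^(p w) / g] with [E = c1 + c2 K] and [g]
    tending to [L]. Since [e^(p w)] is integrable at [Re w = -oo], [K] converges and [E] tends to a
    nonzero [E0]; the last hypothesis supplies a point of the ray where [E] does not vanish, from
    which the lower bound is propagated. *)
Lemma koenigs_strip (h dh G : C -> C) (c1 c2 x L : C) (al : R) :
  Cmod x = 1 -> al < 1 -> L <> RtoC 0 ->
  (forall z, Cmod z < 1 -> cdiff h z (dh z)) ->
  (forall z, Cmod z < 1 -> (dh z * G z = c1 + c2 * h z)%C) ->
  (forall b, 0 < b < PI / 2 -> forall eps, 0 < eps -> exists T, forall w, fst w < T -> Rabs (snd w) <= b ->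
    Cmod (G (x * (1 - cexp w)) * cexp (- (al * w)) - L)%C < eps) ->
  (exists T, forall t, t < T -> (c1 + c2 * h (x * (1 - exp t)))%C <> RtoC 0) ->
  exists hx c, c <> RtoC 0 /\ koenigs_asymptotics h dh x hx c (1 - al).
Proof.
  intros Hx Hal NL Hh Hode HG HE. set (p := 1 - al). assert (Hp : 0 < p) by (unfold p; lra).
  pose proof PI_RGT_0 as HPI. pose proof (proj1 (Cmod_gt_0 _) NL) as PL.
  set (Z := fun w => (x * (1 - cexp w))%C).
  set (K := fun w => h (Z w)). set (K' := fun w => (dh (Z w) * (- (x * cexp w)))%C).
  set (E := fun w => (c1 + c2 * K w)%C). set (g := fun w => (G (Z w) * cexp (- (al * w)))%C).
  assert (HK : forall w, Cmod (Z w) < 1 -> cdiff K w (K' w)).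
  { intros w Hw. unfold K, K'. apply (cdiff_comp Z h); [|now apply Hh]. eapply cdiff_eq.
    - apply cdiff_scal. apply cdiff_minus; [apply cdiff_const|apply cdiff_cexp].
    - ring. }
  assert (HE' : forall w, Cmod (Z w) < 1 -> cdiff E w (c2 * K' w)%C).
  { intros w Hw. eapply cdiff_eq.
    - apply cdiff_plus; [apply cdiff_const|]. apply cdiff_scal. now apply HK.
    - ring. }
  assert (Dom : forall b, 0 < b < PI / 2 -> forall eps, 0 < eps -> exists T, T <= 0 /\ forall w, fst w < T -> Rabs (snd w) <= b ->
      Cmod (Z w) < 1 /\ Cmod (g w - L) < eps /\ Cmod L / 2 < Cmod (g w) /\ (K' w = - x * E w * cexp (p * w) / g w)%C).
  { intros b Hb eps He. destruct (cos_strip b 0 Hb) as [[C1 _] _]; [rewrite Rabs_R0; lra|].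
    destruct (exp_threshold 1 1 (cos b / 2)) as [T1 [HT1 HT1']]; [lra|lra|].
    destruct (HG b Hb (Rmin eps (Cmod L / 2))) as [T2 HT2]; [apply Rmin_pos; lra|].
    exists (Rmin T1 T2). split; [pose proof (Rmin_l T1 T2); lra|]. intros w Hw1 Hw2.
    specialize (HT1' (fst w) (Rlt_le_trans _ _ _ Hw1 (Rmin_l _ _))). rewrite !Rmult_1_l in HT1'.
    specialize (HT2 w (Rlt_le_trans _ _ _ Hw1 (Rmin_r _ _)) Hw2).
    destruct (strip_in_disc x w b Hx Hb Hw2 ltac:(lra)) as [D1 _].
    split; [exact D1|]. fold (Z w) in HT2. fold (g w) in HT2. pose proof (Rmin_bounds eps (Cmod L / 2)).
    split; [lra|]. assert (Gg : Cmod L / 2 < Cmod (g w)).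
    { pose proof (Cmod_minus_le L (g w)) as Q. rewrite Cmod_minus_sym in Q. lra. }
    split; [exact Gg|]. assert (Ng : g w <> RtoC 0) by (apply Cmod_gt_0; lra).
    assert (Ez : (G (Z w) = g w * cexp (al * w))%C).
    { unfold g. rewrite cexp_opp. field. apply cexp_neq_0. }
    assert (NG : G (Z w) <> RtoC 0).
    { rewrite Ez. apply Cmult_neq_0; [exact Ng|apply cexp_neq_0]. }
    assert (Ew : (cexp w = cexp (p * w) * cexp (al * w))%C).
    { rewrite <- cexp_add. assert (Q : (p * w + al * w)%C = w) by (unfold p; rewrite RtoC_minus; ring).
      now rewrite Q. }
    unfold K', E, K. rewrite <- (Hode (Z w) D1), Ez, Ew. field. exact Ng. }
  set (C0 := 2 / Cmod L). assert (HC0 : 0 < C0) by (apply Rdiv_lt_0_compat; lra).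
  assert (KB : forall w, Cmod L / 2 < Cmod (g w) -> (K' w = - x * E w * cexp (p * w) / g w)%C ->
     Cmod (K' w) <= C0 * exp (p * fst w) * Cmod (E w)).
  { intros w H1 ->. rewrite Cmod_div by (apply Cmod_gt_0; lra).
    rewrite !Cmod_mult, Cmod_opp, Hx, Rmult_1_l, Cmod_cexp_scal.
    pose proof (Cmod_ge_0 (E w)). pose proof (exp_pos (p * fst w)).
    replace (C0 * exp (p * fst w) * Cmod (E w)) with (Cmod (E w) * exp (p * fst w) * C0) by ring.
    apply Rmult_le_compat_l; [nra|]. unfold C0. unfold Rdiv. rewrite <- (Rinv_inv 2), <- Rinv_mult.
    apply Rinv_le_contravar; lra. }
  set (C1 := (Cmod c2 + 1) * C0). pose proof (Cmod_ge_0 c2) as Pc2. assert (HC1 : 0 < C1) by (unfold C1; nra).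
  assert (EB : forall w, Cmod (K' w) <= C0 * exp (p * fst w) * Cmod (E w) ->
     Cmod (c2 * K' w) <= C1 * exp (p * fst w) * Cmod (E w)).
  { intros w H. rewrite Cmod_mult. pose proof (Cmod_ge_0 (K' w)). unfold C1.
    apply Rle_trans with (Cmod c2 * (C0 * exp (p * fst w) * Cmod (E w))); [apply Rmult_le_compat_l; lra|].
    pose proof (Cmod_ge_0 (E w)). pose proof (exp_pos (p * fst w)).
    assert (0 <= C0 * exp (p * fst w) * Cmod (E w)) by (apply Rmult_le_pos; [apply Rmult_le_pos; lra|lra]). lra. }
  destruct (Dom (PI / 4) ltac:(lra) 1 Rlt_0_1) as [T1 [HT1 D1]]. destruct HE as [T2 HT2].
  set (T := Rmin T1 T2 - 1). assert (HTa : T < T1) by (pose proof (Rmin_l T1 T2); unfold T; lra).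
  assert (HTb : T < T2) by (pose proof (Rmin_r T1 T2); unfold T; lra).
  assert (Ax : forall t, t <= T -> Cmod (Z (t, 0)) < 1 /\ Cmod (K' (t, 0)) <= C0 * exp (p * t) * Cmod (E (t, 0))).
  { intros t Ht. destruct (D1 (t, 0)) as [A1 [_ [A2 A3]]]; [simpl; lra|simpl; rewrite Rabs_R0; lra|].
    split; [exact A1|]. now apply (KB (t, 0)). }
  (* The integral of the Gronwall weight [C1 e^(p s)] up to [T <= 0] is at most [C1 / p]. *)
  set (e1 := exp (- (C1 / p)) * Cmod (E (T, 0))). set (e2 := exp (C1 / p) * Cmod (E (T, 0))).
  assert (NE : 0 < Cmod (E (T, 0))).
  { apply Cmod_gt_0. specialize (HT2 T HTb). unfold E, K, Z. change ((T, 0)) with (RtoC T). now rewrite cexp_RtoC. }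
  assert (He1 : 0 < e1) by (apply Rmult_lt_0_compat; [apply exp_pos|exact NE]).
  assert (He2 : 0 < e2) by (apply Rmult_lt_0_compat; [apply exp_pos|exact NE]).
  assert (E12 : forall t, t <= T -> e1 <= Cmod (E (t, 0)) <= e2).
  { intros t Ht.
    destruct (gronwall (fun s => E (s, 0)) (fun s => c2 * K' (s, 0%R))%C (fun s => C1 / p * exp (p * s)) (fun s => C1 * exp (p * s)) t T Ht) as [G1 G2].
    - intros s Hs. apply rcdiff_horizontal, HE', Ax. lra.
    - intros s Hs. auto_derive; [trivial|]. field. lra.
    - intros s Hs. apply (EB (s, 0)). simpl. apply Ax. lra.
    - assert (X : exp (C1 / p * exp (p * T) - C1 / p * exp (p * t)) <= exp (C1 / p)).
      { apply exp_le. pose proof (exp_pos (p * t)).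
        assert (exp (p * T) <= 1) by (rewrite <- exp_0; apply exp_le; nra).
        assert (0 < C1 / p) by (apply Rdiv_lt_0_compat; lra). nra. }
      pose proof (Cmod_ge_0 (E (t, 0))). unfold e1, e2. split.
      + rewrite exp_Ropp. apply Rmult_le_reg_l with (exp (C1 / p)); [apply exp_pos|].
        rewrite <- Rmult_assoc, Rinv_r, Rmult_1_l by (apply Rgt_not_eq, exp_pos).
        eapply Rle_trans; [exact G1|]. now apply Rmult_le_compat_r.
      + eapply Rle_trans; [exact G2|]. apply Rmult_le_compat_r; lra. }
  set (C2 := C0 * e2). assert (HC2 : 0 < C2) by (unfold C2; nra).
  destruct (limit_at_minus_infinity (fun t => K (t, 0)) (C2 / p) p T Hp) as [hx Hhx].
  { intros t1 t2 H12 Ht2.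
    pose proof (mean_value_ineq (fun s => K (s, 0)) (fun s => K' (s, 0)) (fun s => C2 / p * exp (p * s)) (fun s => C2 * exp (p * s)) t1 t2 H12) as MV.
    cbv beta in MV. eapply Rle_trans; [apply MV|].
    - intros s Hs. apply rcdiff_horizontal, HK, Ax. lra.
    - intros s Hs. auto_derive; [trivial|]. field. lra.
    - intros s Hs. destruct (Ax s ltac:(lra)) as [_ A2]. destruct (E12 s ltac:(lra)) as [_ A3].
      eapply Rle_trans; [exact A2|]. unfold C2. pose proof (exp_pos (p * s)).
      replace (C0 * e2 * exp (p * s)) with (C0 * exp (p * s) * e2) by ring. apply Rmult_le_compat_l; nra.
    - pose proof (exp_pos (p * t1)). assert (0 < C2 / p) by (apply Rdiv_lt_0_compat; lra). nra. }
  set (E0 := (c1 + c2 * hx)%C). assert (NE0 : E0 <> RtoC 0).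
  { apply Cmod_gt_0. apply Rlt_le_trans with e1; [exact He1|]. apply Rnot_lt_le. intro Lt.
    destruct (exp_threshold p (Cmod c2 * (C2 / p)) (e1 - Cmod E0)) as [T3 [_ HT3]]; [lra|lra|].
    set (t := Rmin T T3 - 1). pose proof (Rmin_bounds T T3).
    specialize (HT3 t ltac:(unfold t; lra)). specialize (Hhx t ltac:(unfold t; lra)).
    destruct (E12 t ltac:(unfold t; lra)) as [E1 _]. pose proof (Cmod_minus_le (E (t, 0)) E0) as Q.
    replace (E (t, 0%R) - E0)%C with (c2 * (K (t, 0%R) - hx))%C in Q by (unfold E, E0; ring).
    rewrite Cmod_mult in Q. nra. }
  (* The coefficient obtained by integrating [- x E0 / L * e^(p w)]. *)
  set (c := (- x * E0 / L / p)%C). assert (Np : RtoC p <> RtoC 0) by (apply RtoC_neq0; lra).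
  assert (Nx : x <> RtoC 0) by (apply Cmod_gt_0; lra). exists hx, c. split.
  { unfold c. intro Q. apply NE0.
    replace E0 with (- x * E0 / L / p * (- (p * L / x)))%C by (field; repeat split; auto). rewrite Q. ring. }
  intros b Hb eps He.
  (* From the axis, bounds spread vertically over a height at most [b], where the Gronwall weight is
     at most [C1]. *)
  set (e3 := exp (C1 * b) * e2). assert (He3 : 0 < e3) by (apply Rmult_lt_0_compat; [apply exp_pos|exact He2]).
  (* The derivative is controlled to within [r <= p * eps] because [p * eps * e^(p t)] integrates to
     [eps * e^(p t)]. The tolerances [dE] and [dg] each contribute [r |L|^2 / 4] to a numerator
     whose denominator exceeds [|L|^2 / 2]. *)
  set (C3 := C0 * e3). assert (HC3 : 0 < C3) by (unfold C3; nra). set (r := Rmin eps (p * eps)).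
  assert (Heps : 0 < r) by (apply Rmin_pos; nra).
  pose proof (Rmin_bounds eps (p * eps)) as Hr. fold r in Hr. clearbody r. set (dE := r * Cmod L / (4)).
  
  assert (HdE : 0 < dE) by (unfold dE; apply Rdiv_lt_0_compat; nra).
  set (dg := r * Cmod L * Cmod L / (4 * (Cmod E0 + 1))). pose proof (Cmod_ge_0 E0) as PE0.
  assert (Hdg : 0 < dg) by (unfold dg; apply Rdiv_lt_0_compat; [repeat apply Rmult_lt_0_compat; lra|lra]).
  destruct (Dom b Hb dg Hdg) as [T3 [HT3 D3]]. set (C4 := C3 * b + C2 / p).
  assert (Kst : forall w, fst w < Rmin T T3 -> Rabs (snd w) <= b ->
     Cmod (K w - hx) <= C4 * exp (p * fst w)).
  { intros [t y] Hw1 Hw2. simpl in Hw1, Hw2. pose proof (Rmin_bounds T T3).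
    assert (Et : exp (p * t) <= 1) by (rewrite <- exp_0; apply exp_le; nra). pose proof (exp_pos (p * t)) as Pt.
    assert (St : forall s, Rabs s <= b -> Cmod (Z (t, s)) < 1 /\ Cmod (K' (t, s)) <= C0 * exp (p * t) * Cmod (E (t, s))).
    { intros s Hs. destruct (D3 (t, s)) as [A1 [_ [A2 A3]]]; [simpl; lra|exact Hs|].
      split; [exact A1|]. now apply (KB (t, s)). }
    assert (Hgr : forall u v, u <= v -> - b <= u -> v <= b -> v - u <= b ->
       Cmod (E (t, v)) <= exp (C1 * b) * Cmod (E (t, u)) /\ Cmod (E (t, u)) <= exp (C1 * b) * Cmod (E (t, v))).
    { intros u v Huv Hu Hv Hd.
      destruct (gronwall (fun s => E (t, s)) (fun s => Ci * (c2 * K' (t, s)))%C (fun s => C1 * s) (fun _ => C1) u v Huv) as [G1 G2].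
      - intros s Hs. apply rcdiff_vertical, HE', St. apply Rabs_le; lra.
      - intros s Hs. auto_derive; [trivial|ring].
      - intros s Hs. rewrite Cmod_mult, Cmod_Ci, Rmult_1_l. destruct (St s) as [_ S2]; [apply Rabs_le; lra|].
        eapply Rle_trans; [apply (EB (t, s)); exact S2|]. simpl.
        apply Rmult_le_compat_r; [apply Cmod_ge_0|]. nra.
      - assert (X : exp (C1 * v - C1 * u) <= exp (C1 * b)) by (apply exp_le; nra).
        pose proof (Cmod_ge_0 (E (t, u))). pose proof (Cmod_ge_0 (E (t, v))).
        split; [eapply Rle_trans; [exact G1|]|eapply Rle_trans; [exact G2|]]; apply Rmult_le_compat_r; lra. }
    assert (Eb : forall s, Rabs s <= b -> Cmod (E (t, s)) <= e3).
    { intros s Hs. apply Rabs_le_between in Hs. destruct (E12 t ltac:(lra)) as [_ E2].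
      apply Rle_trans with (exp (C1 * b) * Cmod (E (t, 0))).
      - destruct (Rle_lt_dec 0 s); [apply (Hgr 0 s); lra|apply (Hgr s 0); lra].
      - unfold e3. apply Rmult_le_compat_l; [left; apply exp_pos|exact E2]. }
    assert (Kv : forall u v, u <= v -> - b <= u -> v <= b -> v - u <= b -> Cmod (K (t, v) - K (t, u)) <= C3 * exp (p * t) * b).
    { intros u v Huv Hu Hv Hd.
      pose proof (mean_value_ineq (fun s => K (t, s)) (fun s => Ci * K' (t, s))%C (fun s => C3 * exp (p * t) * s) (fun _ => C3 * exp (p * t)) u v Huv) as MV.
      cbv beta in MV. eapply Rle_trans; [apply MV|].
      - intros s Hs. apply rcdiff_vertical, HK, St. apply Rabs_le; lra.
      - intros s Hs. auto_derive; [trivial|ring].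
      - intros s Hs. rewrite Cmod_mult, Cmod_Ci, Rmult_1_l. assert (Hs' : Rabs s <= b) by (apply Rabs_le; lra).
        destruct (St s Hs') as [_ S2]. eapply Rle_trans; [exact S2|]. specialize (Eb s Hs').
        unfold C3. replace (C0 * e3 * exp (p * t)) with (C0 * exp (p * t) * e3) by ring. apply Rmult_le_compat_l; nra.
      - assert (0 < C3 * exp (p * t)) by nra. nra. }
    assert (K1 : Cmod (K (t, y) - K (t, 0)) <= C3 * exp (p * t) * b).
    { apply Rabs_le_between in Hw2. destruct (Rle_lt_dec 0 y); [apply Kv; lra|].
      rewrite Cmod_minus_sym. apply Kv; lra. }
    specialize (Hhx t ltac:(lra)). pose proof (Cmod_split (K (t, y)) (K (t, 0)) hx). simpl. unfold C4. lra. }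
  assert (HC4 : 0 < C4).
  { unfold C4. assert (0 < C2 / p) by (apply Rdiv_lt_0_compat; lra). nra. }
  destruct (exp_threshold p (Cmod c2 * C4) dE Hp HdE) as [T4 [HT4 HT4']].
  assert (KD : forall w, fst w < Rmin (Rmin T T3) T4 -> Rabs (snd w) <= b ->
     Cmod (Z w) < 1 /\ Cmod (K' w - p * c * cexp (p * w)) <= r * exp (p * fst w)).
  { intros w Hw1 Hw2. destruct (Rmin_Rgt_l _ _ _ Hw1) as [W1 W2]. pose proof (Rlt_le_trans _ _ _ W1 (Rmin_r _ _)) as W3.
    destruct (D3 w W3 Hw2) as [Z1 [G1 [G2 G3]]]. split; [exact Z1|].
    specialize (Kst w W1 Hw2). specialize (HT4' (fst w) W2).
    assert (Ng : g w <> RtoC 0) by (apply Cmod_gt_0; lra). assert (EE : Cmod (E w - E0) <= dE).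
    { replace (E w - E0)%C with (c2 * (K w - hx))%C by (unfold E, E0; ring). rewrite Cmod_mult. nra. }
    replace (K' w - p * c * cexp (p * w))%C
      with (- x * cexp (p * w) * (((E w - E0) * L + E0 * (L - g w)) / (g w * L)))%C.
    2:{ rewrite G3. unfold c. field. repeat split; auto. }
    rewrite !Cmod_mult, Cmod_opp, Hx, Rmult_1_l, Cmod_cexp_scal, Rmult_comm.
    apply Rmult_le_compat_r; [left; apply exp_pos|]. rewrite Cmod_div, Cmod_mult by now apply Cmult_neq_0.
    assert (N1 : Cmod ((E w - E0) * L + E0 * (L - g w)) <= dE * Cmod L + Cmod E0 * dg).
    { eapply Rle_trans; [apply Cmod_triangle|]. rewrite !Cmod_mult, (Cmod_minus_sym L).
      apply Rplus_le_compat; [apply Rmult_le_compat_r; lra|apply Rmult_le_compat_l; lra]. }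
    assert (N2 : Cmod E0 * dg <= r * Cmod L * Cmod L / 4).
    { unfold dg. apply Rle_trans with ((Cmod E0 + 1) * (r * Cmod L * Cmod L / (4 * (Cmod E0 + 1)))).
      - apply Rmult_le_compat_r; [left; exact Hdg|lra].
      - right. field. lra. }
    assert (N3 : dE * Cmod L = r * Cmod L * Cmod L / 4) by (unfold dE; field).
    apply Rle_div_l; [apply Rmult_lt_0_compat; lra|]. apply Rle_trans with (r * (Cmod L / 2 * Cmod L)); [lra|].
    apply Rmult_le_compat_l; nra. }
  exists (Rmin (Rmin T T3) T4). intros w Hw1 Hw2. fold (Z w). fold (K w). fold (K' w).
  destruct (KD w Hw1 Hw2) as [Z1 Z2]. split; [exact Z1|]. pose proof (exp_pos (p * fst w)) as Pw. split.
  - destruct w as [t y]. simpl in Hw1, Hw2. simpl fst. set (Dw := fun w => (K w - hx - c * cexp (p * w))%C).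
    change (Cmod (Dw (t, y)) <= eps * exp (p * t)).
    (* Integrate the derivative error from [t1] to [t]. The value at [t1] is itself [O(e^(p t1))],
       so it disappears as [t1] tends to minus infinity. *)
    assert (Step : forall t1, t1 <= t -> Cmod (Dw (t, y)) <= eps * exp (p * t) + (C4 + Cmod c) * exp (p * t1)).
    { intros t1 Ht1.
      pose proof (mean_value_ineq (fun s => Dw (s, y)) (fun s => K' (s, y) - p * c * cexp (p * (s, y)))%C
        (fun s => eps * exp (p * s)) (fun s => p * eps * exp (p * s)) t1 t Ht1) as MV. cbv beta in MV.
      assert (MV' : Cmod (Dw (t, y) - Dw (t1, y)) <= eps * exp (p * t) - eps * exp (p * t1)).
      { apply MV.
        - intros s Hs. apply (rcdiff_horizontal Dw). destruct (KD (s, y)) as [Q1 _]; [simpl; lra|exact Hw2|].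
          eapply cdiff_eq.
          + apply cdiff_minus; [apply cdiff_minus; [now apply HK|apply cdiff_const]|].
            apply cdiff_scal. apply (cdiff_comp (fun w => p * w)%C cexp); [apply cdiff_scal, cdiff_id|apply cdiff_cexp].
          + cbv beta. ring.
        - intros s Hs. auto_derive; [trivial|ring].
        - intros s Hs. destruct (KD (s, y)) as [_ Q2]; [simpl; lra|exact Hw2|]. simpl in Q2.
          eapply Rle_trans; [exact Q2|]. apply Rmult_le_compat_r; [left; apply exp_pos|lra]. }
      pose proof (Cmod_minus_le (Dw (t, y)) (Dw (t1, y))) as Q3.
      assert (Q4 : Cmod (Dw (t1, y)) <= (C4 + Cmod c) * exp (p * t1)).
      { unfold Dw. eapply Rle_trans; [apply Cmod_minus_triangle|]. rewrite Cmod_mult, Cmod_cexp_scal.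
        pose proof (Rmin_l (Rmin T T3) T4). specialize (Kst (t1, y)). simpl in *. specialize (Kst ltac:(lra) Hw2). lra. }
      pose proof (exp_pos (p * t1)). nra. }
    apply Rnot_lt_le. intro Lt.
    destruct (exp_threshold p (C4 + Cmod c) (Cmod (Dw (t, y)) - eps * exp (p * t))) as [T5 [_ HT5]]; [lra|lra|].
    pose proof (Rmin_bounds t T5).
    specialize (Step (Rmin t T5 - 1) ltac:(lra)). specialize (HT5 (Rmin t T5 - 1) ltac:(lra)). lra.
  - eapply Rle_trans; [exact Z2|]. apply Rmult_le_compat_r; [lra|lra].
Qed.

(** * Inverse functions *)

Lemma cdiff_lower_bound (f : C -> C) (z d : C) : cdiff f z d -> d <> RtoC 0 ->
  exists r, 0 < r /\ forall w, Cmod (w - z) < r -> Cmod d / 2 * Cmod (w - z) <= Cmod (f w - f z).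
Proof.
  intros Hd N. apply Cmod_gt_0 in N. destruct (Hd (Cmod d / 2)) as [r [Hr K]]; [lra|].
  exists r. split; [exact Hr|]. intros w Hw. specialize (K w Hw).
  pose proof (Cmod_minus_le (d * (w - z)) (f w - f z)) as Q. rewrite (Cmod_minus_sym (d * (w - z))), Cmod_mult in Q. lra.
Qed.

(** [F] is any lift of [psi] through the injective [h]. Taking [psi] arbitrary covers both the
    logarithm, where [psi] is the identity, and the lift of a power map through the Koenigs
    function. *)
Lemma cdiff_inverse (U : C -> Prop) (h psi F : C -> C) (u d d' : C) (r0 : R) :
  (forall z, U z -> exists r, 0 < r /\ forall w, Cmod (w - z) < r -> U w) ->
  (forall z, U z -> hol h z) -> (forall z w, U z -> U w -> h z = h w -> z = w) ->
  0 < r0 -> (forall v, Cmod (v - u) < r0 -> U (F v) /\ h (F v) = psi v) ->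
  cdiff psi u d -> cdiff h (F u) d' -> d' <> RtoC 0 -> cdiff F u (d / d').
Proof.
  intros Uo Uh Ui Hr0 HF Hpsi Hh Nd'. assert (Z0 : Cmod (u - u) < r0) by now rewrite Cmod_diag.
  destruct (HF u Z0) as [FU Fu]. pose proof (proj1 (Cmod_gt_0 _) Nd') as Pd'. assert (FC : ccont F u).
  { intros e He. destruct (Uo _ FU) as [r1 [Hr1 U1]].
    destruct (cdiff_lower_bound h (F u) d' Hh Nd') as [r2 [Hr2 L2]]. set (r := Rmin e (Rmin r1 r2) / 2).
    assert (P : 0 < Rmin e (Rmin r1 r2)) by (repeat apply Rmin_pos; assumption).
    pose proof (Rmin_bounds e (Rmin r1 r2)). pose proof (Rmin_bounds r1 r2).
    set (m := Cmod d' / 2 * r). assert (Hm : 0 < m) by (unfold m, r; apply Rmult_lt_0_compat; lra).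
    destruct (cdiff_ccont _ _ _ Hpsi (m / 2)) as [dl [Hdl K]]; [lra|].
    exists (Rmin dl r0). split; [now apply Rmin_pos|]. intros v Hv. destruct (Rmin_Rgt_l _ _ _ Hv) as [V1 V2].
    specialize (K v V1). destruct (HF v V2) as [FV Fv].
    (* Continuity of [F]: covering yields a preimage of [psi v] near [F u], and injectivity
       identifies it with [F v]. *)
    destruct (covering h (F u) (psi v) r (m / 2)) as [z [Hz1 Hz2]].
    - unfold r; lra.
    - intros z Hz. apply Uh, U1. unfold r in Hz; lra.
    - intros z Hz. specialize (L2 z ltac:(unfold r in Hz; lra)). rewrite Hz in L2. fold m in L2.
      pose proof (Cmod_split (h z) (psi v) (h (F u))). rewrite Fu in *. lra.
    - rewrite Fu, Cmod_minus_sym. exact K.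
    - assert (E : F v = z).
      { apply Ui; [exact FV|apply U1; unfold r in Hz1; lra|]. congruence. }
      rewrite E. unfold r in Hz1; lra. }
  apply cdiff_slope in Hpsi. destruct Hpsi as [S [Sc [Su Se]]].
  apply cdiff_slope in Hh. destruct Hh as [g [gc [gu ge]]].
  assert (GC : ccont (fun v => g (F v)) u) by (apply (ccont_comp F g); assumption).
  assert (GN : g (F u) <> RtoC 0) by (rewrite gu; exact Nd'). destruct (ccont_neq0 _ _ GC GN) as [r3 [Hr3 G3]].
  apply (cdiff_ext_loc (fun v => F u + S v / g (F v) * (v - u))%C F u _ (Rmin r0 r3)).
  - now apply Rmin_pos.
  - intros v Hv. destruct (Rmin_Rgt_l _ _ _ Hv) as [V1 V2]. specialize (G3 v V2). destruct (HF v V1) as [FV Fv].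
    assert (N : g (F v) <> RtoC 0) by (apply Cmod_gt_0; pose proof (Cmod_ge_0 (g (F u))); lra).
    pose proof (Se v) as E1. pose proof (ge (F v)) as E2. rewrite Fv, Fu, E1 in E2.
    replace (S v / g (F v) * (v - u))%C with (S v * (v - u) / g (F v))%C by (unfold Cdiv; ring).
    rewrite E2. field. exact N.
  - apply cdiff_slope. exists (fun v => S v / g (F v))%C. split; [|split].
    + apply ccont_mult; [exact Sc|]. now apply ccont_inv.
    + now rewrite Su, gu.
    + intro v. ring.
Qed.

Lemma cexp_strip_inj (z w : C) : Rabs (snd z) < PI / 2 -> Rabs (snd w) < PI / 2 -> cexp z = cexp w -> z = w.
Proof.
  intros Hz Hw E. assert (E1 : cexp (z - w)%C = RtoC 1).
  { unfold Cminus. rewrite cexp_add, cexp_opp, E. field. apply cexp_neq_0. }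
  apply Rabs_def2 in Hz. apply Rabs_def2 in Hw.
  pose proof (f_equal Cmod E1) as M. rewrite Cmod_cexp, Cmod_1, <- exp_0 in M. apply exp_inv in M.
  pose proof (f_equal snd E1) as S. unfold cexp in S. simpl in *. assert (Sn : sin (snd z + - snd w) = 0).
  { pose proof (exp_pos (fst z + - fst w)). apply Rmult_integral in S. destruct S; [lra|assumption]. }
  assert (snd z = snd w).
  { destruct (Rtotal_order (snd z) (snd w)) as [L|[L|L]]; [|exact L|].
    - pose proof (sin_gt_0 (- (snd z + - snd w)) ltac:(lra) ltac:(lra)). rewrite sin_neg in H. lra.
    - pose proof (sin_gt_0 (snd z + - snd w) ltac:(lra) ltac:(lra)). lra. }
  apply injective_projections; lra.
Qed.

Lemma cdiff_clog (z : C) : 0 < fst z -> cdiff clog z (1 / z).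
Proof.
  intro Hz. assert (N : z <> RtoC 0) by (intro E; rewrite E in Hz; simpl in Hz; lra).
  apply (cdiff_inverse (fun w => Rabs (snd w) < PI / 2) cexp (fun w => w) clog z 1 z (fst z)).
  - intros w Hw. exists (PI / 2 - Rabs (snd w)). split; [lra|]. intros v Hv.
    pose proof (Rabs_snd_le (v - w)%C) as Q. simpl in Q.
    pose proof (Rabs_triang (snd w) (snd v + - snd w)). replace (snd w + (snd v + - snd w)) with (snd v) in H by ring. lra.
  - intros w _. eexists. apply cdiff_cexp.
  - intros u w Hu Hw. now apply cexp_strip_inj.
  - exact Hz.
  - intros v Hv. split; [apply clog_im_bound|]. apply cexp_clog.
    pose proof (Rabs_fst_le (v - z)%C) as Q. simpl in Q. apply Rabs_le_between in Q. lra.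
  - apply cdiff_id.
  - pose proof (cdiff_cexp (clog z)) as Q. rewrite (cexp_clog z Hz) in Q. exact Q.
  - exact N.
Qed.

(** * Sectors at the image of a regular singularity *)

(** On a circle of radius [d1] about [w0] the main term moves by at least [|c| p d1 / 2] times
    [e^(p fst w0)], while the error is at most a quarter of that; covering then finds the exact
    solution. Its distance to [w0] is part of the conclusion because the opening bound needs to
    locate the preimage. *)
Lemma sector_cover (h dh : C -> C) (x hx c : C) (p b d : R) :
  0 < p -> c <> RtoC 0 -> (forall z, Cmod z < 1 -> hol h z) ->
  koenigs_asymptotics h dh x hx c p -> 0 <= b < PI / 2 -> 0 < d ->
  exists T, forall w0, fst w0 < T -> Rabs (snd w0) <= b ->
    exists w, Cmod (w - w0) <= d /\ Cmod (x * (1 - cexp w)) < 1 /\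
      h (x * (1 - cexp w))%C = (hx + c * cexp (p * w0))%C.
Proof.
  intros Hp Nc Hh HK Hb Hd. pose proof (proj1 (Cmod_gt_0 _) Nc) as Pc.
  destruct (cdiff_lower_bound cexp 0 1 cdiff_cexp_0 C1_nz) as [r1 [Hr1 L1]]. rewrite Cmod_1, cexp_0 in L1.
  (* The three constraints: the requested precision, staying in a strip of half-width below
     [PI / 2], and [|e^v - 1| >= |v| / 2] for [|v| = p d1]. *)
  set (d1 := Rmin d (Rmin ((PI / 2 - b) / 2) (r1 / p / 2))).
  assert (Hrp : 0 < r1 / p / 2) by (apply Rdiv_lt_0_compat; [apply Rdiv_lt_0_compat; lra|lra]).
  assert (Hd1 : 0 < d1) by (unfold d1; repeat apply Rmin_pos; lra). assert (D1 : d1 <= d) by apply Rmin_l.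
  assert (D2 : d1 <= (PI / 2 - b) / 2) by (eapply Rle_trans; [apply Rmin_r|apply Rmin_l]).
  assert (D3 : d1 <= r1 / p / 2) by (eapply Rle_trans; [apply Rmin_r|apply Rmin_r]). assert (D4 : p * d1 < r1).
  { apply Rle_lt_trans with (p * (r1 / p / 2)); [apply Rmult_le_compat_l; lra|].
    replace (p * (r1 / p / 2)) with (r1 / 2) by (field; lra). lra. }
  clearbody d1. set (eps := Cmod c * p * d1 / (8 * exp (p * d1))). pose proof (exp_pos (p * d1)) as Pe.
  assert (Pcpd : 0 < Cmod c * p * d1) by (apply Rmult_lt_0_compat; [apply Rmult_lt_0_compat|]; lra).
  assert (He : 0 < eps) by (unfold eps; apply Rdiv_lt_0_compat; lra).
  assert (E1 : eps * exp (p * d1) = Cmod c * p * d1 / 8) by (unfold eps; field; lra).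
  assert (E2 : 1 <= exp (p * d1)) by (rewrite <- exp_0; apply exp_le; nra).
  destruct (HK (b + d1) ltac:(lra) eps He) as [T HT]. exists (T - d1). intros w0 W1 W2.
  assert (Near : forall w, Cmod (w - w0) <= d1 -> fst w <= fst w0 + d1 /\ fst w < T /\ Rabs (snd w) <= b + d1).
  { intros w Hw. pose proof (Rabs_fst_le (w - w0)%C) as Q1. pose proof (Rabs_snd_le (w - w0)%C) as Q2. simpl in Q1, Q2.
    apply Rabs_le_between in Q1. apply Rabs_le_between in Q2. apply Rabs_le_between in W2.
    split; [lra|]. split; [lra|]. apply Rabs_le; lra. }
  assert (Z0 : Cmod (w0 - w0) <= d1) by (rewrite Cmod_diag; lra). pose proof (exp_pos (p * fst w0)) as P0.
  destruct (covering (fun w => h (x * (1 - cexp w))%C) w0 (hx + c * cexp (p * w0))%C d1 (Cmod c * p * d1 / 4 * exp (p * fst w0))) as [w [Hw1 Hw2]].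
  - lra.
  - intros w Hw. destruct (Near w Hw) as [_ [N1 N2]]. destruct (HT w N1 N2) as [Z1 _].
    apply (hol_comp (fun w => x * (1 - cexp w))%C h); [|now apply Hh].
    apply hol_mult; [apply hol_const|]. apply hol_minus; [apply hol_const|apply hol_cexp, hol_id].
  - intros w Hw. destruct (Near w ltac:(lra)) as [N0 [N1 N2]]. destruct (HT w N1 N2) as [_ [Z2 _]].
    set (v := (p * (w - w0))%C).
    assert (Mv : Cmod v = p * d1) by (unfold v; rewrite Cmod_mult, Cmod_RtoC_pos, Hw; lra).
    specialize (L1 v). replace (v - 0)%C with v in L1 by ring. rewrite Mv in L1. specialize (L1 D4).
    assert (Ew : (cexp (p * w) = cexp (p * w0) * cexp v)%C).
    { rewrite <- cexp_add. assert (Q : (p * w0 + v)%C = (p * w)%C) by (unfold v; ring). now rewrite Q. }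
    pose proof (Cmod_minus_le (c * cexp (p * w0) * (cexp v - 1)) (- (h (x * (1 - cexp w))%C - hx - c * cexp (p * w)))) as Q.
    replace (c * cexp (p * w0) * (cexp v - 1) - - (h (x * (1 - cexp w))%C - hx - c * cexp (p * w)))%C
      with (h (x * (1 - cexp w))%C - (hx + c * cexp (p * w0)))%C in Q by (rewrite Ew; ring).
    eapply Rle_trans; [|exact Q]. rewrite Cmod_opp, !Cmod_mult, Cmod_cexp_scal.
    assert (X : eps * exp (p * fst w) <= Cmod c * p * d1 / 8 * exp (p * fst w0)).
    { rewrite <- E1, Rmult_assoc, <- exp_plus. apply Rmult_le_compat_l; [lra|]. apply exp_le. nra. }
    assert (Y : Cmod c * exp (p * fst w0) * (1 / 2 * (p * d1)) <= Cmod c * exp (p * fst w0) * Cmod (cexp v - 1)).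
    { apply Rmult_le_compat_l; [nra|exact L1]. }
    nra.
  - destruct (Near w0 Z0) as [N0 [N1 N2]]. destruct (HT w0 N1 N2) as [_ [Z2 _]].
    replace (h (x * (1 - cexp w0))%C - (hx + c * cexp (p * w0)))%C with (h (x * (1 - cexp w0))%C - hx - c * cexp (p * w0))%C by ring.
    eapply Rle_lt_trans; [exact Z2|]. apply Rmult_lt_compat_r; [exact P0|]. nra.
  - exists w. destruct (Near w Hw1) as [_ [N1 N2]]. destruct (HT w N1 N2) as [Z1 _]. split; [lra|]. split; assumption.
Qed.

Lemma sector_point (c : C) (p r th : R) : 0 < p -> c <> RtoC 0 -> 0 < r ->
  (c * cexp (p * ((ln (r / Cmod c) / p)%R, (th / p)%R)) = c * / Cmod c * (r * cexp (Ci * th)))%C.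
Proof.
  intros Hp Nc Hr. pose proof (proj1 (Cmod_gt_0 _) Nc) as Pc.
  assert (N : RtoC (Cmod c) <> RtoC 0) by (apply RtoC_neq0; lra).
  assert (E1 : (p * ((ln (r / Cmod c) / p)%R, (th / p)%R))%C = ((ln (r / Cmod c))%R + Ci * th)%C).
  { apply injective_projections; simpl; field; lra. }
  rewrite E1, cexp_add, cexp_RtoC, exp_ln by (apply Rdiv_lt_0_compat; lra).
  rewrite RtoC_div by lra. field. exact N.
Qed.

(** The logarithm followed by division by [p] turns a sector of opening [theta < p PI] into a
    half-strip of half-width [theta / (2 p) < PI / 2]. *)
Lemma sector_inside (h dh : C -> C) (x hx c : C) (p theta : R) :
  0 < p -> c <> RtoC 0 -> (forall z, Cmod z < 1 -> hol h z) ->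
  koenigs_asymptotics h dh x hx c p -> 0 < theta < p * PI ->
  exists rho, 0 < rho /\ forall th r, Rabs th < theta / 2 -> 0 < r < rho ->
    exists z, Cmod z < 1 /\ h z = (hx + c * / Cmod c * (r * cexp (Ci * th)))%C.
Proof.
  intros Hp Nc Hh HK Hth. pose proof (proj1 (Cmod_gt_0 _) Nc) as Pc. assert (Hb : 0 <= theta / 2 / p < PI / 2).
  { split; [apply Rmult_le_pos; [lra|left; now apply Rinv_0_lt_compat]|]. apply Rlt_div_l; lra. }
  destruct (sector_cover h dh x hx c p (theta / 2 / p) 1 Hp Nc Hh HK Hb Rlt_0_1) as [T HT].
  exists (Cmod c * exp (p * T)). split; [apply Rmult_lt_0_compat; [lra|apply exp_pos]|]. intros th r Hth' Hr.
  destruct (HT ((ln (r / Cmod c) / p)%R, (th / p)%R)) as [w [_ [W1 W2]]].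
  - simpl. apply Rlt_div_l; [exact Hp|].
    rewrite <- (ln_exp (T * p)). apply ln_increasing; [apply Rdiv_lt_0_compat; lra|].
    apply Rlt_div_l; [exact Pc|]. rewrite (Rmult_comm T). lra.
  - simpl. unfold Rdiv at 1. rewrite Rabs_mult, (Rabs_pos_eq (/ p)) by (left; now apply Rinv_0_lt_compat).
    apply Rmult_le_compat_r; [left; now apply Rinv_0_lt_compat|lra].
  - exists (x * (1 - cexp w))%C. split; [exact W1|]. rewrite W2. f_equal. apply sector_point; lra || assumption.
Qed.

(* Composing the inverse of [h] with [u |-> (R (1 - u))^q], which maps the unit disc into a sector
   of angle [q pi], gives a self-map of the disc; Schwarz-Pick at real [u -> 1] forces [q <= p]. *)
Lemma sector_outside (h dh : C -> C) (x hx c : C) (p theta rho : R) :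
  0 < p -> Cmod x = 1 -> c <> RtoC 0 ->
  (forall z, Cmod z < 1 -> cdiff h z (dh z)) -> (forall z, Cmod z < 1 -> dh z <> RtoC 0) ->
  (forall z w, Cmod z < 1 -> Cmod w < 1 -> h z = h w -> z = w) ->
  koenigs_asymptotics h dh x hx c p -> p * PI < theta -> 0 < rho ->
  ~ (forall th r, Rabs th < theta / 2 -> 0 < r < rho ->
      exists z, Cmod z < 1 /\ h z = (hx + c * / Cmod c * (r * cexp (Ci * th)))%C).
Proof.
  intros Hp Hx Nc Hh Nh Ih HK Hth Hrho Hsec. pose proof (proj1 (Cmod_gt_0 _) Nc) as Pc. pose proof PI_RGT_0 as HPI.
  set (q := theta / PI). assert (Hq : p < q) by (apply Rlt_div_r; lra).
  (* [R0] is half of [rho^(1 / q)]: since [|1 - u| < 2], the power [|R0 (1 - u)|^q] stays below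
     [rho]. *)
  assert (Hqpi : q * (PI / 2) = theta / 2) by (unfold q; field; lra). set (R0 := exp (ln rho / q) / 2).
  assert (HR0 : 0 < R0) by (unfold R0; pose proof (exp_pos (ln rho / q)); lra).
  assert (Rxi : forall u, Cmod u < 1 -> 0 < fst (R0 * (1 - u))%C /\ Cmod (R0 * (1 - u)) < 2 * R0).
  { intros u Hu. pose proof (Rabs_fst_le u) as Q. split.
    - simpl. apply Rabs_le_between in Q. nra.
    - rewrite Cmod_mult, Cmod_RtoC_pos by lra. pose proof (Cmod_minus_triangle 1 u). rewrite Cmod_1 in H. nra. }
  set (lam := (c * / Cmod c)%C). assert (Mlam : Cmod lam = 1).
  { assert (N : RtoC (Cmod c) <> RtoC 0) by (apply RtoC_neq0; lra).
    unfold lam. rewrite Cmod_mult, Cmod_inv, Cmod_RtoC_pos by (exact N || lra). field. lra. }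
  set (psi := fun u => (hx + lam * cexp (q * clog (R0 * (1 - u))))%C).
  (* The premise on [u] sits under the existential so that choice yields a total function; outside
     the disc the value is 0. *)
  assert (Hex : forall u, exists z, Cmod u < 1 -> Cmod z < 1 /\ h z = psi u).
  { intro u. destruct (Rlt_le_dec (Cmod u) 1) as [Hu|Hu]; [|exists (RtoC 0); intro; lra].
    destruct (Rxi u Hu) as [X1 X2]. set (xi := (R0 * (1 - u))%C) in *. assert (Pxi : 0 < Cmod xi).
    { eapply Rlt_le_trans; [exact X1|]. eapply Rle_trans; [apply Rle_abs|apply Rabs_fst_le]. }
    destruct (Hsec (q * snd (clog xi)) (exp (q * ln (Cmod xi)))) as [z [Hz1 Hz2]].
    - rewrite Rabs_mult, (Rabs_pos_eq q), <- Hqpi by lra. apply Rmult_lt_compat_l; [lra|apply clog_im_bound].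
    - split; [apply exp_pos|]. rewrite <- (exp_ln rho) by exact Hrho. apply exp_increasing.
      assert (L : ln (Cmod xi) < ln rho / q).
      { rewrite <- (ln_exp (ln rho / q)). apply ln_increasing; [exact Pxi|]. unfold R0 in X2. lra. }
      apply (Rmult_lt_compat_l q) in L; [|lra]. replace (q * (ln rho / q)) with (ln rho) in L by (field; lra). exact L.
    - exists z. intros _. split; [exact Hz1|]. rewrite Hz2. unfold psi. f_equal. fold lam. f_equal.
      fold xi. rewrite <- cexp_RtoC, <- cexp_add.
      assert (E : ((q * ln (Cmod xi))%R + Ci * (q * snd (clog xi))%R)%C = (q * clog xi)%C)
        by (apply injective_projections; simpl; ring).
      now rewrite E. }
  set (F := fun u => proj1_sig (constructive_indefinite_description _ (Hex u))).
  assert (HF : forall u, Cmod u < 1 -> Cmod (F u) < 1 /\ h (F u) = psi u).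
  { intros u Hu. unfold F. destruct (constructive_indefinite_description _ (Hex u)) as [z Hz]. simpl. auto. }
  assert (Dpsi : forall u, Cmod u < 1 -> cdiff psi u (- (lam * cexp (q * clog (R0 * (1 - u))) * q * R0 / (R0 * (1 - u))))%C).
  { intros u Hu. destruct (Rxi u Hu) as [X1 _]. eapply cdiff_eq.
    - apply cdiff_plus; [apply cdiff_const|]. apply cdiff_scal.
      apply (cdiff_comp (fun u => q * clog (R0 * (1 - u)))%C cexp); [|apply cdiff_cexp].
      apply cdiff_scal. apply (cdiff_comp (fun u => R0 * (1 - u))%C clog); [|now apply cdiff_clog].
      apply cdiff_scal. apply cdiff_minus; [apply cdiff_const|apply cdiff_id].
    - cbv beta. unfold Cdiv. ring. }
  assert (DF : forall u, Cmod u < 1 ->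
    cdiff F u (- (lam * cexp (q * clog (R0 * (1 - u))) * q * R0 / (R0 * (1 - u))) / dh (F u))%C).
  { intros u Hu. destruct (HF u Hu) as [F1 _].
    apply (cdiff_inverse (fun z => Cmod z < 1) h psi F u _ (dh (F u)) (1 - Cmod u)); auto.
    - intros z Hz. exists (1 - Cmod z). split; [lra|]. intros w Hw. pose proof (Cmod_minus_le w z). lra.
    - intros z Hz. eexists. now apply Hh.
    - lra.
    - intros v Hv. apply HF. pose proof (Cmod_minus_le v u). lra. }
  (* The fourth root of [q / p]. The argument below loses three factors [mu]: one in the derivative
     asymptotics, one in the position of the preimage, one in [1 - |u|^2]. This gives
     [q <= p mu^3 < p mu^4 = q]. *)
  set (mu := exp (ln (q / p) / 4)). assert (Hqp : 1 < q / p).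
  { apply Rlt_div_r; lra. }
  assert (Hmu4 : mu * mu * mu * mu = q / p).
  { unfold mu. rewrite <- !exp_plus. rewrite <- (exp_ln (q / p)) at 5 by lra. f_equal. field. }
  assert (Hmu : 1 < mu).
  { unfold mu. rewrite <- exp_0. apply exp_increasing. pose proof (ln_increasing 1 (q / p) ltac:(lra) Hqp).
    rewrite ln_1 in H. lra. }
  set (d := ln mu / p). assert (Hd : 0 < d).
  { unfold d. apply Rdiv_lt_0_compat; [|exact Hp]. rewrite <- ln_1. apply ln_increasing; lra. }
  assert (Epd : exp (p * d) = mu) by (unfold d; replace (p * (ln mu / p)) with (ln mu) by (field; lra); apply exp_ln; lra).
  set (eps := Cmod c * p * (mu - 1)). assert (He : 0 < eps) by (unfold eps; repeat apply Rmult_lt_0_compat; lra).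
  assert (Hhol : forall z, Cmod z < 1 -> hol h z) by (intros z Hz; eexists; eauto).
  assert (Hd2 : 0 < Rmin d 1) by (apply Rmin_pos; lra).
  assert (HM : 0 < Rmin d (PI / 4)) by (apply Rmin_pos; lra).
  (* Only real [w0] occur. A radius at most [PI / 4] keeps the solution in the strip of the
     derivative asymptotics, and a radius at most [d] costs one factor [mu]. *)
  destruct (sector_cover h dh x hx c p 0 (Rmin d (PI / 4)) Hp Nc Hhol HK ltac:(lra) HM) as [T1 HT1].
  destruct (HK (PI / 4) ltac:(lra) eps He) as [T2 HT2]. set (T := Rmin T1 (T2 - d)).
  set (tau1 := ln (2 * R0 * (1 - / mu))). set (tau2 := (p * T + ln (Cmod c)) / q).
  set (tau := Rmin tau1 (Rmin (ln R0) tau2) - 1). set (xi := exp tau). assert (Imu : 0 < / mu < 1).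
  { split; [apply Rinv_0_lt_compat; lra|]. rewrite <- Rinv_1. apply Rinv_lt_contravar; lra. }
  pose proof (Rmin_bounds tau1 (Rmin (ln R0) tau2)). pose proof (Rmin_bounds (ln R0) tau2).
  assert (T1a : tau < tau1) by (unfold tau; lra). assert (T1b : tau < ln R0) by (unfold tau; lra).
  assert (T1c : tau < tau2) by (unfold tau; lra). assert (Pxi : 0 < xi) by apply exp_pos.
  assert (X1 : xi < 2 * R0 * (1 - / mu)).
  { unfold xi. rewrite <- (exp_ln (2 * R0 * (1 - / mu))) by (apply Rmult_lt_0_compat; lra). now apply exp_increasing. }
  assert (X2 : xi < R0).
  { unfold xi. rewrite <- (exp_ln R0) by lra. now apply exp_increasing. }
  set (u := (1 - xi / R0)%R). assert (Hxr : 0 < xi / R0 < 1).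
  { split; [apply Rdiv_lt_0_compat; lra|]. apply Rlt_div_l; lra. }
  assert (Mu : Cmod u = u) by (apply Cmod_RtoC_pos; unfold u; lra).
  assert (Hu : Cmod u < 1) by (rewrite Mu; unfold u; lra). assert (Exi : (R0 * (1 - u))%C = RtoC xi).
  { unfold u. rewrite <- RtoC_minus, <- RtoC_mult. f_equal. field. lra. }
  assert (Clog : clog xi = RtoC tau).
  { apply cexp_strip_inj; [apply clog_im_bound|simpl; rewrite Rabs_R0; lra|].
    rewrite cexp_RtoC. apply cexp_clog. exact Pxi. }
  pose proof (schwarz_pick_deriv F u _ (fun z Hz => ex_intro _ _ (DF z Hz)) (fun z Hz => proj1 (HF z Hz)) Hu (DF u Hu)) as SP.
  (* The real point at which the main term [|c| e^(p t0)] equals [xi^q]; the preimage [F u] then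
     lies close to [x (1 - e^t0)] in the coordinate [w]. *)
  destruct (HF u Hu) as [F1 F2]. set (t0 := (q * tau - ln (Cmod c)) / p).
  assert (Et0 : Cmod c * exp (p * t0) = exp (q * tau)).
  { rewrite <- (exp_ln (Cmod c)) at 1 by lra. rewrite <- exp_plus. f_equal. unfold t0. field. lra. }
  assert (Ht0 : t0 < T).
  { apply Rlt_div_l; [lra|]. apply Rlt_div_r in T1c; lra. }
  pose proof (Rmin_l T1 (T2 - d)) as TT1. pose proof (Rmin_r T1 (T2 - d)) as TT2. fold T in TT1, TT2.
  destruct (HT1 (t0, 0)) as [w [W1 [W2 W3]]]; [simpl; lra|simpl; rewrite Rabs_R0; lra|].
  pose proof (Rmin_l d (PI / 4)) as Md1. pose proof (Rmin_r d (PI / 4)) as Md2.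
  assert (EF : F u = (x * (1 - cexp w))%C).
  { apply Ih; auto. rewrite F2, W3. unfold psi. f_equal. rewrite Exi, Clog. rewrite <- RtoC_mult, cexp_RtoC.
    change ((t0, 0)) with (RtoC t0). rewrite <- RtoC_mult, cexp_RtoC, <- Et0, RtoC_mult. unfold lam.
    field. intro Q. apply RtoC_inj in Q. lra. }
  pose proof (Rabs_fst_le (w - (t0, 0))%C) as Q1. pose proof (Rabs_snd_le (w - (t0, 0))%C) as Q2. simpl in Q1, Q2.
  apply Rabs_le_between in Q1. apply Rabs_le_between in Q2.
  assert (Wt : fst w < T2) by lra. assert (Ws : Rabs (snd w) <= PI / 4) by (apply Rabs_le; lra).
  destruct (HT2 w Wt Ws) as [_ [_ Z3]]. assert (Ndh : 0 < Cmod (dh (F u))) by (apply Cmod_gt_0, Nh, F1).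
  (* The factor [e^(fst w)] pairs with [|dh (F u)|] to form the modulus of the [w]-derivative, which
     [B2] estimates. *)
  assert (B1 : 1 - Cmod (F u) * Cmod (F u) <= 2 * exp (fst w)).
  { rewrite EF, Cmod_mult, Hx, Rmult_1_l.
    rewrite Cmod_sq_1_cexp. pose proof (Rabs_fst_le (cexp w)) as Q. rewrite Cmod_cexp in Q. apply Rabs_le_between in Q.
    pose proof (exp_pos (fst w)). nra. }
  assert (B2 : exp (fst w) * Cmod (dh (F u)) <= (Cmod c * p * mu) * (exp (p * t0) * mu)).
  { rewrite EF.
    replace (exp (fst w) * Cmod (dh (x * (1 - cexp w))%C)) with (Cmod (dh (x * (1 - cexp w))%C * (- (x * cexp w)))).
    2:{ rewrite !Cmod_mult, Cmod_opp, Cmod_mult, Hx, Cmod_cexp. ring. }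
    pose proof (Cmod_minus_le (dh (x * (1 - cexp w))%C * (- (x * cexp w))) (p * c * cexp (p * w))) as Q.
    rewrite (Cmod_mult (p * c)), (Cmod_mult p), Cmod_cexp_scal, (Cmod_RtoC_pos p) in Q by lra.
    apply Rle_trans with ((p * Cmod c + eps) * exp (p * fst w)); [lra|].
    replace (p * Cmod c + eps) with (Cmod c * p * mu) by (unfold eps; ring).
    apply Rmult_le_compat_l; [repeat apply Rmult_le_pos; lra|].
    rewrite <- Epd, <- exp_plus. apply exp_le. nra. }
  rewrite Cmod_div, Cmod_opp, Exi, Clog in SP by (apply Cmod_gt_0; exact Ndh).
  rewrite Cmod_div in SP by (apply RtoC_neq0; lra).
  rewrite !Cmod_mult, Mlam, Cmod_cexp_scal, Mu, !Cmod_RtoC_pos in SP by lra. simpl in SP.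
  assert (B3 : 1 * exp (q * tau) * q * R0 / xi * (1 - u * u) <= 2 * ((Cmod c * p * mu) * (exp (p * t0) * mu))).
  { apply Rle_trans with (2 * (exp (fst w) * Cmod (dh (F u)))); [|lra].
    apply (Rmult_le_compat_r (Cmod (dh (F u)))) in SP; [|lra].
    replace (1 * exp (q * tau) * q * R0 / xi / Cmod (dh (F u)) * (1 - u * u) * Cmod (dh (F u)))
      with (1 * exp (q * tau) * q * R0 / xi * (1 - u * u)) in SP by (field; lra).
    apply (Rmult_le_compat_r (Cmod (dh (F u)))) in B1; lra. }
  replace (1 * exp (q * tau) * q * R0 / xi * (1 - u * u)) with (exp (q * tau) * (q * (2 - xi / R0))) in B3
    by (unfold u; field; lra).
  replace (2 * (Cmod c * p * mu * (exp (p * t0) * mu))) with (exp (q * tau) * (2 * p * mu * mu)) in B3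
    by (rewrite <- Et0; ring).
  apply Rmult_le_reg_l in B3; [|apply exp_pos]. assert (B4 : 2 * / mu <= 2 - xi / R0).
  { assert (xi / R0 <= 2 * (1 - / mu)); [|lra]. apply Rle_div_l; lra. }
  assert (B5 : q * (2 * / mu) <= 2 * p * mu * mu) by nra. assert (B6 : q <= p * mu * mu * mu).
  { apply (Rmult_le_compat_r mu) in B5; [|lra]. replace (q * (2 * / mu) * mu) with (2 * q) in B5 by (field; lra). lra. }
  assert (B7 : q = p * mu * mu * mu * mu).
  { replace (p * mu * mu * mu * mu) with (p * (mu * mu * mu * mu)) by ring. rewrite Hmu4. field. lra. }
  assert (0 < p * mu * mu * mu) by (repeat apply Rmult_lt_0_compat; lra). nra.
Qed.

(** * Angular limit and radial direction *)

Lemma stolz_limit (h dh : C -> C) (x hx c : C) (p : R) : 0 < p -> Cmod x = 1 ->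
  koenigs_asymptotics h dh x hx c p -> forall M, 1 < M -> forall eps, 0 < eps -> exists d, 0 < d /\
  forall z, Cmod z < 1 -> Cmod (x - z) < M * (1 - Cmod z) -> Cmod (z - x) < d -> Cmod (h z - hx) < eps.
Proof.
  (* With [zeta = 1 - z / x], the Stolz condition gives [|zeta| < M (1 - |z|) <= M Re zeta], so the
     argument of [zeta] is at most [atan M]. *)
  intros Hp Hx HK M HM eps He. pose proof PI_RGT_0. assert (Hb : 0 < atan M < PI / 2).
  { split; [|apply atan_bound]. rewrite <- atan_0. apply atan_increasing. lra. }
  destruct (HK (atan M) Hb 1 Rlt_0_1) as [T1 HT1].
  destruct (exp_threshold p (Cmod c + 1) eps Hp He) as [T2 [_ HT2]].
  exists (exp (Rmin T1 T2)). split; [apply exp_pos|]. intros z Hz Hst Hd.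
  assert (Xx : (x * Cconj x)%C = RtoC 1) by (rewrite <- Cmod2_conj, Hx; f_equal; ring).
  set (zeta := (1 - Cconj x * z)%C). assert (Ez : (x * (1 - zeta))%C = z).
  { unfold zeta. replace (x * (1 - (1 - Cconj x * z)))%C with ((x * Cconj x) * z)%C by ring. rewrite Xx. ring. }
  clearbody zeta. assert (Mz : Cmod zeta = Cmod (z - x)).
  { rewrite <- Ez. replace (x * (1 - zeta) - x)%C with (- (x * zeta))%C by ring.
    rewrite Cmod_opp, Cmod_mult, Hx. ring. }
  assert (Rz : 1 - Cmod z <= fst zeta).
  { rewrite <- Ez, Cmod_mult, Hx, Rmult_1_l. pose proof (Rabs_fst_le (1 - zeta)%C) as Q. simpl in Q.
    pose proof (Rle_abs (1 + - fst zeta)). lra. }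
  rewrite Cmod_minus_sym, <- Mz in Hst. assert (Pz : 0 < fst zeta) by lra. assert (Cz : 0 < Cmod zeta).
  { eapply Rlt_le_trans; [exact Pz|]. eapply Rle_trans; [apply Rle_abs|apply Rabs_fst_le]. }
  pose proof (cexp_clog zeta Pz) as El. assert (Ft : fst (clog zeta) < Rmin T1 T2).
  { simpl. rewrite <- (ln_exp (Rmin T1 T2)). apply ln_increasing; [exact Cz|]. now rewrite Mz. }
  assert (St : Rabs (snd (clog zeta)) <= atan M).
  { simpl. assert (Q : Rabs (snd zeta / fst zeta) < M).
    { unfold Rdiv. rewrite Rabs_mult, (Rabs_pos_eq (/ fst zeta)) by (left; now apply Rinv_0_lt_compat).
      apply Rmult_lt_reg_r with (fst zeta); [exact Pz|]. rewrite Rmult_assoc, Rinv_l, Rmult_1_r by lra.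
      pose proof (Rabs_snd_le zeta). nra. }
    apply Rabs_def2 in Q. apply Rabs_le. rewrite <- atan_opp. split; left; apply atan_increasing; lra. }
  pose proof (Rmin_bounds T1 T2). destruct (HT1 (clog zeta) ltac:(lra) St) as [_ [K _]]. rewrite El, Ez in K.
  specialize (HT2 (fst (clog zeta)) ltac:(lra)).
  pose proof (Cmod_minus_le (h z - hx) (c * cexp (p * clog zeta))) as Q.
  rewrite Cmod_mult, Cmod_cexp_scal in Q. lra.
Qed.

Lemma direction_close (u v : C) : u <> RtoC 0 -> v <> RtoC 0 ->
  Cmod (u * / Cmod u - v * / Cmod v) <= 2 * Cmod (u - v) / Cmod v.
Proof.
  intros Nu Nv. pose proof (proj1 (Cmod_gt_0 _) Nu) as Pu. pose proof (proj1 (Cmod_gt_0 _) Nv) as Pv.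
  assert (N1 : RtoC (Cmod u) <> RtoC 0) by (apply RtoC_neq0; lra).
  assert (N2 : RtoC (Cmod v) <> RtoC 0) by (apply RtoC_neq0; lra). replace (u * / Cmod u - v * / Cmod v)%C
    with (((u - v) + (u * / Cmod u) * (Cmod v - Cmod u)%R) / Cmod v)%C by (rewrite RtoC_minus; field; auto).
  rewrite Cmod_div by exact N2. rewrite (Cmod_RtoC_pos (Cmod v)) by lra.
  apply Rmult_le_compat_r; [left; now apply Rinv_0_lt_compat|]. eapply Rle_trans; [apply Cmod_triangle|].
  rewrite !Cmod_mult, Cmod_inv by exact N1. rewrite (Cmod_RtoC_pos (Cmod u)), Rinv_r, Rmult_1_l, Cmod_R by lra.
  assert (Rabs (Cmod v - Cmod u) <= Cmod (u - v)); [|lra].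
  apply Rabs_le. pose proof (Cmod_minus_le u v). pose proof (Cmod_minus_le v u) as Q. rewrite Cmod_minus_sym in Q. lra.
Qed.

(** On the radius [hx - h] is [- c e^(p t)] up to a small relative error, and the positive factor
    [e^(p t)] disappears on normalising. *)
Lemma radial_direction (h dh : C -> C) (x hx c : C) (p : R) : 0 < p -> c <> RtoC 0 ->
  koenigs_asymptotics h dh x hx c p -> forall eps, 0 < eps -> exists T, forall t, t < T ->
    (hx - h (x * (1 - exp t))%C)%C <> RtoC 0 /\
    Cmod ((hx - h (x * (1 - exp t))%C) * / Cmod (hx - h (x * (1 - exp t))%C) - (- c) * / Cmod (- c)) < eps.
Proof.
  intros Hp Nc HK eps He. pose proof (proj1 (Cmod_gt_0 _) Nc) as Pc. pose proof PI_RGT_0.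
  set (e := Rmin (Cmod c / 2) (eps * Cmod c / 4)).
  assert (He' : 0 < e) by (apply Rmin_pos; [lra|apply Rdiv_lt_0_compat; [apply Rmult_lt_0_compat|]; lra]).
  assert (E1 : e <= Cmod c / 2) by apply Rmin_l. assert (E2 : e <= eps * Cmod c / 4) by apply Rmin_r.
  destruct (HK (PI / 4) ltac:(lra) e He') as [T HT]. exists T. intros t Ht.
  destruct (HT (RtoC t)) as [_ [K _]]; [exact Ht|simpl; rewrite Rabs_R0; lra|].
  rewrite cexp_RtoC, <- RtoC_mult, cexp_RtoC in K. simpl fst in K.
  set (v := (hx - h (x * (1 - exp t))%C)%C). pose proof (exp_pos (p * t)) as P.
  set (v0 := (- c * exp (p * t))%C). assert (D : Cmod (v - v0) <= e * exp (p * t)).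
  { rewrite Cmod_minus_sym. unfold v, v0.
    replace (- c * exp (p * t) - (hx - h (x * (1 - exp t))%C))%C with (h (x * (1 - exp t))%C - hx - c * exp (p * t))%C by ring.
    exact K. }
  assert (M0 : Cmod v0 = Cmod c * exp (p * t)) by (unfold v0; rewrite Cmod_mult, Cmod_opp, Cmod_RtoC_pos; lra).
  assert (N0 : v0 <> RtoC 0) by (apply Cmod_gt_0; rewrite M0; nra). assert (Nv : v <> RtoC 0).
  { apply Cmod_gt_0. pose proof (Cmod_minus_le v0 v). rewrite Cmod_minus_sym, M0 in H0.
    assert (e * exp (p * t) <= Cmod c / 2 * exp (p * t)) by (apply Rmult_le_compat_r; lra).
    assert (0 < Cmod c * exp (p * t)) by now apply Rmult_lt_0_compat. lra. }
  split; [exact Nv|]. assert (Ev : (v0 * / Cmod v0)%C = (- c * / Cmod (- c))%C).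
  { rewrite M0, Cmod_opp, RtoC_mult. unfold v0. field. split; apply RtoC_neq0; lra. }
  rewrite <- Ev. eapply Rle_lt_trans; [now apply direction_close|]. rewrite M0.
  apply Rlt_div_l; [now apply Rmult_lt_0_compat|].
  assert (e * exp (p * t) <= eps * Cmod c / 4 * exp (p * t)) by (apply Rmult_le_compat_r; lra).
  assert (0 < eps * (Cmod c * exp (p * t))) by (apply Rmult_lt_0_compat; [exact He|now apply Rmult_lt_0_compat]). lra.
Qed.

(** * Koenigs functions *)

(** Two first-order expansions of [h (phi s z)] at [s = 0+] are equated: one by the chain rule, the
    other from the functional equation. The latter enters through its derivative [e0], so both
    positions of the Denjoy-Wolff point share the argument. *)
Lemma koenigs_ode (phi : R -> C -> C) (h G : C -> C) (e0 z d : C) :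
  cdiff h z d ->
  (forall eps, 0 < eps -> exists dl, 0 < dl /\ forall s, 0 < s < dl -> Cmod (phi s z - z - s * G z) <= eps * s) ->
  (forall eps, 0 < eps -> exists dl, 0 < dl /\ forall s, 0 < s < dl -> Cmod (h (phi s z) - h z - s * e0) <= eps * s) ->
  (d * G z)%C = e0.
Proof.
  intros Hd HG He. apply (Cmod_le_all_eps _ _ (Cmod d + Cmod (G z) + 2)). intros eps Heps.
  set (e := Rmin eps 1). assert (He0 : 0 < e) by (apply Rmin_pos; lra).
  assert (e <= eps) by apply Rmin_l. assert (e <= 1) by apply Rmin_r. clearbody e.
  destruct (Hd e He0) as [d1 [D1 K1]]. destruct (HG e He0) as [d2 [D2 K2]]. destruct (He e He0) as [d3 [D3 K3]].
  pose proof (Cmod_ge_0 (G z)) as PG. pose proof (Cmod_ge_0 d) as Pd.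
  set (s := Rmin (d1 / (Cmod (G z) + 1)) (Rmin d2 d3) / 2).
  assert (Q1 : 0 < d1 / (Cmod (G z) + 1)) by (apply Rdiv_lt_0_compat; lra).
  assert (Q2 : 0 < Rmin (d1 / (Cmod (G z) + 1)) (Rmin d2 d3)) by (repeat apply Rmin_pos; assumption).
  pose proof (Rmin_bounds (d1 / (Cmod (G z) + 1)) (Rmin d2 d3)). pose proof (Rmin_bounds d2 d3).
  assert (Hs : 0 < s) by (unfold s; lra).
  specialize (K2 s ltac:(unfold s in *; lra)). specialize (K3 s ltac:(unfold s in *; lra)).
  assert (Np : Cmod (phi s z - z) <= s * (Cmod (G z) + 1)).
  { pose proof (Cmod_minus_le (phi s z - z) (s * G z)) as Q. rewrite Cmod_mult, Cmod_RtoC_pos in Q by lra.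
    assert (e * s <= 1 * s) by (apply Rmult_le_compat_r; lra). lra. }
  assert (Hlt : Cmod (phi s z - z) < d1).
  { eapply Rle_lt_trans; [exact Np|].
    apply Rlt_le_trans with (d1 / (Cmod (G z) + 1) * (Cmod (G z) + 1)); [|right; field; lra].
    apply Rmult_lt_compat_r; [lra|]. unfold s; lra. }
  specialize (K1 _ Hlt).
  apply Rmult_le_reg_l with s; [exact Hs|]. rewrite <- (Cmod_RtoC_pos s) at 1 by lra. rewrite <- Cmod_mult.
  replace (s * (d * G z - e0))%C
    with ((h (phi s z) - h z - s * e0) - (h (phi s z) - h z - d * (phi s z - z)) - d * (phi s z - z - s * G z))%C by ring.
  eapply Rle_trans; [apply Cmod_minus_triangle|]. eapply Rle_trans; [apply Rplus_le_compat_r, Cmod_minus_triangle|].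
  rewrite Cmod_mult.
  assert (Cmod d * Cmod (phi s z - z - s * G z) <= Cmod d * (e * s)) by (apply Rmult_le_compat_l; lra).
  assert (e * Cmod (phi s z - z) <= e * (s * (Cmod (G z) + 1))) by (apply Rmult_le_compat_l; lra).
  apply Rle_trans with (s * (e * (Cmod d + Cmod (G z) + 2))); [lra|].
  apply Rmult_le_compat_l; [lra|]. apply Rmult_le_compat_r; lra.
Qed.

Lemma exp_scal_remainder (g v : C) : forall eps, 0 < eps -> exists dl, 0 < dl /\
  forall s, 0 < s < dl -> Cmod (cexp (s * g) * v - v - s * (g * v)) <= eps * s.
Proof.
  intros eps He. pose proof (Cmod_ge_0 g) as Pg. pose proof (Cmod_ge_0 v) as Pv.
  set (e := eps / ((Cmod g + 1) * (Cmod v + 1))).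
  assert (He' : 0 < e) by (unfold e; apply Rdiv_lt_0_compat; nra). destruct (cdiff_cexp_0 e He') as [d [Hd K]].
  exists (d / (Cmod g + 1)). split; [apply Rdiv_lt_0_compat; lra|]. intros s Hs.
  assert (Msg : Cmod (s * g) = s * Cmod g) by (rewrite Cmod_mult, Cmod_RtoC_pos; lra).
  specialize (K (s * g)%C). replace (s * g - 0)%C with (s * g)%C in K by ring. rewrite cexp_0, Msg in K.
  assert (Hlt : s * Cmod g < d).
  { apply Rle_lt_trans with (s * (Cmod g + 1)); [apply Rmult_le_compat_l; lra|].
    apply Rlt_le_trans with (d / (Cmod g + 1) * (Cmod g + 1)); [|right; field; lra].
    apply Rmult_lt_compat_r; lra. }
  specialize (K Hlt).
  replace (cexp (s * g) * v - v - s * (g * v))%C with ((cexp (s * g) - 1 - 1 * (s * g)) * v)%C by ring.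
  rewrite Cmod_mult. apply Rle_trans with (e * (s * Cmod g) * Cmod v); [apply Rmult_le_compat_r; lra|].
  apply Rle_trans with (e * (s * (Cmod g + 1)) * (Cmod v + 1)).
  - apply Rmult_le_compat; [apply Rmult_le_pos; [lra|apply Rmult_le_pos; lra]|lra| |lra].
    apply Rmult_le_compat_l; [lra|]. apply Rmult_le_compat_l; lra.
  - right. unfold e. field. lra.
Qed.

(** * Koenigs equation and singularity in terms of the given definitions *)

Lemma Defs_Cmod (z : C) : Defs.Cmod z = Cmod z.
Proof. unfold Defs.Cmod, Cmod. f_equal. ring. Qed.

Lemma is_Cderiv_cdiff (f : C -> C) (z d : C) : Cmod z < 1 -> is_Cderiv f z d -> cdiff f z d.
Proof.
  intros Hz H e He. destruct (H e He) as [dl [Hd K]].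
  exists (Rmin dl (1 - Cmod z)). split; [apply Rmin_pos; lra|]. intros w Hw.
  destruct (Rmin_Rgt_l _ _ _ Hw) as [W1 W2].
  unfold inD in K. specialize (K w). rewrite !Defs_Cmod in K. apply K; [|exact W1].
  pose proof (Cmod_minus_le w z). lra.
Qed.

Lemma Cscal_Cmult (r : R) (z : C) : Cscal r z = (r * z)%C.
Proof. apply injective_projections; simpl; ring. Qed.

Lemma generator_at_0 (phi : R -> C -> C) (G : C -> C) :
  (forall z, inD z -> phi 0 z = z) -> is_generator phi G ->
  forall z, Cmod z < 1 -> forall eps, 0 < eps -> exists dl, 0 < dl /\
    forall s, 0 < s < dl -> Cmod (phi s z - z - s * G z) <= eps * s.
Proof.
  intros S3 Hgen z Hz eps He. assert (Hz' : inD z) by (unfold inD; now rewrite Defs_Cmod).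
  destruct (Hgen 0 z (Rle_refl 0) Hz' eps He) as [dl [Hd K]]. exists dl. split; [exact Hd|]. intros s Hs.
  specialize (K s ltac:(lra)). rewrite (S3 z Hz'), Rminus_0_r, (Rabs_pos_eq s), Defs_Cmod, Cscal_Cmult in K by lra.
  apply K. lra.
Qed.

(** The constants are [0] and [G'(tau)] for an interior Denjoy-Wolff point, [1] and [0] for a
    boundary one. The second conclusion holds in the interior case because [h] vanishes only at
    [tau]. *)
Lemma koenigs_equation (phi : R -> C -> C) (G : C -> C) (tau : C) (h : C -> C) (x : C) :
  is_semigroup phi -> is_generator phi G -> is_Koenigs phi G tau h -> Cmod x = 1 ->
  exists c1 c2 : C,
    (forall z d, Cmod z < 1 -> cdiff h z d -> (d * G z)%C = (c1 + c2 * h z)%C /\ d <> RtoC 0) /\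
    (exists T, forall t, t < T -> (c1 + c2 * h (x * (1 - exp t))%C)%C <> RtoC 0).
Proof.
  intros [S1 [S2 [S3 [_ [_ S6]]]]] Hgen [[_ Hinj] Hk] Hx. unfold inD in *.
  pose proof (generator_at_0 phi G S3 Hgen) as Hgen0.
  destruct Hk as [[Htau [gp [_ [Hh0 [Hh1 Hsem]]]]] | [_ [_ Hsem]]].
  - assert (Htau' : Cmod tau < 1) by now rewrite <- Defs_Cmod. assert (Ngp : gp <> RtoC 0).
    (* A zero multiplier would make [h (phi 1 z) = h z], so [phi 1] would be the identity, an
       automorphism. *)
    { intro E. apply (S6 1 Rlt_0_1). assert (Id : forall z, Defs.Cmod z < 1 -> phi 1 z = z).
      { intros z Hz. apply Hinj; [apply S2; auto; lra|exact Hz|]. rewrite Hsem by (auto; lra). rewrite E, Cscal_Cmult.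
        replace (1 * 0)%C with (RtoC 0) by ring. change (Defs.Cexp (RtoC 0)) with (cexp 0). rewrite cexp_0.
        change ((1 * h z)%C = h z). ring. }
      unfold is_automorphism_D, inD. split; [apply S1; lra|]. split; [intros z Hz; apply S2; auto; lra|]. split.
      - intros z w Hz Hw. now rewrite !Id.
      - intros w Hw. exists w. split; [exact Hw|now apply Id]. }
    exists (RtoC 0), gp. assert (Ode : forall z d, Cmod z < 1 -> cdiff h z d -> (d * G z)%C = (0 + gp * h z)%C).
    { intros z d Hz Hd. apply (koenigs_ode phi h G _ z d Hd); [now apply Hgen0|].
      intros eps He. destruct (exp_scal_remainder gp (h z) eps He) as [dl [Hdl K]].
      exists dl. split; [exact Hdl|]. intros s Hs. specialize (K s Hs).
      rewrite Hsem by (rewrite ?Defs_Cmod; lra). rewrite Cscal_Cmult.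
      replace (0 + gp * h z)%C with (gp * h z)%C by ring. exact K. }
    split.
    + intros z d Hz Hd. split; [now apply Ode|]. intro E. pose proof (Ode z d Hz Hd) as O. rewrite E in O.
      assert (Hz0 : h z = RtoC 0).
      { apply NNPP. intro N. apply (Cmult_neq_0 gp (h z) Ngp N).
        replace (gp * h z)%C with (0 + gp * h z)%C by ring. rewrite <- O. ring. }
      assert (Ez : z = tau) by (apply Hinj; rewrite ?Defs_Cmod; auto; rewrite Hz0; symmetry; exact Hh0).
      subst z. pose proof (cdiff_unique _ _ _ _ Hd (is_Cderiv_cdiff _ _ _ Hz Hh1)) as U.
      rewrite E in U. apply RtoC_inj in U. lra.
    (* Beyond this threshold the radial point has modulus [1 - e^t > |tau|] and cannot be [tau]. *)
    + exists (ln (1 - Cmod tau)). intros t Ht. replace (0 + gp * h (x * (1 - exp t))%C)%C with (gp * h (x * (1 - exp t))%C)%C by ring.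
      assert (Et : exp t < 1 - Cmod tau).
      { rewrite <- (exp_ln (1 - Cmod tau)) by lra. now apply exp_increasing. }
      pose proof (exp_pos t). pose proof (Cmod_ge_0 tau). assert (Mz : Cmod (x * (1 - exp t)) = 1 - exp t).
      { rewrite Cmod_mult, Hx, <- RtoC_minus, Cmod_RtoC_pos; lra. }
      apply Cmult_neq_0; [exact Ngp|]. intro E. assert (Ez : (x * (1 - exp t))%C = tau).
      { apply Hinj; rewrite ?Defs_Cmod, ?Mz; try lra. rewrite E. symmetry. exact Hh0. }
      rewrite Ez in Mz. lra.
  - exists (RtoC 1), (RtoC 0).
    assert (Ode : forall z d, Cmod z < 1 -> cdiff h z d -> (d * G z)%C = (1 + 0 * h z)%C).
    { intros z d Hz Hd. apply (koenigs_ode phi h G _ z d Hd); [now apply Hgen0|].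
      intros eps He. exists 1. split; [lra|]. intros s Hs. rewrite Hsem by (rewrite ?Defs_Cmod; lra).
      replace (Cadd (h z) (Defs.RtoC s) - h z - s * (1 + 0 * h z))%C with (RtoC 0)
        by (apply injective_projections; simpl; ring).
      rewrite Cmod_0. nra. }
    assert (One : forall v : C, (1 + 0 * v)%C <> RtoC 0).
    { intros v E. replace (1 + 0 * v)%C with (RtoC 1) in E by ring. apply RtoC_inj in E. lra. }
    split.
    + intros z d Hz Hd. split; [now apply Ode|]. intro E. pose proof (Ode z d Hz Hd) as O. rewrite E in O.
      apply (One (h z)). rewrite <- O. ring.
    + exists 0. intros t _. apply One.
Qed.

(** The substitution [r = 1 - e^t] turns [(1 - r)^al] into [e^(al t)]. *)
Lemma regular_singularity_radial (G : C -> C) (x : C) (al : R) : regular_singularity G x al ->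
  exists L : C, L <> RtoC 0 /\ forall eps, 0 < eps -> exists T, forall t, t < T ->
    Cmod (G (x * (1 - exp t))%C * exp (- (al * t)) - L) < eps.
Proof.
  intros [L [NL HL]]. exists L. split; [exact NL|]. intros eps He.
  destruct (HL eps He) as [d [Hd K]]. exists (ln d). intros t Ht.
  assert (Et : exp t < d) by (rewrite <- (exp_ln d) by exact Hd; now apply exp_increasing).
  pose proof (exp_pos t). specialize (K (1 - exp t) ltac:(lra)). rewrite Defs_Cmod, Cscal_Cmult in K.
  replace (1 - (1 - exp t)) with (exp t) in K by ring. unfold Rpower in K. rewrite ln_exp in K.
  pose proof (exp_pos (al * t)).
  assert (E : Defs.Cdiv (G ((1 - exp t)%R * x)%C) (Defs.RtoC (exp (al * t))) = (G (x * (1 - exp t))%C * exp (- (al * t)))%C).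
  { rewrite exp_Ropp, RtoC_minus, (Cmult_comm x). apply injective_projections; simpl; field; lra. }
  rewrite E in K. exact K.
Qed.

Lemma sector_point_conversion (hx c : C) (r th : R) : c <> RtoC 0 ->
  Csub hx (Cmul (- c * / Cmod (- c))%C (Cscal r (Defs.Cexp (Cmul Defs.Ci (Defs.RtoC th)))))
  = (hx + c * / Cmod c * (r * cexp (Ci * th)))%C.
Proof.
  intro Nc. rewrite Cscal_Cmult.
  change ((hx - (- c * / Cmod (- c)) * (r * cexp (Ci * th)))%C = (hx + c * / Cmod c * (r * cexp (Ci * th)))%C).
  rewrite Cmod_opp. ring.
Qed.

(** * Asymptotics at a regular singularity and the sector theorem *)

Lemma koenigs_regular_singularity (phi : R -> C -> C) (G : C -> C) (tau : C) (h : C -> C) (x : C) (al : R) :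
  is_semigroup phi -> is_generator phi G -> is_Koenigs phi G tau h -> Cmod x = 1 -> al < 1 ->
  regular_singularity G x al ->
  exists (dh : C -> C) (hx c : C), c <> RtoC 0 /\
    (forall z, Cmod z < 1 -> cdiff h z (dh z)) /\ (forall z, Cmod z < 1 -> dh z <> RtoC 0) /\
    koenigs_asymptotics h dh x hx c (1 - al).
Proof.
  intros Hsg Hgen Hk Hx Hal Hreg.
  destruct (koenigs_equation phi G tau h x Hsg Hgen Hk Hx) as [c1 [c2 [Hode HE]]].
  destruct Hsg as [S1 [S2 [S3 _]]]. destruct Hk as [[Hhol _] _]. unfold inD in *.
  assert (Hh : forall z, exists d, Cmod z < 1 -> cdiff h z d).
  { intro z. destruct (Rlt_le_dec (Cmod z) 1) as [Hz|Hz]; [|exists (RtoC 0); intro; lra].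
    destruct (Hhol z) as [d Hd]; [unfold inD; now rewrite Defs_Cmod|]. exists d. intros _. now apply is_Cderiv_cdiff. }
  set (dh := fun z => proj1_sig (constructive_indefinite_description _ (Hh z))).
  assert (Hdh : forall z, Cmod z < 1 -> cdiff h z (dh z)).
  { intros z Hz. unfold dh. destruct (constructive_indefinite_description _ (Hh z)) as [d Hd]. now apply Hd. }
  assert (Ndh : forall z, Cmod z < 1 -> dh z <> RtoC 0).
  { intros z Hz. apply (Hode z (dh z) Hz (Hdh z Hz)). }
  assert (Hode' : forall z, Cmod z < 1 -> (dh z * G z = c1 + c2 * h z)%C).
  { intros z Hz. apply (Hode z (dh z) Hz (Hdh z Hz)). }
  assert (Near : forall z w : C, Cmod (w - z)%C < 1 - Cmod z -> Cmod w < 1).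
  { intros z w Hw. pose proof (Cmod_minus_le w z). lra. }
  assert (HG : forall z, Cmod z < 1 -> hol G z).
  { intros z Hz. apply (hol_ext_loc (fun w => (c1 + c2 * h w) / dh w)%C G z (1 - Cmod z)); [lra| |].
    - intros w Hw. apply Near in Hw. rewrite <- (Hode' w Hw). field. now apply Ndh.
    - apply hol_div; [| |now apply Ndh].
      + apply hol_plus; [apply hol_const|]. apply hol_mult; [apply hol_const|]. eexists. now apply Hdh.
      + apply (hol_derivative h dh z (1 - Cmod z)); [lra|]. intros w Hw. apply Hdh. now apply Near in Hw. }
  assert (Hq : forall a, Cmod a < 1 ->
    fst (Cconj a * (G a - G 0))%C + Cmod a * Cmod a * fst (Cconj (G 0) * a)%C <= 0).
  { intros a Ha. apply (generator_inequality phi G a); [| |exact Ha].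
    - intros s z Hs Hz. assert (Hz' : Defs.Cmod z < 1) by now rewrite Defs_Cmod. split.
      + destruct (S1 s ltac:(lra) z Hz') as [d Hd]. exists d. now apply is_Cderiv_cdiff.
      + rewrite <- Defs_Cmod. apply S2; [lra|exact Hz'].
    - intros z eps Hz He. now apply (generator_at_0 phi G S3 Hgen). }
  destruct (regular_singularity_radial G x al Hreg) as [L [NL HL]].
  destruct (koenigs_strip h dh G c1 c2 x L al Hx Hal NL Hdh Hode'
    (generator_strip G x L al Hx Hal HG Hq HL) HE) as [hx [c [Nc HK]]].
  exists dh, hx, c. repeat split; assumption.
Qed.

Import Defs.

Theorem theorem6p7 (phi : R -> Cx -> Cx) (G : Cx -> Cx) (tau : Cx) (h : Cx -> Cx)
  (x : Cx) (alpha : R) :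
  is_semigroup phi -> is_generator phi G -> is_DW_point phi tau ->
  is_Koenigs phi G tau h ->
  Cmod x = 1 -> -1 <= alpha < 1 -> alpha <> 0 ->
  regular_singularity G x alpha ->
  exists hx, angular_limit h x hx /\
  exists nu,
    (exists r0, r0 < 1 /\ forall r, r0 < r < 1 -> Csub hx (h (Cscal r x)) <> RtoC 0) /\
    lim_left1 (fun r => Cscal (/ Cmod (Csub hx (h (Cscal r x)))) (Csub hx (h (Cscal r x)))) nu /\
    (forall theta, 0 < theta < (1 - alpha) * PI ->
       exists rho, 0 < rho /\ sector_in_image h hx nu theta rho) /\
    (forall theta, (1 - alpha) * PI < theta ->
       forall rho, 0 < rho -> ~ sector_in_image h hx nu theta rho).
Proof.
  intros Hsg Hgen _ Hk Hx Hal _ Hreg. rewrite Defs_Cmod in Hx.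
  destruct (koenigs_regular_singularity phi G tau h x alpha Hsg Hgen Hk Hx (proj2 Hal) Hreg)
    as [dh [hx [c [Nc [Hdh [Ndh HK]]]]]].
  destruct Hk as [[_ Hinj] _]. unfold inD in *.
  set (p := 1 - alpha) in *. assert (Hp : 0 < p) by (unfold p; lra).
  assert (Hhol' : forall z, Complex.Cmod z < 1 -> hol h z) by (intros z Hz; eexists; now apply Hdh).
  exists hx. split.
  { intros M HM eps He. destruct (stolz_limit h dh x hx c p Hp Hx HK M HM eps He) as [d [Hd K]].
    exists d. split; [exact Hd|]. intros z. unfold inD. rewrite !Defs_Cmod. apply K. }
  (* Since [hx - h] behaves like [- c e^(p t)], the direction is [- c / |c|]; the sector
     [hx - nu r e^(i th)] thus opens from [hx] along [c], in agreement with the expansion of [h]. *)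
  exists (- c * / Complex.Cmod (- c)%C)%C. pose proof (radial_direction h dh x hx c p Hp Nc HK) as Hrad.
  assert (Er : forall r, r < 1 -> Cscal r x = (x * (1 - exp (ln (1 - r))))%C).
  { intros r Hr. rewrite exp_ln by lra. apply injective_projections; simpl; ring. }
  assert (Lr : forall r T, 1 - exp T < r < 1 -> ln (1 - r) < T).
  { intros r T Hr. rewrite <- (ln_exp T). apply ln_increasing; lra. }
  split; [|split; [|split]].
  - destruct (Hrad 1 Rlt_0_1) as [T HT]. exists (1 - exp T). split; [pose proof (exp_pos T); lra|].
    intros r Hr. rewrite Er by lra. apply (HT (ln (1 - r))). now apply Lr.
  - intros eps He. destruct (Hrad eps He) as [T HT]. exists (exp T). split; [apply exp_pos|].
    intros r Hr. rewrite Defs_Cmod. destruct (HT (ln (1 - r)) (Lr r T Hr)) as [HT1 HT2]. rewrite Er by lra.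
    set (v := (hx - h (x * (1 - exp (ln (1 - r))))%C)%C) in *. change (Csub hx (h (x * (1 - exp (ln (1 - r))))%C)) with v.
    rewrite Defs_Cmod, Cscal_Cmult, RtoC_inv, Cmult_comm; [exact HT2|]. apply Cmod_gt_0 in HT1. lra.
  - intros theta Hth. destruct (sector_inside h dh x hx c p theta Hp Nc Hhol' HK Hth) as [rho [Hrho K]].
    exists rho. split; [exact Hrho|]. intros th r H1 H2. destruct (K th r H1 H2) as [z [Hz1 Hz2]].
    exists z. unfold inD. rewrite Defs_Cmod. split; [exact Hz1|]. rewrite sector_point_conversion by exact Nc. exact Hz2.
  - intros theta Hth rho Hrho Hsec. apply (sector_outside h dh x hx c p theta rho Hp Hx Nc Hdh Ndh); auto.
    + intros z w Hz Hw. apply Hinj; now rewrite Defs_Cmod.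
    + intros th r H1 H2. destruct (Hsec th r H1 H2) as [z [Hz1 Hz2]].
      exists z. rewrite <- Defs_Cmod. split; [exact Hz1|]. rewrite <- sector_point_conversion by exact Nc. exact Hz2.
Qed.
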